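(* There exist $\alpha\in(0,2\pi)$ such that, for the sector $S(\alpha)$, $\kappa_1(S(\alpha))<\mu_2(S(\alpha))$ while all Neumann Laplacian eigenfunctions of $\mu_2(S(\alpha))$ are antisymmetric (odd) with respect to the $x$-axis.
   Context: In polar coordinates $(r,\theta)$ in $\mathbb{R}^2$, $S(\alpha)=\{0\le r\le1,\ |\theta|<\alpha/2\}$ is the circular sector of opening angle $\alpha$, symmetric about the $x$-axis (as a domain, take its interior). $\mu_2(\Omega)$ is the second Neumann Laplacian eigenvalue of $\Omega$ (the first being $0$), and $$\kappa_1(\Omega)=\inf\Big\{\frac{\int_\Omega|\nabla u|^2\,dx}{\int_\Omega u^2\,dx}:\ u\in H^1(\Omega)\setminus\{0\},\ \int_{\partial\Omega}u\,d\sigma=0\Big\},$$ with $d\sigma$ the arc-length measure on $\partial\Omega$. *)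

(* Defs.v *)
From HB Require Import structures.
From mathcomp Require Import all_boot all_order all_algebra.
From mathcomp Require Import all_classical all_reals all_analysis.
From mathcomp Require Import measurable_realfun.

Set Implicit Arguments.
Unset Strict Implicit.
Unset Printing Implicit Defensive.

Import Order.TTheory GRing.Theory Num.Theory.
Import numFieldNormedType.Exports.

Local Open Scope classical_set_scope.
Local Open Scope ring_scope.

(* [lebesgue_measure] lives on [measurableTypeR R], whose carrier is convertible
   to [R]; sets and functions on the plane are typed over [R * R], where the
   topology is found, and are read over [mplane R] when integrated. *)
Definition mplane (R : realType) : measurableType _ :=
  (measurableTypeR R * measurableTypeR R)%type.

Definition area (R : realType) : {measure set (mplane R) -> \bar R} :=
  (@lebesgue_measure R \x @lebesgue_measure R)%E.

Definition dot (R : realType) (a b : R * R) : R := a.1 * b.1 + a.2 * b.2.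

Section calculus.
Context {R : realType}.
Implicit Types (f : R * R -> R) (Omega : set (R * R)).

Definition partial1 f : R * R -> R := 'D_((1, 0) : R * R) f.
Definition partial2 f : R * R -> R := 'D_((0, 1) : R * R) f.
Definition gradient f (p : R * R) : R * R := (partial1 f p, partial2 f p).

Fixpoint Ck (k : nat) f : Prop :=
  continuous f /\
  if k is k'.+1 then
    [/\ forall p, derivable f p ((1, 0) : R * R),
        forall p, derivable f p ((0, 1) : R * R),
        Ck k' (partial1 f) & Ck k' (partial2 f)]
  else True.

Definition smooth f : Prop := forall k, Ck k f.

Definition test_function Omega f : Prop :=
  [/\ smooth f, compact (closure [set p | f p != 0])
    & closure [set p | f p != 0] `<=` Omega].

End calculus.

Definition L2 d (T : measurableType d) (R : realType)
    (m : {measure set T -> \bar R}) (D : set T) (f : T -> R) : Prop :=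
  measurable_fun D f /\ m.-integrable D (fun x => (f x ^+ 2)%:E).

Section sobolev.
Context {R : realType}.
Implicit Types (Omega : set (R * R)) (u v w : R * R -> R)
  (g h : R * R -> R * R).

Definition weak_gradient Omega u g : Prop :=
  forall phi, test_function Omega phi ->
    (\int[area R]_(p in Omega) (u p * partial1 phi p) =
      - (\int[area R]_(p in Omega) ((g p).1 * phi p))) /\
    (\int[area R]_(p in Omega) (u p * partial2 phi p) =
      - (\int[area R]_(p in Omega) ((g p).2 * phi p))).

(* u is in H^1(Omega), and g represents its weak gradient. *)
Definition H1 Omega u g : Prop :=
  [/\ L2 (area R) Omega u,
      L2 (area R) Omega (fun p => (g p).1),
      L2 (area R) Omega (fun p => (g p).2)
    & weak_gradient Omega u g].

Definition ae_zero Omega u : Prop :=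
  {ae area R, forall p, Omega p -> u p = 0}.

(* Weak form of: - Laplacian u = mu u in Omega, with du/dn = 0 on the boundary. *)
Definition neumann_eigenfunction Omega (mu : R) u : Prop :=
  ~ ae_zero Omega u /\
  exists2 g, H1 Omega u g &
    forall v h, H1 Omega v h ->
      \int[area R]_(p in Omega) dot (g p) (h p) =
        mu * (\int[area R]_(p in Omega) (u p * v p)).

(* There are at least k Neumann eigenvalues <= t, counted with multiplicity. *)
Definition neumann_count_ge Omega (k : nat) (t : R) : Prop :=
  exists (u : 'I_k -> R * R -> R) (l : 'I_k -> R),
    (forall i, neumann_eigenfunction Omega (l i) (u i) /\ l i <= t) /\
    (forall c : 'I_k -> R,
      ae_zero Omega (fun p => \sum_(i < k) c i * u i p) -> forall i, c i = 0).

(* mu is the k-th eigenvalue mu_1 <= mu_2 <= ... of the Neumann Laplacian,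
   counted with multiplicity (k starts at 1, and mu_1 = 0). *)
Definition is_neumann_eigenvalue Omega (k : nat) (mu : R) : Prop :=
  neumann_count_ge Omega k mu /\
  forall t, neumann_count_ge Omega k t -> mu <= t.

(* w is the boundary trace of u: the L^2(boundary) limit of the restrictions of
   smooth functions converging to u in H^1(Omega), which determines w when
   Omega is a bounded Lipschitz domain. Here sigma is the arc-length measure of
   the boundary of Omega, as a measure on the plane. *)
Definition trace Omega (sigma : {measure set (mplane R) -> \bar R}) u w : Prop :=
  L2 sigma setT w /\
  exists g (phi : nat -> R * R -> R),
    [/\ H1 Omega u g,
        forall n, smooth (phi n),
        (\int[area R]_(p in Omega) ((phi n p - u p) ^+ 2)%:E)%E
          @[n --> \oo] --> 0%E,
        (\int[area R]_(p in Omega)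
            (dot (gradient (phi n) p - g p) (gradient (phi n) p - g p))%:E)%E
          @[n --> \oo] --> 0%E
      & (\int[sigma]_p ((phi n p - w p) ^+ 2)%:E)%E @[n --> \oo] --> 0%E].

Definition kappa1 Omega (sigma : {measure set (mplane R) -> \bar R}) : \bar R :=
  ereal_inf [set q : \bar R | exists u g,
    [/\ H1 Omega u g, ~ ae_zero Omega u,
        exists2 w, trace Omega sigma u w & \int[sigma]_p w p = 0
      & q = ((\int[area R]_(p in Omega) dot (g p) (g p)) /
             (\int[area R]_(p in Omega) (u p ^+ 2)))%:E]].

Definition odd_in_y Omega u : Prop :=
  {ae area R, forall p, Omega p -> u (p.1, - p.2) = - u p}.

End sobolev.

Section sector.
Context {R : realType}.

Definition polar (r t : R) : R * R := (r * cos t, r * sin t).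

Definition sector (alpha : R) : set (R * R) :=
  ([set p | exists r t : R,
    [/\ 0 <= r <= 1, `|t| < alpha / 2 & p = polar r t]])°.

Definition ray (t : R) (r : measurableTypeR R) : mplane R := polar r t.
Definition circle (t : measurableTypeR R) : mplane R := polar 1 t.

Lemma measurable_ray t :
  measurable_fun [set: measurableTypeR R] (ray t).
Proof.
by apply: measurable_fun_pair; exact: mulrr_measurable.
Qed.

Lemma measurable_circle :
  measurable_fun [set: measurableTypeR R] circle.
Proof.
apply: measurable_fun_pair;
  apply: (measurableT_comp (mulrl_measurable _));
  apply: continuous_measurable_fun.
- exact: continuous_cos.
- exact: continuous_sin.
Qed.

HB.instance Definition _ t := isMeasurableFun.Build _ _ _ _ (ray t)
  (measurable_ray t).
HB.instance Definition _ := isMeasurableFun.Build _ _ _ _ circle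
  measurable_circle.

End sector.

(* For an injective unit-speed parametrization gamma of an arc, this is the
   arc-length measure of gamma([a, b]), as a measure on the plane. *)
Definition arc_length (R : realType) (gamma : {mfun measurableTypeR R >-> mplane R})
    (a b : R) : set (mplane R) -> \bar R :=
  pushforward (mrestr (@lebesgue_measure R) (measurable_itv `[a, b])) gamma.

Section arc_length_measure.
Context (R : realType) (gamma : {mfun measurableTypeR R >-> mplane R}) (a b : R).

Let arc_length0 : arc_length gamma a b set0 = 0%E.
Proof. by rewrite /arc_length /pushforward preimage_set0 measure0. Qed.

Let arc_length_ge0 A : (0 <= arc_length gamma a b A)%E.
Proof. exact: measure_ge0. Qed.

Let arc_length_sigma_additive : semi_sigma_additive (arc_length gamma a b).
Proof.
exact: (@measure_semi_sigma_additive _ _ _ (pushforward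
  (mrestr (@lebesgue_measure R) (measurable_itv `[a, b])) gamma)).
Qed.

HB.instance Definition _ := isMeasure.Build _ _ _ (arc_length gamma a b)
  arc_length0 arc_length_ge0 arc_length_sigma_additive.

End arc_length_measure.

(* The boundary of the sector: its two radii and its circular arc. *)
Definition sector_arc_length (R : realType) (alpha : R) :
    {measure set (mplane R) -> \bar R} :=
  measure_add (measure_add (arc_length (ray (- (alpha / 2))) 0 1)
                           (arc_length (ray (alpha / 2)) 0 1))
              (arc_length circle (- (alpha / 2)) (alpha / 2)).

(* Main.v *)
(* For S(alpha) put nu = pi / alpha. The function J_nu(k r) sin(nu theta) is an
   odd Neumann eigenfunction as soon as k is a critical point of J_nu, whereas
   the first radial one is J_0(j r), with j = j_{1,1} the first zero of J_0'. The
   angle is chosen so that k is slightly below j, which happens for some nu in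
   [5/2, 3]: then mu_2 = k^2 and all the other separated modes lie strictly
   higher. On the other hand u = J_0(j r) - c, with c chosen so that u has mean
   zero on the boundary, has Rayleigh quotient j^2 N / (N + c^2 |S|), with
   N = int J_0(j r)^2 <= |S|, because J_0(j r) has mean zero on S(alpha). As c is
   bounded away from 0, this is at most j^2 / (1 + c0^2), which is below k^2 when
   k is close enough to j.

   No compactness is needed to identify the spectrum. If u is an eigenfunction
   for la, then Green's formula makes u orthogonal to (Laplacian + la) w for every
   separated w satisfying the Neumann condition. For every angular mode that is
   not resonant at la one can solve (Laplacian + la) w = A(r) cos(n nu (theta +
   alpha / 2)) by reduction of order, so that the n-th cosine coefficient of u
   vanishes; the cosine modes are complete. *)
From HB Require Import structures.
Require Import Defs.
From mathcomp Require Import all_boot all_order all_algebra.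
From mathcomp Require Import all_classical all_reals all_analysis.
From mathcomp Require Import measurable_realfun.
From mathcomp Require Import ring lra.

Set Implicit Arguments.
Unset Strict Implicit.
Unset Printing Implicit Defensive.

Import Order.TTheory GRing.Theory Num.Theory.
Import numFieldNormedType.Exports.

Local Open Scope classical_set_scope.
Local Open Scope ring_scope.

(** * Smooth functions of one variable *)

Section smooth1.
Context {R : realType}.
Implicit Types (I J : set R) (f g : R -> R) (k : nat).

(** With [t = k^2 / 4] the Bessel functions become power series in [t r^2] and every eigenvalue
    reads [4 * t]; in this scale the first radial level is [t0], about 3.67. What shapes the proof
    is how little room there is for [c]. It is the boundary mean of J_0(j r): over the perimeter the
    two radii contribute at least 0.55, while the arc can take away almost 0.525, because J_0(j) is
    about -0.40. Since the arc has length [pi / nu], orders [nu >= 5 / 2] make it short enough,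
    provided the rational bounds on [pi], [t0] and J_0(j) are tight. The bound [1 / 200 <= c] is
    uniform in the angle, so the gain in the Rayleigh quotient is known in advance: it tells how
    close to [t0] the level [ts] must be, [nu] is found from [ts], and the angle is [pi / nu]. The
    other obstacle is that a weak gradient sees only compactly supported test functions, whereas the
    separated solutions reach the boundary and the vertex. Quantitative decay of their gradient at
    the vertex, and of its normal component at the sides, replaces traces and density arguments in
    Green's formula. *)

Lemma is_derive_line (V : normedModType R) (f : V -> R) (p v : V) (d : R) :
  is_derive p v f d <-> is_derive (0 : R) (1 : R) (fun h : R => f (h *: v + p)) d.
Proof.
have E : 'D_v f p = 'D_1 (fun h : R => f (h *: v + p)) (0 : R).
  rewrite /derive; set g1 := fun h => h^-1 *: _; set g2 := fun h => h^-1 *: _.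
  suff -> : g1 = g2 by [].
  by apply/funext => h; rewrite /g1 /g2 /= addr0 scale0r add0r [_%:A]mulr1.
have [d1 d2] := derivable1P f p v.
by split=> -[h1 h2]; split; [exact: d1|rewrite -E|exact: d2|rewrite E].
Qed.

(** Along a line in direction [v], [is_derive_line] turns this into the chain rule in one real
    variable. *)
Lemma is_derive_comp (V : normedModType R) (A : R -> R) (u : V -> R)
    (p v : V) (a d : R) :
  is_derive (u p) (1 : R) A a -> is_derive p v u d ->
  is_derive p v (fun q => A (u q)) (a * d).
Proof.
move=> hA /is_derive_line hu; apply/is_derive_line.
apply: (@is_derive1_comp _ A (fun h : R => u (h *: v + p))) => //.
by rewrite scale0r add0r.
Qed.

Lemma is_derive_mul (V : normedModType R) (f g : V -> R) (p v : V) (a b : R) :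
  is_derive p v f a -> is_derive p v g b ->
  is_derive p v (fun q => f q * g q) (a * g p + f p * b).
Proof.
move=> hf hg; apply: (@is_derive_eq _ _ _ (f * g)).
by rewrite /= addrC mulrC.
Qed.

Lemma is_derive_add (V : normedModType R) (f g : V -> R) (p v : V) (a b : R) :
  is_derive p v f a -> is_derive p v g b ->
  is_derive p v (fun q => f q + g q) (a + b).
Proof. by move=> hf hg; exact: (@is_deriveD _ _ _ f g). Qed.

Lemma is_derive_sub (V : normedModType R) (f g : V -> R) (p v : V) (a b : R) :
  is_derive p v f a -> is_derive p v g b ->
  is_derive p v (fun q => f q - g q) (a - b).
Proof. by move=> hf hg; exact: (@is_deriveB _ _ _ f g). Qed.

Lemma is_derive_opp (V : normedModType R) (f : V -> R) (p v : V) (a : R) :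
  is_derive p v f a -> is_derive p v (fun q => - f q) (- a).
Proof. by move=> hf; exact: (@is_deriveN _ _ _ f). Qed.

Lemma is_derive_const (V : normedModType R) (c : R) (p v : V) :
  is_derive p v (fun=> c) 0.
Proof. exact: is_derive_cst. Qed.

Lemma is_derive_scale (V : normedModType R) (f : V -> R) (p v : V) (c a : R) :
  is_derive p v f a -> is_derive p v (fun q => c * f q) (c * a).
Proof. by move=> hf; exact: (@is_deriveZ _ _ _ f). Qed.

Lemma is_derive_inv (x : R) f (a : R) : f x != 0 ->
  is_derive x (1 : R) f a -> is_derive x (1 : R) (fun y => (f y)^-1) (- a / (f x) ^+ 2).
Proof.
move=> f0 hf; apply: (is_derive_eq (is_deriveV f0 hf)).
by rewrite /GRing.scale /= mulNr mulrC mulNr.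
Qed.

Lemma is_derive_continuous (x : R) f (a : R) :
  is_derive x (1 : R) f a -> {for x, continuous f}.
Proof. by case=> h _; exact/differentiable_continuous/derivable1_diffP. Qed.

Lemma is_derive_near (V : normedModType R) (D : set V) (f g : V -> R)
    (p v : V) (a : R) : open D -> D p -> (forall q, D q -> f q = g q) ->
  is_derive p v f a -> is_derive p v g a.
Proof.
move=> oD Dp fg; apply: near_eq_is_derive.
by apply: (@filterS _ _ _ D) => //; exact: open_nbhs_nbhs.
Qed.

(** The derivative is carried as a witness, constrained only on [I], so that each closure property
    is an induction that exhibits the derivative. *)
Fixpoint Sk I k f : Prop :=
  if k is k'.+1 then
    exists2 f', (forall x, I x -> is_derive x (1 : R) f (f' x)) & Sk I k' f'
  else forall x, I x -> {for x, continuous f}.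

Definition smooth1 I f := forall k, Sk I k f.

Lemma Sk_pred I k f : Sk I k.+1 f -> Sk I k f.
Proof.
elim: k f => [|k IH] f [f' hf' sf'].
  by move=> x Ix; apply: is_derive_continuous; exact: hf'.
by exists f' => //; exact: IH.
Qed.

Lemma Sk_ext I k f g : open I -> (forall x, I x -> f x = g x) ->
  Sk I k f -> Sk I k g.
Proof.
move=> oI; elim: k f g => [|k IH] f g fg.
  move=> cf x Ix; rewrite /prop_for /continuous_at -fg//.
  have nI : nbhs x I by exact: open_nbhs_nbhs.
  by apply: cvg_trans (cf x Ix); apply: near_eq_cvg; apply: filterS nI => y /fg.
case=> f' hf' sf'; exists f' => // x Ix.
by apply: (is_derive_near oI Ix fg); exact: hf'.
Qed.

Lemma Sk_sub I J k f : J `<=` I -> Sk I k f -> Sk J k f.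
Proof.
move=> JI; elim: k f => [|k IH] f; first by move=> cf x /JI; exact: cf.
by case=> f' hf' sf'; exists f'; [move=> x /JI; exact: hf'|exact: IH].
Qed.

Lemma Sk_cst I k c : Sk I k (fun=> c).
Proof.
elim: k c => [|k IH] c; first by move=> x _; exact: cst_continuous.
by exists (fun=> 0) => // x _; exact: is_derive_const.
Qed.

Lemma Sk_id I k : Sk I k id.
Proof.
case: k => [|k]; first by move=> x _; exact: cvg_id.
exists (fun=> 1); first by move=> x _; exact: is_derive_id.
exact: Sk_cst.
Qed.

Lemma Sk_add I k f g : Sk I k f -> Sk I k g -> Sk I k (fun x => f x + g x).
Proof.
elim: k f g => [|k IH] f g; first by move=> cf cg x Ix; apply: cvgD; [exact: cf|exact: cg].
move=> [f' hf' sf'] [g' hg' sg']; exists (fun x => f' x + g' x); last exact: IH.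
by move=> x Ix; apply: is_derive_add; [exact: hf'|exact: hg'].
Qed.

Lemma Sk_mul I k f g : Sk I k f -> Sk I k g -> Sk I k (fun x => f x * g x).
Proof.
elim: k f g => [|k IH] f g; first by move=> cf cg x Ix; apply: cvgM; [exact: cf|exact: cg].
move=> sf sg; have [f' hf' sf'] := sf; have [g' hg' sg'] := sg.
exists (fun x => f' x * g x + f x * g' x).
  by move=> x Ix; apply: is_derive_mul; [exact: hf'|exact: hg'].
by apply: Sk_add; apply: IH => //; exact: Sk_pred.
Qed.

Lemma Sk_scale I k c f : Sk I k f -> Sk I k (fun x => c * f x).
Proof. by move=> sf; apply: Sk_mul => //; exact: Sk_cst. Qed.

Lemma Sk_opp I k f : Sk I k f -> Sk I k (fun x => - f x).
Proof.
move=> sf; rewrite (_ : (fun x => - f x) = (fun x => -1 * f x)); first exact: Sk_scale.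
by apply/funext => x; rewrite mulN1r.
Qed.

Lemma Sk_sub_fun I k f g : Sk I k f -> Sk I k g -> Sk I k (fun x => f x - g x).
Proof. by move=> sf sg; apply: Sk_add => //; exact: Sk_opp. Qed.

Lemma Sk_inv I k f : (forall x, I x -> f x != 0) -> Sk I k f ->
  Sk I k (fun x => (f x)^-1).
Proof.
move=> f0; elim: k => [|k IH].
  by move=> cf x Ix; apply: cvgV; [exact: f0|exact: cf].
move=> sf; have [f' hf' sf'] := sf.
exists (fun x => - f' x / (f x) ^+ 2).
  by move=> x Ix; apply: is_derive_inv; [exact: f0|exact: hf'].
have sV := IH (Sk_pred sf).
rewrite (_ : (fun x => _) = (fun x => - (f' x * ((f x)^-1 * (f x)^-1)))).
  by apply: Sk_opp; apply: Sk_mul => //; exact: Sk_mul.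
by apply/funext => x; rewrite mulNr expr2 invfM.
Qed.

Lemma Sk_comp I J k f g : (forall x, I x -> J (g x)) -> Sk J k f -> Sk I k g ->
  Sk I k (fun x => f (g x)).
Proof.
move=> IJ; elim: k f => [|k IH] f.
  move=> cf cg x Ix; apply: continuous_comp; first exact: cg.
  exact/cf/IJ.
move=> sf sg; have [f' hf' sf'] := sf; have [g' hg' sg'] := sg.
exists (fun x => f' (g x) * g' x).
  by move=> x Ix; apply: is_derive_comp; [exact/hf'/IJ|exact: hg'].
by apply: Sk_mul => //; apply: IH => //; exact: Sk_pred.
Qed.

Lemma Sk_expn I k n f : Sk I k f -> Sk I k (fun x => f x ^+ n).
Proof.
move=> sf; elim: n => [|n IH]; first exact: Sk_cst.
rewrite (_ : (fun x => _) = (fun x => f x * f x ^+ n)); first exact: Sk_mul.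
by apply/funext => x; rewrite exprS.
Qed.

(** Each order [k] comes with its own derivative witness; uniqueness of the derivative makes them
    agree on [I], so the first one serves for all orders. *)
Lemma smooth1_derive I f : open I -> smooth1 I f ->
  exists2 f', (forall x, I x -> is_derive x (1 : R) f (f' x)) & smooth1 I f'.
Proof.
move=> oI sf; have [f' hf' _] := sf 1%N; exists f' => // k.
have [g hg sg] := sf k.+1; apply: (Sk_ext oI _ sg) => x Ix.
by have [_ <-] := hf' x Ix; have [_ <-] := hg x Ix.
Qed.

Lemma smooth1_antiderivative I f F : (forall x, I x -> is_derive x (1 : R) F (f x)) ->
  smooth1 I f -> smooth1 I F.
Proof.
move=> hF sf [|k]; last by exists f.
by move=> x Ix; apply: is_derive_continuous; exact: hF.
Qed.

Lemma Sk_powR (s : R) k : Sk [set x | 0 < x] k (fun x => x `^ s).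
Proof.
elim: k s => [|k IH] s.
  by move=> x /= x0; apply: is_derive_continuous; exact: is_derive1_powR.
exists (fun x => s * x `^ (s - 1)); first by move=> x /= x0; exact: is_derive1_powR.
exact: Sk_scale.
Qed.

Lemma Sk_cos_sin k I :
  Sk I k (@cos R) /\ Sk I k (@sin R).
Proof.
elim: k => [|k [IHc IHs]].
  by split=> x _; [exact: continuous_cos|exact: continuous_sin].
split.
  by exists (fun x => - sin x); [move=> x _; exact: is_derive_cos|exact: Sk_opp].
by exists (@cos R); [move=> x _; exact: is_derive_sin|].
Qed.

Lemma Sk_cos k I f : Sk I k f -> Sk I k (fun x => cos (f x)).
Proof. by move=> sf; apply: (@Sk_comp _ setT) => //; apply: (Sk_cos_sin _ _).1. Qed.

Lemma Sk_sin k I f : Sk I k f -> Sk I k (fun x => sin (f x)).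
Proof. by move=> sf; apply: (@Sk_comp _ setT) => //; apply: (Sk_cos_sin _ _).2. Qed.

End smooth1.

(** * Mean value estimates on segments *)

Section real_lemmas.
Context {R : realType}.
Implicit Types f g : R -> R.

Lemma segment_bounded f (a b : R) :
  (forall x, a <= x <= b -> {for x, continuous f}) ->
  exists2 C : R, 0 < C & forall x, a <= x <= b -> `|f x| <= C.
Proof.
move=> cf; have [ab|ba] := leP a b; last first.
  by exists 1 => // x /andP[ax xb]; have := le_lt_trans (le_trans ax xb) ba; rewrite ltxx.
have [|c _ hc] := @EVT_max R (fun x => `|f x|) a b ab.
  apply: continuous_in_subspaceT => x; rewrite inE /= in_itv /= => xab.
  by apply: continuous_comp; [exact: cf|exact: norm_continuous].
exists (`|f c| + 1) => [|x xab]; first by rewrite ltr_wpDl.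
by rewrite (le_trans (hc x _))// ?in_itv// lerDl.
Qed.

Lemma mean_value f f' (a b : R) : a <= b ->
  (forall x, a <= x <= b -> is_derive x (1 : R) f (f' x)) ->
  exists2 c, a <= c <= b & f b - f a = f' c * (b - a).
Proof.
move=> ab hf.
have [||c] := @MVT_segment R f f' a b ab; last by rewrite in_itv /= => cab E; exists c.
  move=> x; rewrite in_itv /= => /andP[ax xb]; apply: hf.
  by rewrite !ltW.
apply: continuous_in_subspaceT => x; rewrite inE /= in_itv /= => xab.
exact: is_derive_continuous (hf x xab).
Qed.

Lemma is_derive_bound f f' (C a b : R) : a <= b ->
  (forall x, a <= x <= b -> is_derive x (1 : R) f (f' x)) ->
  (forall x, a <= x <= b -> `|f' x| <= C) -> `|f b - f a| <= C * (b - a).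
Proof.
move=> ab hf hC; have [c cab ->] := mean_value ab hf.
by rewrite normrM [`|b - a|]ger0_norm ?subr_ge0// ler_wpM2r ?subr_ge0// hC.
Qed.

Lemma is_derive0_eq f (a b : R) : a <= b ->
  (forall x, a <= x <= b -> is_derive x (1 : R) f 0) -> f b = f a.
Proof.
move=> ab hf; have [c _ E] := @mean_value f (fun=> 0) a b ab hf.
by apply/eqP; rewrite -subr_eq0 E mul0r.
Qed.

Lemma is_derive_expn (V : normedModType R) n (f : V -> R) (p v : V) (a : R) :
  is_derive p v f a ->
  is_derive p v (fun q => f q ^+ n) (n%:R * f p ^+ n.-1 * a).
Proof.
move=> hf; elim: n => [|n IH]; first by rewrite !mul0r; exact: is_derive_const.
rewrite (_ : (fun q => _) = (fun q => f q * f q ^+ n)); last first.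
  by apply/funext => q; rewrite exprS.
apply: (is_derive_eq (is_derive_mul hf IH)).
case: n {IH} => [|n] /=; first by rewrite expr0; ring.
by rewrite exprS -(natr1 n.+1); ring.
Qed.

End real_lemmas.

(** * A smooth step function *)

Section smooth_step.
Context {R : realType}.

(* Closed under differentiation up to linear combinations, see [is_derive_flat]. *)
Definition flat (n : nat) (x : R) : R :=
  if 0 < x then (x^-1) ^+ n * expR (- x^-1) else 0.

(** The Taylor term [y^(n+1) / (n+1)! <= exp y] at [y = 1 / x]. A bound linear in [x] yields
    continuity at 0 for every [n], and differentiability at 0 follows by passing from [n] to
    [n + 1]. *)
Lemma flat_le n (x : R) : `|flat n x| <= (n.+1)`!%:R * `|x|.
Proof.
rewrite /flat; case: ltP => x0; last by rewrite normr0 mulr_ge0.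
have x0' := ltW x0.
rewrite !ger0_norm ?mulr_ge0 ?exprn_ge0 ?invr_ge0 ?expR_ge0//.
set y := x^-1; have y0 : 0 < y by rewrite invr_gt0.
have -> : x = y^-1 by rewrite invrK.
rewrite expRN ler_pdivlMr// mulrAC -exprSr ler_pdivrMr ?expR_gt0//.
have := expR_ge1Dxn n (ltW y0); rewrite -(@ler_pM2l _ (n.+1)`!%:R) ?ltr0n ?fact_gt0//.
apply: le_trans; rewrite mulrDr mulr1 mulrCA divff ?mulr1 ?lerDr//.
Qed.

Lemma flat_continuous0 n : {for (0 : R), continuous (flat n)}.
Proof.
rewrite /prop_for /continuous_at {2}/flat ltxx; apply/cvgrPdist_le => /= e e0.
near=> x; rewrite sub0r normrN (le_trans (flat_le n x))//.
rewrite mulrC -ler_pdivlMr ?ltr0n ?fact_gt0//.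
near: x; apply/nbhs_ballP; exists (e / (n.+1)`!%:R) => /=.
  by rewrite divr_gt0// ltr0n fact_gt0.
by move=> x; rewrite /ball /= sub0r normrN => /ltW.
Unshelve. all: by end_near. Qed.

Lemma is_derive_flat n (x : R) :
  is_derive x (1 : R) (flat n) (flat n.+2 x - n%:R * flat n.+1 x).
Proof.
have [x0|x0|->] := ltgtP x 0.
- apply: (@is_derive_near _ _ [set y : R | y < 0] (fun=> 0)) => //.
  + by move=> y /= y0; rewrite /flat ltNge (ltW y0).
  + by rewrite /flat ltNge (ltW x0) /= mulr0 subr0; exact: is_derive_const.
- apply: (@is_derive_near _ _ [set y : R | 0 < y]
      (fun y => (y^-1) ^+ n * expR (- y^-1))) => //.
  + by move=> y /= y0; rewrite /flat y0.
  have hV : is_derive x (1 : R) (fun y : R => y^-1) (- 1 / x ^+ 2).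
    by apply: (@is_derive_inv _ x id) => //; rewrite gt_eqF.
  have hX := @is_derive_comp R R (fun y => y ^+ n) (fun y : R => y^-1) x 1 (n%:R * x^-1 ^+ n.-1) _ _ hV.
  have hE := @is_derive_comp R R (@expR R) (fun y => - y^-1) x 1 _ _ (is_derive_expR (- x^-1)) (is_derive_opp hV).
  apply: is_derive_eq; first apply: (is_derive_mul (hX _) hE).
    have := is_derive_expn n (is_derive_id x^-1 (1 : R)).
    by rewrite mulr1.
  rewrite /flat x0; case: n {hX} => [|n] /=.
    by field; rewrite gt_eqF.
  rewrite !exprS; set u := _ ^+ n; field.
  by rewrite gt_eqF.
(* At 0 the difference quotient of [flat n] is [flat n.+1], which is continuous there with value
   0. *)
- apply/is_derive1_caratheodory; exists (flat n.+1); split.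
  + move=> z; rewrite subr0 {2}/flat ltxx subr0 /flat; case: ltP => z0.
      by rewrite exprS; field; rewrite gt_eqF.
    by rewrite mul0r.
  + exact: flat_continuous0.
  + by rewrite /flat ltxx mulr0 subr0.
Qed.

Lemma smooth1_flat n : smooth1 setT (flat n).
Proof.
move=> k; elim: k n => [|k IH] n.
  by move=> x _; exact: is_derive_continuous (is_derive_flat n x).
exists (fun x => flat n.+2 x - n%:R * flat n.+1 x).
  by move=> x _; exact: is_derive_flat.
by apply: Sk_sub_fun => //; exact: Sk_scale.
Qed.

(** The transition takes place on [[1, 2]] rather than [[0, 1]], so that [sstep (m * (y - lo))]
    vanishes in a neighbourhood of [lo] and not merely at [lo]. *)
Definition sstep (x : R) : R := flat 0 (x - 1) / (flat 0 (x - 1) + flat 0 (2 - x)).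

Lemma flat0_ge0 (x : R) : 0 <= flat 0 x.
Proof. by rewrite /flat; case: ifP => // _; rewrite mul1r expR_ge0. Qed.

Lemma flat0_gt0 (x : R) : 0 < x -> 0 < flat 0 x.
Proof. by rewrite /flat => ->; rewrite mul1r expR_gt0. Qed.

Lemma flat0_eq0 (x : R) : x <= 0 -> flat 0 x = 0.
Proof. by rewrite /flat; case: ltP. Qed.

Lemma sstep_den (x : R) : 0 < flat 0 (x - 1) + flat 0 (2 - x).
Proof.
have [x1|x1] := ltP 1 x.
  by rewrite ltr_pwDl ?flat0_ge0// flat0_gt0// subr_gt0.
by rewrite ltr_wpDl ?flat0_ge0// flat0_gt0// subr_gt0; lra.
Qed.

Lemma sstep_eq0 (x : R) : x <= 1 -> sstep x = 0.
Proof. by move=> x1; rewrite /sstep flat0_eq0 ?mul0r// subr_le0. Qed.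

Lemma sstep_eq1 (x : R) : 2 <= x -> sstep x = 1.
Proof.
move=> x2; have := sstep_den x; rewrite /sstep [flat 0 (2 - x)]flat0_eq0 ?subr_le0//.
by rewrite addr0 => d; rewrite divff// gt_eqF.
Qed.

Lemma sstep_itv (x : R) : 0 <= sstep x <= 1.
Proof.
apply/andP; split; first by rewrite divr_ge0 ?flat0_ge0// ltW ?sstep_den.
by rewrite ler_pdivrMr ?sstep_den// mul1r lerDl flat0_ge0.
Qed.

Lemma smooth1_sstep : smooth1 setT sstep.
Proof.
move=> k; have s1 : Sk setT k (fun x : R => flat 0 (x - 1)).
  apply: (@Sk_comp _ setT setT) => //; first exact: smooth1_flat.
  by apply: Sk_sub_fun; [exact: Sk_id|exact: Sk_cst].
have s2 : Sk setT k (fun x : R => flat 0 (2 - x)).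
  apply: (@Sk_comp _ setT setT) => //; first exact: smooth1_flat.
  by apply: Sk_sub_fun; [exact: Sk_cst|exact: Sk_id].
apply: Sk_mul => //; apply: Sk_inv; last exact: Sk_add.
by move=> x _; rewrite gt_eqF ?sstep_den.
Qed.

Lemma sstep_derivative : exists (sstep' : R -> R) (K : R),
  [/\ 0 < K, forall x, is_derive x (1 : R) sstep (sstep' x), smooth1 setT sstep',
      forall x, `|sstep' x| <= K & forall x, sstep' x != 0 -> 1 <= x <= 2].
Proof.
have [d hd sd] := smooth1_derive (@openT _) smooth1_sstep.
have d0 x : d x != 0 -> 1 <= x <= 2.
  apply: contraNT => h; have {h} : (x < 1) || (2 < x).
    by move: h; rewrite negb_and -!ltNge.
  have [_ <-] := hd x I; move=> /orP[h|h]; apply/eqP.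
    suff: is_derive x (1 : R) sstep 0 by case.
    apply: (@is_derive_near _ _ [set y : R | y < 1] (fun=> 0)) => //.
    by move=> y /= /ltW /sstep_eq0.
  suff: is_derive x (1 : R) sstep 0 by case.
  apply: (@is_derive_near _ _ [set y : R | 2 < y] (fun=> 1)) => //.
  by move=> y /= /ltW /sstep_eq1.
have [K K0 hK] := @segment_bounded _ d 1 2 (fun x _ => sd 0%N x I).
exists d, K; split => // x; first exact: hd.
by have [->|/d0/hK//] := eqVneq (d x) 0; rewrite normr0 ltW.
Qed.

End smooth_step.

(** * Polar coordinates and separated test functions *)

Section plane.
Context {R : realType}.
Implicit Types (p e : R * R) (f g : R * R -> R).

Definition prad p : R := Num.sqrt (p.1 ^+ 2 + p.2 ^+ 2).
(* The polar angle only for [0 < p.1]. *)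
Definition pang p : R := atan (p.2 / p.1).

Lemma prad_ge0 p : 0 <= prad p. Proof. exact: sqrtr_ge0. Qed.

Lemma prad2 p : prad p ^+ 2 = p.1 ^+ 2 + p.2 ^+ 2.
Proof. by rewrite sqr_sqrtr// addr_ge0// sqr_ge0. Qed.

Lemma prad_gt0 p : 0 < p.1 -> 0 < prad p.
Proof. by move=> p0; rewrite sqrtr_gt0 ltr_pwDl ?sqr_ge0// exprn_gt0. Qed.

Lemma cos_pang p : 0 < p.1 -> cos (pang p) = p.1 / prad p.
Proof.
move=> p0; rewrite /pang cos_atan; have -> : 1 + (p.2 / p.1) ^+ 2 = (prad p / p.1) ^+ 2.
  by rewrite !expr_div_n prad2; field; rewrite gt_eqF.
by rewrite sqrtr_sqr ger0_norm ?invf_div// divr_ge0// ?prad_ge0// ltW.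
Qed.

Lemma sin_pang p : 0 < p.1 -> sin (pang p) = p.2 / prad p.
Proof.
move=> p0; have c0 : cos (pang p) != 0 by rewrite cos_pang// mulf_neq0 ?invr_eq0// gt_eqF// prad_gt0.
have := atanK (p.2 / p.1); rewrite -/(pang p) /tan => /(congr1 (fun z => z * cos (pang p))).
by rewrite divfK// => ->; rewrite cos_pang//; field; rewrite !gt_eqF ?prad_gt0.
Qed.

Lemma polar_prad_pang p : 0 < p.1 -> polar (prad p) (pang p) = p.
Proof.
move=> p0; have r0 := prad_gt0 p0.
by case: p p0 r0 => x y p0 r0; rewrite /polar cos_pang// sin_pang//= !(mulrC (prad _)) !divfK// gt_eqF.
Qed.

Lemma prad_polar (r t : R) : 0 <= r -> prad (polar r t) = r.
Proof.
move=> r0; rewrite /prad /polar /= !exprMn -mulrDr cos2Dsin2 mulr1 sqrtr_sqr.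
by rewrite ger0_norm.
Qed.

Lemma pang_polar (r t : R) : 0 < r -> - (pi / 2) < t < pi / 2 -> pang (polar r t) = t.
Proof.
move=> r0 t1; have c0 : 0 < cos t by exact: cos_gt0_pihalf.
rewrite /pang /polar /= -mulf_div divff ?gt_eqF// mul1r.
by rewrite -/(tan t) tanK// in_itv.
Qed.

Lemma is_derive_fst p e : is_derive p e (fun q => q.1) e.1.
Proof.
apply/is_derive_line.
have := is_derive_add (is_derive_mul (is_derive_id (0 : R) (1 : R)) (is_derive_const e.1 (0:R) (1:R)))
  (is_derive_const p.1 (0:R) (1:R)).
by move/is_derive_eq; apply; rewrite mul1r mulr0 !addr0.
Qed.

Lemma is_derive_snd p e : is_derive p e (fun q => q.2) e.2.
Proof.
apply/is_derive_line.
have := is_derive_add (is_derive_mul (is_derive_id (0 : R) (1 : R)) (is_derive_const e.2 (0:R) (1:R)))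
  (is_derive_const p.2 (0:R) (1:R)).
by move/is_derive_eq; apply; rewrite mul1r mulr0 !addr0.
Qed.

Lemma is_derive_rho p e :
  is_derive p e (fun q => q.1 ^+ 2 + q.2 ^+ 2) (2 * (p.1 * e.1 + p.2 * e.2)).
Proof.
have := is_derive_add (is_derive_expn 2 (is_derive_fst p e)) (is_derive_expn 2 (is_derive_snd p e)).
by move/is_derive_eq; apply; rewrite /= !expr1; ring.
Qed.

Lemma is_derive_prad p e : 0 < p.1 ->
  is_derive p e prad (cos (pang p) * e.1 + sin (pang p) * e.2).
Proof.
move=> p0; have r0 := prad_gt0 p0.
have s0 : 0 < p.1 ^+ 2 + p.2 ^+ 2 by rewrite -prad2 exprn_gt0.
have h : is_derive p e prad _ := @is_derive_comp R _ Num.sqrt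
  (fun q : R * R => q.1 ^+ 2 + q.2 ^+ 2) p e _ _ (is_derive1_sqrt s0) (is_derive_rho p e).
apply: (is_derive_eq h); by rewrite -/(prad p) cos_pang// sin_pang//; field; rewrite gt_eqF.
Qed.

Lemma is_derive_pang p e : 0 < p.1 ->
  is_derive p e pang ((cos (pang p) * e.2 - sin (pang p) * e.1) / prad p).
Proof.
move=> p0; have r0 := prad_gt0 p0.
have hx : is_derive p e (fun q => q.1^-1) (- e.1 / p.1 ^+ 2).
  have h1 : is_derive p.1 (1 : R) (fun x : R => x^-1) (- 1 / p.1 ^+ 2).
    by apply: (@is_derive_inv _ _ id) => //; rewrite gt_eqF.
  by apply: (is_derive_eq (is_derive_comp h1 (is_derive_fst p e))); rewrite mulrAC mulN1r.
have h : is_derive p e pang _ := @is_derive_comp R _ atan (fun q : R * R => q.2 / q.1)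
  p e _ _ (is_derive1_atan (p.2 / p.1)) (is_derive_mul (is_derive_snd p e) hx).
apply: (is_derive_eq h); rewrite cos_pang// sin_pang//.
have s0 : 0 < p.1 ^+ 2 + p.2 ^+ 2 by rewrite -prad2 exprn_gt0.
have -> : (p.1 / prad p * e.2 - p.2 / prad p * e.1) / prad p =
   (p.1 * e.2 - p.2 * e.1) / prad p ^+ 2 by field; rewrite gt_eqF.
by rewrite prad2; field; rewrite !gt_eqF//= gt_eqF.
Qed.

Lemma fst_continuous p : {for p, continuous (fun q : R * R => q.1)}.
Proof. exact: cvg_fst. Qed.

Lemma snd_continuous p : {for p, continuous (fun q : R * R => q.2)}.
Proof. exact: cvg_snd. Qed.

Lemma rho_continuous p : {for p, continuous (fun q : R * R => q.1 ^+ 2 + q.2 ^+ 2)}.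
Proof.
have h1 : {for p, continuous (fun q : R * R => q.1 * q.1)}.
  by apply: cvgM; exact: fst_continuous.
have h2 : {for p, continuous (fun q : R * R => q.2 * q.2)}.
  by apply: cvgM; exact: snd_continuous.
exact: (cvgD h1 h2).
Qed.

Lemma prad_continuous p : {for p, continuous prad}.
Proof. by apply: continuous_comp; [exact: rho_continuous|exact: sqrt_continuous]. Qed.

Lemma pang_continuous p : 0 < p.1 -> {for p, continuous pang}.
Proof.
move=> p0; apply: (@continuous_comp _ _ _ (fun q : R * R => q.2 / q.1)); last exact: continuous_atan.
apply: cvgM; first exact: snd_continuous.
by apply: cvgV; [rewrite gt_eqF|exact: fst_continuous].
Qed.

Lemma polar_continuous : continuous (fun q : R * R => polar q.1 q.2).
Proof.
move=> q.
have h1 : (fun q : R * R => q.1 * cos q.2) @ q --> q.1 * cos q.2.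
  apply: cvgM; first exact: fst_continuous.
  by apply: continuous_comp; [exact: snd_continuous|exact: continuous_cos].
have h2 : (fun q : R * R => q.1 * sin q.2) @ q --> q.1 * sin q.2.
  apply: cvgM; first exact: fst_continuous.
  by apply: continuous_comp; [exact: snd_continuous|exact: continuous_sin].
exact: (cvg_pair h1 h2).
Qed.

Lemma open_fst_gt0 : open [set p : R * R | 0 < p.1].
Proof. rewrite (_ : [set p : R * R | 0 < p.1] = fst @^-1` [set x : R | 0 < x]) //.
by apply: open_comp => [p _|]; [exact: fst_continuous|exact: open_gt]. Qed.

Lemma continuous_near (D : set (R * R)) f g p : open D -> D p ->
  (forall q, D q -> f q = g q) -> {for p, continuous f} -> {for p, continuous g}.
Proof.
move=> oD Dp fg cf; rewrite /prop_for /continuous_at -fg//.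
have nD : nbhs p D by exact: open_nbhs_nbhs.
by apply: cvg_trans cf; apply: near_eq_cvg; apply: filterS nD => y /fg.
Qed.

Lemma Ck_succ k f f1 f2 : continuous f ->
  (forall p, is_derive p ((1, 0) : R * R) f (f1 p)) ->
  (forall p, is_derive p ((0, 1) : R * R) f (f2 p)) ->
  Ck k f1 -> Ck k f2 -> Ck k.+1 f.
Proof.
move=> cf h1 h2 s1 s2; split => //.
have E1 : partial1 f = f1 by apply/funext => p; have [_] := h1 p.
have E2 : partial2 f = f2 by apply/funext => p; have [_] := h2 p.
by rewrite E1 E2; split.
Qed.

Lemma CkS k f : Ck k.+1 f -> [/\ continuous f,
  (forall p, is_derive p ((1, 0) : R * R) f (partial1 f p)),
  (forall p, is_derive p ((0, 1) : R * R) f (partial2 f p)) &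
  Ck k (partial1 f) /\ Ck k (partial2 f)].
Proof. by case=> cf [d1 d2 s1 s2]; split => // p; exact: derivableP. Qed.

Lemma Ck_continuous k f : Ck k f -> continuous f.
Proof. by case: k => [|k] []. Qed.

Lemma Ck_pred k f : Ck k.+1 f -> Ck k f.
Proof.
elim: k f => [|k IH] f /CkS[cf h1 h2 [s1 s2]]; first by split.
by apply: (Ck_succ cf h1 h2); exact: IH.
Qed.

Lemma Ck_add k f g : Ck k f -> Ck k g -> Ck k (fun p => f p + g p).
Proof.
elim: k f g => [|k IH] f g.
  by move=> [cf _] [cg _]; split => // p; apply: cvgD; [exact: cf|exact: cg].
move=> /CkS[cf f1 f2 [sf1 sf2]] /CkS[cg g1 g2 [sg1 sg2]].
apply: (@Ck_succ _ _ (fun p => partial1 f p + partial1 g p)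
                     (fun p => partial2 f p + partial2 g p)).
- by move=> p; apply: cvgD; [exact: cf|exact: cg].
- exact: IH.
- exact: IH.
Qed.

Lemma Ck_mul k f g : Ck k f -> Ck k g -> Ck k (fun p => f p * g p).
Proof.
elim: k f g => [|k IH] f g.
  by move=> [cf _] [cg _]; split => // p; apply: cvgM; [exact: cf|exact: cg].
move=> sf sg; have [cf f1 f2 [sf1 sf2]] := CkS sf; have [cg g1 g2 [sg1 sg2]] := CkS sg.
have sf0 := Ck_pred sf; have sg0 := Ck_pred sg.
apply: (@Ck_succ _ _ (fun p => partial1 f p * g p + f p * partial1 g p)
                     (fun p => partial2 f p * g p + f p * partial2 g p)).
- by move=> p; apply: cvgM; [exact: cf|exact: cg].
- by move=> p; exact: is_derive_mul.
- by move=> p; exact: is_derive_mul.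
- by apply: Ck_add; exact: IH.
- by apply: Ck_add; exact: IH.
Qed.

Lemma Ck_cst k c : Ck k (fun=> c : R).
Proof.
elim: k c => [|k IH] c; first by split => // p; exact: cst_continuous.
apply: (@Ck_succ _ _ (fun=> 0) (fun=> 0)); first by move=> p; exact: cst_continuous.
- exact: IH.
- exact: IH.
Qed.

End plane.

(** * Compactly supported smooth functions of one variable *)

Section bumps.
Context {R : realType}.
Implicit Types (lo hi : R) (A B f : R -> R).

Definition itvoo lo hi : set R := [set x | lo < x < hi].

Lemma open_itvoo lo hi : open (itvoo lo hi).
Proof.
rewrite (_ : itvoo lo hi = `]lo, hi[%classic); first exact: itv_open.
by apply/seteqP; split => x; rewrite /itvoo /= in_itv.
Qed.

(** The support condition concerns the whole line, smoothness only the open interval. Multiplication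
    by a function that is singular at an endpoint, such as [1 / r], therefore preserves bumps. *)
Definition bumpfun lo hi A := smooth1 (itvoo lo hi) A /\
  exists a b, [/\ lo < a, b < hi & forall x, A x != 0 -> a <= x <= b].

Lemma bump_mull lo hi f A : smooth1 (itvoo lo hi) f -> bumpfun lo hi A ->
  bumpfun lo hi (fun x => f x * A x).
Proof.
move=> sf [sA [a [b [la bh h]]]]; split; first by move=> k; exact: Sk_mul.
by exists a, b; split => // x fA; apply: h; apply: contraNneq fA => ->; rewrite mulr0.
Qed.

Lemma bump_derive lo hi A : bumpfun lo hi A ->
  exists2 A', (forall x, itvoo lo hi x -> is_derive x (1 : R) A (A' x)) & bumpfun lo hi A'.
Proof.
move=> [sA [a [b [la bh h]]]].
have [d hd sd] := smooth1_derive (@open_itvoo lo hi) sA.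
have d0 x : itvoo lo hi x -> ~~ (a <= x <= b) -> d x = 0.
  move=> Ix /[dup] nx; rewrite negb_and -!ltNge => xab.
  have [_ <-] := hd x Ix; suff: is_derive x (1 : R) A 0 by case.
  case/orP: xab => xab.
    apply: (@is_derive_near _ _ [set y : R | y < a] (fun=> 0)) => //.
    move=> y /= ya; apply/esym/eqP; apply: contraTT ya => /h /andP[ay _].
    by rewrite -leNgt.
  apply: (@is_derive_near _ _ [set y : R | b < y] (fun=> 0)) => //.
  move=> y /= yb; apply/esym/eqP; apply: contraTT yb => /h /andP[_ yb].
  by rewrite -leNgt.
(* Outside [(lo, hi)] the witness [d] is unconstrained. Truncating it to [[a, b]] fixes the support
   and, by [d0], changes nothing on the interval. *)
exists (fun x => if a <= x <= b then d x else 0).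
  by move=> x Ix; case: ifPn => [_|nx]; [exact: hd|rewrite -(d0 x Ix nx); exact: hd].
split.
  move=> k; apply: (@Sk_ext _ _ _ d); [exact: open_itvoo| |exact: sd].
  by move=> x Ix; case: ifPn => // /(d0 x Ix).
by exists a, b; split => // x; case: ifP => // _; rewrite eqxx.
Qed.

End bumps.

(** * Products of a radial and an angular bump *)

Section polar_products.
Context {R : realType}.
Implicit Types (p e : R * R) (A B : R -> R).

Definition pol A B p : R := if 0 < p.1 then A (prad p) * B (pang p) else 0.

(** For [b <= pi / 2] this is the open sector of half-angle [b]. The half-plane condition makes
    [pang] the true polar angle. *)
Definition wedge (b : R) : set (R * R) :=
  [set p | [/\ 0 < p.1, prad p < 1 & `|pang p| < b]].

Lemma wedgeP (b : R) p : wedge b p ->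
  [/\ 0 < p.1, itvoo 0 1 (prad p) & itvoo (- b) b (pang p)].
Proof.
by move=> [p0 r1 t1]; split => //; rewrite /itvoo /= ?prad_gt0// -ltr_norml.
Qed.

Lemma open_wedge (b : R) : open (wedge b).
Proof.
move=> p [p0 r1 t1].
have h0 : \forall q \near p, 0 < q.1 by apply: open_nbhs_nbhs; split => //; exact: open_fst_gt0.
have h1 : \forall q \near p, prad q < 1.
  by apply: (@prad_continuous _ p [set x | x < 1]); apply: open_nbhs_nbhs; split => //; exact: open_lt.
have h2 : \forall q \near p, `|pang q| < b.
  have c : {for p, continuous (fun q => `|pang q|)}.
    by apply: continuous_comp; [exact: pang_continuous|exact: norm_continuous].
  by apply: (c [set x | x < b]); apply: open_nbhs_nbhs; split => //; exact: open_lt.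
by apply: filterS3 h0 h1 h2 => q.
Qed.

Section bumps.
Variables (b : R) (b_pi2 : b <= pi / 2).

(** The compact set is the image of the rectangle of the two supports under the polar map, which
    [prad] and [pang] invert there because [b <= pi / 2]. *)
Lemma pol_support A B : bumpfun 0 1 A -> bumpfun (- b) b B ->
  exists K : set (R * R), [/\ compact K, K `<=` wedge b &
    forall p, pol A B p != 0 -> K p].
Proof.
move=> [_ [a1 [a2 [a10 a21 hA]]]] [_ [b1 [b2 [b10 b21 hB]]]].
exists ((fun q : R * R => polar q.1 q.2) @` (`[a1, a2] `*` `[b1, b2])); split.
- apply: continuous_compact; first exact/continuous_subspaceT/polar_continuous.
  by apply: compact_setX; exact: segment_compact.
- move=> _ [[r t] /= [+ +] <-]; rewrite !in_itv /= => /andP[ar ra] /andP[bt tb].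
  have r0 : 0 < r by exact: lt_le_trans ar.
  have tb' : `|t| < b by rewrite ltr_norml (lt_le_trans b10)//= (le_lt_trans tb).
  have tpi : - (pi / 2) < t < pi / 2 by rewrite -ltr_norml (lt_le_trans tb').
  split; first by rewrite /= mulr_gt0// cos_gt0_pihalf.
    by rewrite prad_polar ?(le_lt_trans ra)// ltW.
  by rewrite pang_polar.
- move=> p; rewrite /pol; case: ifPn => [p0|]; last by rewrite eqxx.
  rewrite mulf_eq0 negb_or => /andP[/hA hr /hB ht].
  exists (prad p, pang p) => /=; last exact: polar_prad_pang.
  by rewrite !in_itv /= hr ht.
Qed.

Lemma pol_out A B p : bumpfun 0 1 A -> bumpfun (- b) b B -> ~ wedge b p ->
  pol A B p = 0.
Proof.
move=> hA hB nw; have [K [_ Kw KA]] := pol_support hA hB.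
by apply/eqP; apply: contra_notT nw => /KA/Kw.
Qed.

(** Local vanishing handles all points off the wedge at once, including the line [p.1 = 0], where
    the polar coordinates break down. *)
Lemma pol_local A B p : bumpfun 0 1 A -> bumpfun (- b) b B -> ~ wedge b p ->
  exists2 D : set (R * R), open D /\ D p & forall q, D q -> 0 = pol A B q.
Proof.
move=> hA hB nw; have [K [cK Kw KA]] := pol_support hA hB.
exists (~` K).
  split; last by move=> /Kw.
  by apply: closed_openC; apply: compact_closed => //; exact: (@norm_hausdorff R (R * R)%type).
by move=> q nKq; apply/esym/eqP; apply: contra_notT nKq; exact: KA.
Qed.

Lemma pol_continuous A B : bumpfun 0 1 A -> bumpfun (- b) b B -> continuous (pol A B).
Proof.
move=> hA hB p; have [/wedgeP[p0 hr ht]|nw] := pselect (wedge b p); last first.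
  have [D [oD Dp] D0] := pol_local hA hB nw.
  by apply: (continuous_near oD Dp D0); exact: cst_continuous.
apply: (@continuous_near _ _ (fun q => A (prad q) * B (pang q)) _ _ open_fst_gt0) => //.
  by move=> q /= q0; rewrite /pol q0.
apply: cvgM; apply: continuous_comp.
- exact: prad_continuous.
- exact: (hA.1 0%N).
- exact: pang_continuous.
- exact: (hB.1 0%N).
Qed.

(** The Cartesian derivatives of a separated bump are again combinations of separated bumps; this is
    what lets [Ck_pol] proceed by induction on the order. *)
Lemma is_derive_pol A B A' B' p e : bumpfun 0 1 A -> bumpfun (- b) b B ->
  (forall x, itvoo 0 1 x -> is_derive x (1 : R) A (A' x)) ->
  (forall x, itvoo (- b) b x -> is_derive x (1 : R) B (B' x)) ->
  bumpfun 0 1 A' -> bumpfun (- b) b B' ->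
  is_derive p e (pol A B)
    (e.1 * (pol A' (fun t => cos t * B t) p - pol (fun r => r^-1 * A r) (fun t => sin t * B' t) p)
   + e.2 * (pol A' (fun t => sin t * B t) p + pol (fun r => r^-1 * A r) (fun t => cos t * B' t) p)).
Proof.
move=> hA hB dA dB hA' hB'.
have hV : smooth1 (itvoo 0 1) (fun r : R => r^-1).
  by move=> k; apply: Sk_inv => [x /andP[x0 _]|]; [rewrite gt_eqF|exact: Sk_id].
have hVA := bump_mull hV hA.
have hc C : bumpfun (- b) b C -> bumpfun (- b) b (fun t => cos t * C t).
  by apply: bump_mull => k; apply: Sk_cos; exact: Sk_id.
have hs C : bumpfun (- b) b C -> bumpfun (- b) b (fun t => sin t * C t).
  by apply: bump_mull => k; apply: Sk_sin; exact: Sk_id.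
have [/wedgeP[p0 hr ht]|nw] := pselect (wedge b p); last first.
  have [D [oD Dp] D0] := pol_local hA hB nw.
  apply: (is_derive_near oD Dp D0); rewrite !(pol_out _ _ nw) //; try exact: hc; try exact: hs.
  by apply: (is_derive_eq (is_derive_const _ _ _)); rewrite subr0 addr0 !mulr0 addr0.
apply: (@is_derive_near _ _ _ (fun q => A (prad q) * B (pang q)) _ _ _ _ open_fst_gt0 p0).
  by move=> q /= q0; rewrite /pol q0.
have h1 := @is_derive_comp R _ A prad p e _ _ (dA _ hr) (is_derive_prad e p0).
have h2 := @is_derive_comp R _ B pang p e _ _ (dB _ ht) (is_derive_pang e p0).
apply: (is_derive_eq (is_derive_mul h1 h2)); rewrite /pol p0; field.
by rewrite gt_eqF// prad_gt0.
Qed.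

Lemma bump_inv_mul A : bumpfun 0 1 A -> bumpfun 0 1 (fun r => r^-1 * A r).
Proof.
by apply: bump_mull => k; apply: Sk_inv => [x /andP[x0 _]|]; [rewrite gt_eqF|exact: Sk_id].
Qed.

Lemma bump_cos_mul B : bumpfun (- b) b B -> bumpfun (- b) b (fun t => cos t * B t).
Proof. by apply: bump_mull => k; apply: Sk_cos; exact: Sk_id. Qed.

Lemma bump_sin_mul B : bumpfun (- b) b B -> bumpfun (- b) b (fun t => sin t * B t).
Proof. by apply: bump_mull => k; apply: Sk_sin; exact: Sk_id. Qed.

Lemma Ck_pol k A B : bumpfun 0 1 A -> bumpfun (- b) b B -> Ck k (pol A B).
Proof.
elim: k A B => [|k IH] A B hA hB; first by split => //; exact: pol_continuous.
have [A' dA hA'] := bump_derive hA; have [B' dB hB'] := bump_derive hB.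
have N f : Ck k f -> Ck k (fun p => - f p).
  move=> sf; rewrite (_ : (fun p => _) = (fun p => -1 * f p)).
    by apply: Ck_mul => //; exact: Ck_cst.
  by apply/funext => p; rewrite mulN1r.
apply: (@Ck_succ _ _ _
  (fun p => pol A' (fun t => cos t * B t) p - pol (fun r => r^-1 * A r) (fun t => sin t * B' t) p)
  (fun p => pol A' (fun t => sin t * B t) p + pol (fun r => r^-1 * A r) (fun t => cos t * B' t) p)).
- exact: pol_continuous.
- move=> p; apply: (is_derive_eq (is_derive_pol p (1, 0) hA hB dA dB hA' hB')).
  by rewrite mul1r mul0r addr0.
- move=> p; apply: (is_derive_eq (is_derive_pol p (0, 1) hA hB dA dB hA' hB')).
  by rewrite mul1r mul0r add0r.
- by apply: Ck_add; [|apply: N]; apply: IH => //; [exact: bump_cos_mul|exact: bump_inv_mul|exact: bump_sin_mul].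
- by apply: Ck_add; apply: IH => //; [exact: bump_sin_mul|exact: bump_inv_mul|exact: bump_cos_mul].
Qed.

Lemma test_function_of_support (Om K : set (R * R)) (f : R * R -> R) :
  smooth f -> compact K -> K `<=` Om -> (forall p, f p != 0 -> K p) ->
  test_function Om f.
Proof.
move=> sf cK KO hK; have clK : closed K.
  by apply: compact_closed => //; exact: (@norm_hausdorff R (R * R)%type).
have sub : closure [set p | f p != 0] `<=` K.
  by rewrite ((closure_id K).1 clK); apply: closureS => p; exact: hK.
split => //; last exact: subset_trans KO.
by apply: (subclosed_compact _ cK) => //; exact: closed_closure.
Qed.

Lemma test_function_pol_add A B C D :
  bumpfun 0 1 A -> bumpfun (- b) b B -> bumpfun 0 1 C -> bumpfun (- b) b D ->
  test_function (wedge b) (fun p => pol A B p + pol C D p).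
Proof.
move=> hA hB hC hD.
have [K [cK Kw KA]] := pol_support hA hB; have [L [cL Lw LC]] := pol_support hC hD.
apply: (@test_function_of_support _ (K `|` L)).
- by move=> k; apply: Ck_add; exact: Ck_pol.
- exact: compactU.
- by move=> p [/Kw|/Lw].
- move=> p; have [->|/KA] := eqVneq (pol A B p) 0; last by left.
  by rewrite add0r => /LC; right.
Qed.

End bumps.

End polar_products.

(** * Integration on the plane *)

Section real_integration.
Context d (T : measurableType d) (R : realType) (m : {measure set T -> \bar R}).
Variables (D : set T) (mD : measurable D).
Implicit Types f g : T -> R.

Definition rint f := m.-integrable D (fun x => (f x)%:E).

Lemma rint_mfun f : rint f -> measurable_fun D f.
Proof. by move=> /(measurable_int m)/measurable_EFinP. Qed.

Lemma rint_le f g : measurable_fun D f -> rint g ->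
  (forall x, D x -> `|f x| <= g x) -> rint f.
Proof.
move=> mf ig fg; apply: (le_integrable mD _ _ ig); first exact/measurable_EFinP.
by move=> x Dx; rewrite /= lee_fin (le_trans (fg x Dx))// ler_norm.
Qed.

Lemma rint_bounded f (C : R) : (m D < +oo)%E -> measurable_fun D f ->
  (forall x, D x -> `|f x| <= C) -> rint f.
Proof.
move=> Doo mf fC; apply: (@rint_le _ (fun=> C)) => //.
apply/integrableP; split; first exact: measurable_cst.
by rewrite integral_cst// lte_mul_pinfty.
Qed.

Lemma rintD f g : rint f -> rint g -> rint (fun x => f x + g x).
Proof. by move=> hf hg; exact: (integrableD mD hf hg). Qed.

Lemma rintB f g : rint f -> rint g -> rint (fun x => f x - g x).
Proof. by move=> hf hg; exact: (integrableB mD hf hg). Qed.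

Lemma rintZ c f : rint f -> rint (fun x => c * f x).
Proof. by move=> hf; exact: (integrableZl mD c hf). Qed.

Lemma rint_mulbounded f g (C : R) : rint f -> measurable_fun D g ->
  (forall x, D x -> `|g x| <= C) -> rint (fun x => f x * g x).
Proof.
move=> hf mg gC; have mf := rint_mfun hf.
have C0 x : D x -> 0 <= C by move=> /gC; exact: le_trans.
apply: (@rint_le _ (fun x => C * `|f x|)); first exact: measurable_funM.
  by apply: rintZ; exact: integrable_norm.
by move=> x Dx; rewrite normrM mulrC ler_wpM2r// gC.
Qed.

Lemma L2_mfun f : L2 m D f -> measurable_fun D f. Proof. by case. Qed.

Lemma L2_rint f : (m D < +oo)%E -> L2 m D f -> rint f.
Proof.
move=> Doo [mf hf]; apply: (@rint_le _ (fun x => 1 + f x ^+ 2)) => //.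
  apply: rintD => //; apply: (@rint_bounded _ 1) => //.
  by move=> x _; rewrite normr1.
move=> x _; have := sqr_ge0 (`|f x| - 1); rewrite sqrrB expr1n mulr1 real_normK ?num_real//.
by have := normr_ge0 (f x); lra.
Qed.

Lemma L2_mul f g : L2 m D f -> L2 m D g -> rint (fun x => f x * g x).
Proof.
move=> [mf hf] [mg hg]; apply: (@rint_le _ (fun x => f x ^+ 2 + g x ^+ 2)).
- exact: measurable_funM.
- exact: rintD.
- move=> x _; rewrite normrM -(real_normK (num_real (f x))) -(real_normK (num_real (g x))).
  by have := sqr_ge0 (`|f x| - `|g x|); have := normr_ge0 (f x); have := normr_ge0 (g x); nra.
Qed.

Lemma L2_bounded f (C : R) : (m D < +oo)%E -> measurable_fun D f ->
  (forall x, D x -> `|f x| <= C) -> L2 m D f.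
Proof.
move=> Doo mf fC; split => //.
apply: (@rint_bounded _ (C ^+ 2)) => //; first exact: measurable_funX.
by move=> x Dx; rewrite normrX lerXn2r ?nnegrE// ?fC// (le_trans _ (fC x Dx)).
Qed.

Lemma RintD f g : rint f -> rint g ->
  \int[m]_(x in D) (f x + g x) = \int[m]_(x in D) f x + \int[m]_(x in D) g x.
Proof. by move=> hf hg; exact: RintegralD. Qed.

Lemma RintB f g : rint f -> rint g ->
  \int[m]_(x in D) (f x - g x) = \int[m]_(x in D) f x - \int[m]_(x in D) g x.
Proof. by move=> hf hg; exact: RintegralB. Qed.

Lemma RintZ c f : rint f ->
  \int[m]_(x in D) (c * f x) = c * \int[m]_(x in D) f x.
Proof. by move=> hf; exact: RintegralZl. Qed.

Lemma RintN f : rint f ->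
  \int[m]_(x in D) (- f x) = - \int[m]_(x in D) f x.
Proof.
by move=> hf; rewrite -mulN1r -RintZ//; apply: eq_Rintegral => x _; rewrite mulN1r.
Qed.

Lemma Rint_dct (fn : nat -> T -> R) f g :
  (forall n, measurable_fun D (fn n)) -> measurable_fun D f -> rint g ->
  (forall n x, D x -> `|fn n x| <= g x) ->
  (forall x, D x -> fn n x @[n --> \oo] --> f x) ->
  rint f /\ (\int[m]_(x in D) fn n x) @[n --> \oo] --> \int[m]_(x in D) f x.
Proof.
move=> mfn mf ig fng fnf.
have [|||||h1 _ h3] := @dominated_convergence _ _ _ m D mD
  (fun n x => (fn n x)%:E) (fun x => (f x)%:E) (fun x => (g x)%:E).
- by move=> n; exact/measurable_EFinP.
- exact/measurable_EFinP.
- by apply/aeW => x Dx; apply/fine_cvgP; split; [exact: nearW|exact: fnf].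
- exact: ig.
- by apply/aeW => x n Dx; rewrite /= lee_fin fng.
split => //; have hfin : (\int[m]_(x in D) (f x)%:E)%E \is a fin_num by exact: integrable_fin_num.
rewrite -(fineK hfin) in h3.
by move/fine_cvgP : h3 => [].
Qed.

(** Transfers an integral identity from approximants to their limit: from cut-off fields in Green's
    formula, and from smooth functions to indicators in the completeness argument. *)
Lemma Rint_dct_eq (fn : nat -> T -> R) f g (l : R) :
  (forall n, measurable_fun D (fn n)) -> measurable_fun D f -> rint g ->
  (forall n x, D x -> `|fn n x| <= g x) ->
  (forall x, D x -> fn n x @[n --> \oo] --> f x) ->
  (\forall n \near \oo, \int[m]_(x in D) fn n x = l) -> \int[m]_(x in D) f x = l.
Proof.
move=> mfn mf ig fng fnf E.
have [_ h] := Rint_dct mfn mf ig fng fnf.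
have h' : (\int[m]_(x in D) fn n x) @[n --> \oo] --> l.
  by apply/cvg_ballP => e e0; apply: filterS E => n ->; exact: ballxx.
exact: (cvg_unique (@Rhausdorff R) h h').
Qed.

End real_integration.

Section plane_measure.
Context {R : realType}.
Implicit Types (f g : R * R -> R) (U D : set (R * R)).

(** The measurable structure is that of the product, so the open set is written as the countable
    union of the boxes with rational corners that it contains. *)
Lemma open_measurable_plane U : open U -> measurable (U : set (mplane R)).
Proof.
move=> oU.
pose box (q : (rat * rat) * (rat * rat)) : set (mplane R) :=
  `]ratr q.1.1, ratr q.1.2[%classic `*` `]ratr q.2.1, ratr q.2.2[%classic.
have mbox q : measurable (box q) by apply: measurableX; exact: measurable_itv.
rewrite (_ : U = \bigcup_(q in [set q | box q `<=` U]) box q).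
  rewrite bigcup_mkcond; apply: countable_bigcupT_measurable => // q.
  by case: ifP.
apply/seteqP; split => [p Up|p [q]]; last by apply.
have /nbhs_ballP[e /= e0 he] : nbhs p U by exact: open_nbhs_nbhs.
have lt1 (x : R) : x - e < x by rewrite gtrBl.
have lt2 (x : R) : x < x + e by rewrite ltrDl.
have [a1] := rat_in_itvoo (lt1 p.1); have [b1] := rat_in_itvoo (lt2 p.1).
have [a2] := rat_in_itvoo (lt1 p.2); have [b2] := rat_in_itvoo (lt2 p.2).
rewrite !in_itv /= => /andP[h1 h2] /andP[h3 h4] /andP[h5 h6] /andP[h7 h8].
exists ((a1, b1), (a2, b2)); last by split; rewrite /= in_itv /= ?h8 ?h5 ?h4 ?h1.
move=> [x y] [/=]; rewrite !in_itv /= => /andP[k1 k2] /andP[k3 k4].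
apply: he; split; rewrite /ball /= ltr_norml; lra.
Qed.

Lemma open_continuous_mfun D f : open D ->
  (forall p, D p -> {for p, continuous f}) ->
  measurable_fun (D : set (mplane R)) (f : mplane R -> R).
Proof.
move=> oD cf; apply: (measurability _ (RGenOpens.measurableE R)).
move=> _ [_ [a [b ->] <-]].
suff oI : open (D `&` f @^-1` `]a, b[) by exact: open_measurable_plane.
rewrite openE => p [Dp fp].
have h1 : nbhs p D by exact: open_nbhs_nbhs.
have h2 : nbhs p (f @^-1` `]a, b[).
  by apply: (cf p Dp); apply: open_nbhs_nbhs; split => //; exact: interval_open.
exact: filterI h1 h2.
Qed.

Lemma wedge_box (b : R) p : wedge b p -> 0 < p.1 < 1 /\ -1 < p.2 < 1.
Proof.
move=> [p0 r1 _]; have r0 := prad_gt0 p0; have r2 := prad2 p.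
by split; have := sqr_ge0 p.2; nra.
Qed.

Lemma measurable_wedge (b : R) : measurable (wedge b : set (mplane R)).
Proof. by have := @open_wedge R b; exact: open_measurable_plane. Qed.

Lemma area_wedge_lty (b : R) : (area R (wedge b) < +oo)%E.
Proof.
have mbox : measurable (`[0, 1]%classic `*` `[-1, 1]%classic : set (mplane R)).
  by apply: measurableX; exact: measurable_itv.
apply: (@le_lt_trans _ _ (area R (`[0, 1]%classic `*` `[-1, 1]%classic))).
  apply: le_measure; rewrite ?inE//; first exact: measurable_wedge.
  move=> p /wedge_box[h1 h2]; split; rewrite /= in_itv /=; lra.
have -> : area R (`[0, 1]%classic `*` `[-1, 1]%classic) =
    (lebesgue_measure (`[0%R, 1%R]%classic : set R) * lebesgue_measure (`[(-1)%R, 1%R]%classic : set R))%E.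
  by apply: product_measure1E; exact: measurable_itv.
by rewrite !lebesgue_measure_itv /= !lte_fin; case: ifP => _; case: ifP => _; rewrite -?EFinD -?EFinM ?mule0 ?mul0e// ltry.
Qed.

End plane_measure.

(** * Green's formula in the sector for separated functions *)

Section cutoff.
Context {R : realType}.
Implicit Types lo hi x : R.

(** The derivative of the cutoff has size at most [K * n.+1] and is nonzero only where
    [n.+1 * (x - lo) <= 2], hence the bound by a multiple of the inverse distance. For fixed [x]
    both the cutoff and its derivative are eventually constant. *)
Lemma sstep_half (lo : R) : exists (c' : nat -> R -> R) (K : R),
  [/\ 0 < K,
      forall n x, is_derive x (1 : R) (fun y => sstep (n.+1%:R * (y - lo))) (c' n x),
      forall n x, lo < x -> `|c' n x| <= K * (x - lo)^-1,
      forall x, lo < x -> c' n x @[n --> \oo] --> 0 &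
      forall x, lo < x -> sstep (n.+1%:R * (x - lo)) @[n --> \oo] --> (1 : R)].
Proof.
have [s' [K [K0 ds ss sK s12]]] := @sstep_derivative R.
have big x : lo < x -> \forall n \near \oo, 2 < n.+1%:R * (x - lo).
  move=> lx; have d0 : 0 < x - lo by rewrite subr_gt0.
  have e0 : 0 < (x - lo) / 2 by rewrite divr_gt0.
  near=> n; have : n.+1%:R^-1 < (x - lo) / 2 by near: n; exact: (near_infty_natSinv_lt (PosNum e0)).
  by rewrite -[n.+1%:R^-1]mul1r ltr_pdivrMr// => h; lra.
exists (fun n x => s' (n.+1%:R * (x - lo)) * n.+1%:R), (2 * K); split.
- by rewrite mulr_gt0.
- move=> n x; apply: (@is_derive_comp _ _ sstep (fun y => n.+1%:R * (y - lo))) => //.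
  apply: (is_derive_eq (is_derive_scale n.+1%:R (is_derive_sub (is_derive_id x (1 : R)) (is_derive_const lo x (1 : R))))).
  by rewrite subr0 mulr1.
- move=> n x lx; have d0 : 0 < x - lo by rewrite subr_gt0.
  have [->|/s12/andP[_ h]] := eqVneq (s' (n.+1%:R * (x - lo))) 0.
    by rewrite mul0r normr0 mulr_ge0 ?invr_ge0 ?ltW// mulr_gt0.
  rewrite normrM [`|n.+1%:R|]ger0_norm// mulrC ler_pdivlMr//.
  rewrite mulrAC; apply: ler_pM => //; first by rewrite mulr_ge0// ltW.
- move=> x lx; apply/cvg_ballP => e e0; apply: filterS (big x lx) => n h.
  suff -> : s' (n.+1%:R * (x - lo)) * n.+1%:R = 0 by exact: ballxx.
  apply/eqP; rewrite mulf_eq0; apply/orP; left.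
  by apply: contraTT h => /s12/andP[_]; rewrite -leNgt.
- move=> x lx; apply/cvg_ballP => e e0; apply: filterS (big x lx) => n h.
  by rewrite sstep_eq1 ?ltW//; exact: ballxx.
Unshelve. all: by end_near. Qed.

(** A product of two one-sided cutoffs, the right one obtained by reflecting [x] to [- x]. The
    derivatives are not bounded uniformly in [n]; the bound by inverse distances to the endpoints is
    designed to be absorbed by functions decaying linearly at the endpoints. *)
Lemma cutoff lo hi : exists (c c' : nat -> R -> R) (K : R),
  [/\ 0 < K, forall n, bumpfun lo hi (c n) /\ smooth1 setT (c n),
      forall n x, is_derive x (1 : R) (c n) (c' n x),
      forall n x, 0 <= c n x <= 1 &
   [/\ forall n x, itvoo lo hi x -> `|c' n x| <= K * ((x - lo)^-1 + (hi - x)^-1),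
      forall x, itvoo lo hi x -> c' n x @[n --> \oo] --> 0 &
      forall x, itvoo lo hi x -> c n x @[n --> \oo] --> (1 : R)]].
Proof.
have [a' [K [K0 da ha ca c1]]] := sstep_half lo.
have [b' [L [L0 db hb cb c2]]] := sstep_half (- hi).
have Nhi x : - x - - hi = hi - x by rewrite opprK addrC.
have sI n (x : R) : `|sstep (n.+1%:R * x)| <= 1.
  by have /andP[? ?] := sstep_itv (n.+1%:R * x); rewrite ger0_norm.
exists (fun n x => sstep (n.+1%:R * (x - lo)) * sstep (n.+1%:R * (- x - - hi))).
exists (fun n x => a' n x * sstep (n.+1%:R * (- x - - hi)) - sstep (n.+1%:R * (x - lo)) * b' n (- x)).
exists (K + L); split.
- by rewrite addr_gt0.
- move=> n; have sm : smooth1 setT (fun x => sstep (n.+1%:R * (x - lo)) * sstep (n.+1%:R * (- x - - hi))).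
    move=> k; apply: Sk_mul; apply: (@Sk_comp _ _ setT) => //; try exact: smooth1_sstep.
      by apply: Sk_scale; apply: Sk_sub_fun; [exact: Sk_id|exact: Sk_cst].
    by apply: Sk_scale; apply: Sk_sub_fun; [apply: Sk_opp; exact: Sk_id|exact: Sk_cst].
  split=> //; split; first by move=> k; apply: Sk_sub (sm k).
  exists (lo + n.+1%:R^-1), (hi - n.+1%:R^-1); split.
  + by rewrite ltrDl invr_gt0.
  + by rewrite gtrBl invr_gt0.
  + move=> x; rewrite mulf_eq0 negb_or Nhi => /andP[h1 h2].
    apply/andP; split.
      rewrite -lerBrDl -[n.+1%:R^-1]mulr1 ler_pdivrMl//; apply: contraNT h1.
      by rewrite -ltNge => /ltW/sstep_eq0 ->.
    rewrite lerBrDr -lerBrDl -[n.+1%:R^-1]mulr1 ler_pdivrMl//; apply: contraNT h2.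
    by rewrite -ltNge => /ltW/sstep_eq0 ->.
- move=> n x.
  have h : is_derive x (1 : R) (fun y => sstep (n.+1%:R * (- y - - hi))) (- b' n (- x)).
    apply: (is_derive_eq (@is_derive_comp _ _ (fun y => sstep (n.+1%:R * (y - - hi))) _ _ _ _ _ (db n (- x)) (is_derive_opp (is_derive_id x (1 : R))))).
    by rewrite mulrN1.
  by apply: (is_derive_eq (is_derive_mul (da n x) h)); rewrite mulrN.
- move=> n x; have /andP[? ?] := sstep_itv (n.+1%:R * (x - lo)).
  have /andP[? ?] := sstep_itv (n.+1%:R * (- x - - hi)).
  by rewrite mulr_ge0//= mulr_ile1.
split.
- move=> n x /andP[lx xh]; have xh' : - hi < - x by rewrite ltrN2.
  have d1 : 0 <= (x - lo)^-1 by rewrite invr_ge0 subr_ge0 ltW.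
  have d2 : 0 <= (hi - x)^-1 by rewrite invr_ge0 subr_ge0 ltW.
  rewrite (le_trans (ler_normB _ _))// [`|a' n x * _|]normrM [`|_ * b' n _|]normrM.
  have := ha n x lx; have := hb n (- x) xh'; rewrite Nhi => h1 h2.
  have h3 := sI n (x - lo); have h4 := sI n (hi - x).
  rewrite (@le_trans _ _ (K * (x - lo)^-1 + L * (hi - x)^-1))//.
    apply: lerD; [rewrite -[leRHS]mulr1|rewrite -[leRHS]mul1r]; exact: ler_pM.
  move: d1 d2 => {h1 h2}; move: (x - lo)^-1 (hi - x)^-1 => u w u0 w0.
  by have := mulr_ge0 (ltW K0) w0; have := mulr_ge0 (ltW L0) u0; lra.
- move=> x /andP[lx xh]; have xh' : - hi < - x by rewrite ltrN2.
  rewrite (_ : 0 = 0 * 1 - 1 * 0); last by rewrite mul0r mulr0 subrr.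
  by apply: cvgB; apply: cvgM; [exact: ca|exact: c2|exact: c1|exact: cb].
- move=> x /andP[lx xh]; have xh' : - hi < - x by rewrite ltrN2.
  have h := cvgM (c1 _ lx) (c2 _ xh'); rewrite mulr1 in h; exact: h.
Qed.

Lemma smooth1_deriv (I : set R) (f f' : R -> R) : open I -> smooth1 I f ->
  (forall x, I x -> is_derive x (1 : R) f (f' x)) -> smooth1 I f'.
Proof.
move=> oI sf hf; have [g hg sg] := smooth1_derive oI sf => k.
apply: (Sk_ext oI _ (sg k)) => x Ix.
by have [_ <-] := hf x Ix; have [_ <-] := hg x Ix.
Qed.

End cutoff.

Section green.
Context {R : realType}.
Implicit Types (p e : R * R) (v : R * R -> R) (h : R * R -> R * R).

Lemma is_derive_prad_pang (A B : R -> R) (a' b' : R) p e : 0 < p.1 ->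
  is_derive (prad p) (1 : R) A a' ->
  is_derive (pang p) (1 : R) B b' ->
  is_derive p e (fun q => A (prad q) * B (pang q))
    (a' * (cos (pang p) * e.1 + sin (pang p) * e.2) * B (pang p) +
     A (prad p) * (b' * ((cos (pang p) * e.2 - sin (pang p) * e.1) / prad p))).
Proof.
move=> p0 dA dB.
have h1 := @is_derive_comp R _ A prad p e _ _ dA (is_derive_prad e p0).
have h2 := @is_derive_comp R _ B pang p e _ _ dB (is_derive_pang e p0).
exact: (is_derive_mul h1 h2).
Qed.

Lemma is_derive_pol_local (A B : R -> R) (a' b' : R) p e : 0 < p.1 ->
  is_derive (prad p) (1 : R) A a' ->
  is_derive (pang p) (1 : R) B b' ->
  is_derive p e (pol A B)
    (a' * (cos (pang p) * e.1 + sin (pang p) * e.2) * B (pang p) +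
     A (prad p) * (b' * ((cos (pang p) * e.2 - sin (pang p) * e.1) / prad p))).
Proof.
move=> p0 dA dB.
apply: (is_derive_near open_fst_gt0 p0 _ (is_derive_prad_pang e p0 dA dB)).
by move=> q /= q0; rewrite /pol q0.
Qed.

(** The Cartesian gradient of [f(r) T(theta)], with [f1] and [T1] standing for the derivatives;
    [plap] is its Laplacian in polar form. *)
Definition pgrad (f f1 T T1 : R -> R) p : R * R :=
  (f1 (prad p) * (cos (pang p) * T (pang p)) - (prad p)^-1 * f (prad p) * (sin (pang p) * T1 (pang p)),
   f1 (prad p) * (sin (pang p) * T (pang p)) + (prad p)^-1 * f (prad p) * (cos (pang p) * T1 (pang p))).

Definition plap (f f1 f2 T T2 : R -> R) p : R :=
  (f2 (prad p) + (prad p)^-1 * f1 (prad p)) * T (pang p) +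
  (prad p)^-2 * f (prad p) * T2 (pang p).

(* [w = f(r) T(theta)] satisfies the Neumann condition on the arc ([f1] vanishes
   at 1) and on the radii ([T1] vanishes at [b] and [- b]), and is small enough at
   the origin for the cutoff terms in Green's formula to vanish in the limit. *)
Definition neumann_mode (b : R) (f f1 f2 T T1 T2 : R -> R) (C : R) : Prop :=
  [/\ smooth1 (itvoo 0 1) f /\ smooth1 (itvoo (- b) b) T,
      (forall r, itvoo 0 1 r -> is_derive r (1 : R) f (f1 r)) /\
      (forall r, itvoo 0 1 r -> is_derive r (1 : R) f1 (f2 r)),
      (forall t, itvoo (- b) b t -> is_derive t (1 : R) T (T1 t)) /\
      (forall t, itvoo (- b) b t -> is_derive t (1 : R) T1 (T2 t)),
      (forall r, itvoo 0 1 r -> [/\ `|f1 r| <= C * r, `|f1 r| <= C * (1 - r) & `|f2 r| <= C]) &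
      (forall r t, itvoo 0 1 r -> itvoo (- b) b t ->
         [/\ `|T t| <= C, `|f r * T1 t| <= C * (r ^+ 2 * (b - `|t|)) & `|f r * T2 t| <= C * r ^+ 2])].

Section fixed_b.
Variables (b : R) (b0 : 0 < b) (b_pi2 : b <= pi / 2).

Lemma prad_comp_continuous (A : R -> R) p : wedge b p -> smooth1 (itvoo 0 1) A ->
  {for p, continuous (fun q => A (prad q))}.
Proof.
move=> /wedgeP[p0 hr ht] sA; apply: continuous_comp; first exact: prad_continuous.
exact: (sA 0%N).
Qed.

Lemma pang_comp_continuous (B : R -> R) p : wedge b p -> smooth1 (itvoo (- b) b) B ->
  {for p, continuous (fun q => B (pang q))}.
Proof.
move=> /wedgeP[p0 hr ht] sB; apply: continuous_comp; first exact: pang_continuous.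
exact: (sB 0%N).
Qed.

Lemma prad_pang_mfun (A B : R -> R) : smooth1 (itvoo 0 1) A -> smooth1 (itvoo (- b) b) B ->
  measurable_fun (wedge b : set (mplane R)) (fun q : mplane R => A (prad q) * B (pang q)).
Proof.
move=> sA sB; apply: open_continuous_mfun; first exact: open_wedge.
by move=> p wp; apply: cvgM; [exact: prad_comp_continuous|exact: pang_comp_continuous].
Qed.

Lemma continuous_mfun (f : R * R -> R) : continuous f ->
  measurable_fun (wedge b : set (mplane R)) (f : mplane R -> R).
Proof. by move=> cf; apply: open_continuous_mfun => [|p _]; [exact: open_wedge|exact: cf]. Qed.

Lemma smooth1_rV : smooth1 (itvoo 0 1) (fun r : R => r^-1).
Proof. by move=> k; apply: Sk_inv => [x /andP[x0 _]|]; [rewrite gt_eqF|exact: Sk_id]. Qed.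

Lemma pgrad_mfun f f1 f2 T T1 T2 C : neumann_mode b f f1 f2 T T1 T2 C ->
  measurable_fun (wedge b : set (mplane R)) (fun p : mplane R => (pgrad f f1 T T1 p).1) /\
  measurable_fun (wedge b : set (mplane R)) (fun p : mplane R => (pgrad f f1 T T1 p).2).
Proof.
move=> [[sf sT] [df df1] [dT dT1] _ _].
have sf1 := smooth1_deriv (@open_itvoo _ _ _) sf df.
have sT1 := smooth1_deriv (@open_itvoo _ _ _) sT dT.
have sc I k : Sk I k (@cos R) by exact: (Sk_cos_sin _ _).1.
have ss I k : Sk I k (@sin R) by exact: (Sk_cos_sin _ _).2.
have sr : smooth1 (itvoo 0 1) (fun r => r^-1 * f r).
  by move=> k; apply: Sk_mul => //; exact: smooth1_rV.
have scT T' k : Sk (itvoo (- b) b) k T' -> Sk (itvoo (- b) b) k (fun t => cos t * T' t).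
  by move=> ?; exact: Sk_mul.
have ssT T' k : Sk (itvoo (- b) b) k T' -> Sk (itvoo (- b) b) k (fun t => sin t * T' t).
  by move=> ?; exact: Sk_mul.
split.
  apply: measurable_funB.
    by apply: (prad_pang_mfun (A := f1) (B := fun t => cos t * T t)) => // k; exact: scT.
  by apply: (prad_pang_mfun (A := fun r => r^-1 * f r) (B := fun t => sin t * T1 t)) => // k; exact: ssT.
apply: measurable_funD.
  by apply: (prad_pang_mfun (A := f1) (B := fun t => sin t * T t)) => // k; exact: ssT.
by apply: (prad_pang_mfun (A := fun r => r^-1 * f r) (B := fun t => cos t * T1 t)) => // k; exact: scT.
Qed.

Lemma plap_mfun f f1 f2 T T1 T2 C : neumann_mode b f f1 f2 T T1 T2 C ->
  measurable_fun (wedge b : set (mplane R)) (plap f f1 f2 T T2 : mplane R -> R).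
Proof.
move=> [[sf sT] [df df1] [dT dT1] _ _].
have sf1 := smooth1_deriv (@open_itvoo _ _ _) sf df.
have sf2 := smooth1_deriv (@open_itvoo _ _ _) sf1 df1.
have sT1 := smooth1_deriv (@open_itvoo _ _ _) sT dT.
have sT2 := smooth1_deriv (@open_itvoo _ _ _) sT1 dT1.
apply: measurable_funD.
  apply: (prad_pang_mfun (A := fun r => f2 r + r^-1 * f1 r)) => //.
  by move=> k; apply: Sk_add => //; apply: Sk_mul => //; exact: smooth1_rV.
apply: (prad_pang_mfun (A := fun r => r ^- 2 * f r)) => //.
move=> k; apply: Sk_mul => //; apply: Sk_inv => [x /andP[x0 _]|].
  by rewrite gt_eqF// exprn_gt0.
by apply: Sk_expn; exact: Sk_id.
Qed.

Lemma pgrad_bound f f1 f2 T T1 T2 C p : neumann_mode b f f1 f2 T T1 T2 C -> wedge b p ->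
  `|f1 (prad p)| * `|T (pang p)| + `|(prad p)^-1 * f (prad p)| * `|T1 (pang p)| <= C * C + C * b.
Proof.
move=> [_ _ _ hf hT] /wedgeP[p0 hr ht].
have /andP[r0 r1] := hr; have [h1 h2 _] := hf _ hr; have [h3 h4 _] := hT _ _ hr ht.
have C0 : 0 <= C by exact: le_trans h3.
apply: lerD.
  by apply: ler_pM => //; rewrite (le_trans h1)//; nra.
have r0' := ltW r0.
rewrite -normrM -mulrA normrM [`|_^-1|]ger0_norm ?invr_ge0// ler_pdivrMl//.
apply: (le_trans h4).
have t0 := normr_ge0 (pang p); have tb : `|pang p| < b by rewrite ltr_norml.
have k : 0 <= b - prad p * (b - `|pang p|) by nra.
by have := mulr_ge0 (mulr_ge0 r0' C0) k; nra.
Qed.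

Lemma plap_bound f f1 f2 T T1 T2 C p : neumann_mode b f f1 f2 T T1 T2 C -> wedge b p ->
  `|plap f f1 f2 T T2 p| <= (C + C) * C + C.
Proof.
move=> [_ _ _ hf hT] /wedgeP[p0 hr ht].
have /andP[r0 r1] := hr; have [h1 h2 h5] := hf _ hr; have [h3 _ h4] := hT _ _ hr ht.
have C0 : 0 <= C by exact: le_trans h3.
have r0' := ltW r0.
rewrite /plap (le_trans (ler_normD _ _))//; apply: lerD; rewrite normrM.
  apply: ler_pM => //; rewrite (le_trans (ler_normD _ _))//; apply: lerD => //.
  by rewrite normrM [`|_^-1|]ger0_norm ?invr_ge0// ler_pdivrMl// mulrC.
rewrite -normrM -mulrA normrM ger0_norm ?invr_ge0 ?exprn_ge0// ler_pdivrMl ?exprn_gt0//.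
by rewrite [leRHS]mulrC.
Qed.

(** The two summands are the Cartesian components of the field whose radial component is
    [A(r) B(theta)] and whose angular component is [G(r) E(theta)]; the right side is the divergence
    in polar coordinates. *)
Lemma pol_divergence (A A' B B' G G' E E' : R -> R) p : 0 < p.1 ->
  is_derive (prad p) (1 : R) A (A' (prad p)) ->
  is_derive (pang p) (1 : R) B (B' (pang p)) ->
  is_derive (prad p) (1 : R) G (G' (prad p)) ->
  is_derive (pang p) (1 : R) E (E' (pang p)) ->
  partial1 (fun q => pol A (fun t => cos t * B t) q + pol (fun r => - G r) (fun t => sin t * E t) q) p +
  partial2 (fun q => pol A (fun t => sin t * B t) q + pol G (fun t => cos t * E t) q) p =
  (A' (prad p) + (prad p)^-1 * A (prad p)) * B (pang p) +
  (prad p)^-1 * G (prad p) * E' (pang p).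
Proof.
move=> p0 dA dB dG dE.
have dc Y y' : is_derive (pang p) (1 : R) Y y' ->
    is_derive (pang p) (1 : R) (fun t => cos t * Y t)
      (- sin (pang p) * Y (pang p) + cos (pang p) * y').
  by move=> dY; exact: (is_derive_mul (is_derive_cos _) dY).
have ds Y y' : is_derive (pang p) (1 : R) Y y' ->
    is_derive (pang p) (1 : R) (fun t => sin t * Y t)
      (cos (pang p) * Y (pang p) + sin (pang p) * y').
  by move=> dY; exact: (is_derive_mul (is_derive_sin _) dY).
have dN : is_derive (prad p) (1 : R) (fun r => - G r) (- G' (prad p)).
  exact: is_derive_opp.
have [_ h1] := is_derive_add (is_derive_pol_local (1, 0) p0 dA (dc _ _ dB))
  (is_derive_pol_local (1, 0) p0 dN (ds _ _ dE)).
have [_ h2] := is_derive_add (is_derive_pol_local (0, 1) p0 dA (ds _ _ dB))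
  (is_derive_pol_local (0, 1) p0 dG (dc _ _ dE)).
rewrite /partial1 /partial2 h1 h2 /=.
have r0 : prad p != 0 by rewrite gt_eqF// prad_gt0.
have cs := cos2Dsin2 (pang p).
move: (cos (pang p)) (sin (pang p)) cs => c s cs.
(* The left side contains squares of [c] and [s] where the right side has 1; multiplying the right
   side by [c^2 + s^2] leaves an identity valid for arbitrary [c] and [s]. *)
have E0 X : X = X * (c ^+ 2 + s ^+ 2) by rewrite cs mulr1.
by rewrite [RHS]E0; field.
Qed.

Lemma ler_norm_mul (x y X Y : R) : `|x| <= X -> `|y| <= Y -> `|x * y| <= X * Y.
Proof. by move=> hx hy; rewrite normrM; exact: ler_pM. Qed.

Lemma ler_norm_add (x y X Y : R) : `|x| <= X -> `|y| <= Y -> `|x + y| <= X + Y.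
Proof. by move=> hx hy; rewrite (le_trans (ler_normD _ _))// lerD. Qed.

Lemma continuous_bounded (f : R * R -> R) : continuous f ->
  exists C : R, forall p, wedge b p -> `|f p| <= C.
Proof.
move=> cf; have [|||c _ hc] := @compact_EVT_max _ R (fun p => `|f p|) (`[0, 1] `*` `[-1, 1]).
- by exists (0, 0); split; rewrite /= in_itv /=; lra.
- by apply: compact_setX; exact: segment_compact.
- apply: continuous_subspaceT => p; apply: continuous_comp; [exact: cf|exact: norm_continuous].
exists `|f c| => p /wedge_box[h1 h2]; apply: hc; rewrite inE; split; rewrite /= in_itv /=; lra.
Qed.

Lemma rint_mul_continuous v (f : R * R -> R) : rint (area R) (wedge b) v ->
  continuous f -> rint (area R) (wedge b) (fun p => v p * f p).
Proof.
move=> iv cf; have [C hC] := continuous_bounded cf.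
by apply: (rint_mulbounded (@measurable_wedge R b) iv (continuous_mfun cf)) => p; exact: hC.
Qed.

(* The weak gradient is tested against [c_n(r) d_n(theta) grad w], with cutoffs
   [c_n], [d_n] tending to 1; the Neumann bounds dominate the terms containing
   the derivatives of the cutoffs. *)
Lemma green v h f f1 f2 T T1 T2 C :
  neumann_mode b f f1 f2 T T1 T2 C -> H1 (wedge b) v h ->
  [/\ rint (area R) (wedge b) (fun p => v p * plap f f1 f2 T T2 p),
      rint (area R) (wedge b) (fun p => dot (h p) (pgrad f f1 T T1 p)) &
      \int[area R]_(p in wedge b) dot (h p) (pgrad f f1 T T1 p) =
      - \int[area R]_(p in wedge b) (v p * plap f f1 f2 T T2 p)].
Proof.
move=> hm [Lv Lh1 Lh2 hw].
have mW := @measurable_wedge R b; have Woo := @area_wedge_lty R b.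
have iv := L2_rint mW Woo Lv; have ih1 := L2_rint mW Woo Lh1.
have ih2 := L2_rint mW Woo Lh2.
have mv := L2_mfun Lv; have mh1 := L2_mfun Lh1; have mh2 := L2_mfun Lh2.
have [mg1 mg2] := pgrad_mfun hm; have ml := plap_mfun hm.
pose M := (C + C) * C + C; pose N := C * C + C * b.
have cs1 (t : R) : `|cos t| <= 1 by rewrite ler_norml cos_geN1 cos_le1.
have sn1 (t : R) : `|sin t| <= 1 by rewrite ler_norml sin_geN1 sin_le1.
have trig (x y c s : R) : `|c| <= 1 -> `|s| <= 1 -> `|x| + `|y| <= N ->
    `|x * c - y * s| <= N /\ `|x * c + y * s| <= N.
  move=> c1 s1 xy; have h1 : `|x * c| <= `|x| by rewrite normrM ler_piMr.
  have h2 : `|y * s| <= `|y| by rewrite normrM ler_piMr.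
  by split; [rewrite (le_trans (ler_normB _ _))|rewrite (le_trans (ler_normD _ _))];
    rewrite // (le_trans _ xy)// lerD.
have gb p : wedge b p -> `|(pgrad f f1 T T1 p).1| <= N /\ `|(pgrad f f1 T T1 p).2| <= N.
  move=> wp; have := pgrad_bound hm wp; rewrite -!normrM /pgrad /= => h0.
  split.
    have -> : f1 (prad p) * (cos (pang p) * T (pang p)) - (prad p)^-1 * f (prad p) * (sin (pang p) * T1 (pang p)) =
      f1 (prad p) * T (pang p) * cos (pang p) - (prad p)^-1 * f (prad p) * T1 (pang p) * sin (pang p) by ring.
    exact: (trig _ _ _ _ (cs1 _) (sn1 _) h0).1.
  have -> : f1 (prad p) * (sin (pang p) * T (pang p)) + (prad p)^-1 * f (prad p) * (cos (pang p) * T1 (pang p)) =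
      f1 (prad p) * T (pang p) * sin (pang p) + (prad p)^-1 * f (prad p) * T1 (pang p) * cos (pang p) by ring.
  exact: (trig _ _ _ _ (sn1 _) (cs1 _) h0).2.
have [c [c' [K [K0 hc dc c01 [c'b c'0 c1]]]]] := @cutoff R 0 1.
have [d [d' [L [L0 hd dd d01 [d'b d'0 d1]]]]] := @cutoff R (- b) b.
have [[sf sT] [df df1] [dT dT1] hf hT] := hm.
have sf1 := smooth1_deriv (@open_itvoo _ _ _) sf df.
have sT1 := smooth1_deriv (@open_itvoo _ _ _) sT dT.
(* [A] and [B] carry the cut-off radial component of the gradient, [G] and [E] the angular one;
   primes denote the derivatives on the open intervals. *)
pose A n r := f1 r * c n r; pose A' n r := f2 r * c n r + f1 r * c' n r.
pose B n t := T t * d n t; pose B' n t := T1 t * d n t + T t * d' n t.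
pose G n r := r^-1 * f r * c n r.
pose G' n r := (- 1 / r ^+ 2 * f r + r^-1 * f1 r) * c n r + r^-1 * f r * c' n r.
pose E n t := T1 t * d n t; pose E' n t := T2 t * d n t + T1 t * d' n t.
have bA n : bumpfun 0 1 (A n) by apply: bump_mull => //; exact: (hc n).1.
have bB n : bumpfun (- b) b (B n) by apply: bump_mull => //; exact: (hd n).1.
have bE n : bumpfun (- b) b (E n) by apply: bump_mull => //; exact: (hd n).1.
have bG n : bumpfun 0 1 (G n).
  apply: bump_mull; last exact: (hc n).1.
  by move=> k; apply: Sk_mul => //; exact: smooth1_rV.
have bNG n : bumpfun 0 1 (fun r => - G n r).
  rewrite (_ : (fun r => - G n r) = (fun r => -1 * G n r)).
    by apply: bump_mull => // k; exact: Sk_cst.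
  by apply/funext => r; rewrite mulN1r.
pose F1 n q := pol (A n) (fun t => cos t * B n t) q + pol (fun r => - G n r) (fun t => sin t * E n t) q.
pose F2 n q := pol (A n) (fun t => sin t * B n t) q + pol (G n) (fun t => cos t * E n t) q.
have t1 n : test_function (wedge b) (F1 n).
  by apply: test_function_pol_add => //; [exact: bump_cos_mul|exact: bump_sin_mul].
have t2 n : test_function (wedge b) (F2 n).
  by apply: test_function_pol_add => //; [exact: bump_sin_mul|exact: bump_cos_mul].
have cF1 n : continuous (F1 n) by have [/(_ 0%N)[]] := t1 n.
have cF2 n : continuous (F2 n) by have [/(_ 0%N)[]] := t2 n.
have cP1 n : continuous (partial1 (F1 n)) by have [/(_ 1%N)[_ [_ _ [h0 _] _]]] := t1 n.
have cP2 n : continuous (partial2 (F2 n)) by have [/(_ 1%N)[_ [_ _ _ [h0 _]]]] := t2 n.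
(* The sum of the two weak-gradient identities, with the components [F1] and [F2] of the cut-off
   field as test functions. *)
pose fn n p := v p * partial1 (F1 n) p + v p * partial2 (F2 n) p +
   ((h p).1 * F1 n p + (h p).2 * F2 n p).
have int0 n : \int[area R]_(p in wedge b) fn n p = 0.
  have [e1 _] := hw _ (t1 n); have [_ e2] := hw _ (t2 n).
  rewrite /fn RintD//; last 2 first.
  - by apply: rintD => //; exact: rint_mul_continuous.
  - by apply: rintD => //; exact: rint_mul_continuous.
  rewrite RintD//; [|exact: rint_mul_continuous..].
  rewrite RintD//; [|exact: rint_mul_continuous..].
  by rewrite e1 e2; ring.
pose dv n p := (A' n (prad p) + (prad p)^-1 * A n (prad p)) * B n (pang p) +
   (prad p)^-1 * G n (prad p) * E' n (pang p).
have fnE n p : wedge b p -> fn n p = v p * dv n p + ((h p).1 * F1 n p + (h p).2 * F2 n p).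
  move=> /wedgeP[p0 hr ht]; rewrite /fn -mulrDr; congr (_ * _ + _).
  apply: (@pol_divergence (A n) (A' n) (B n) (B' n) (G n) (G' n) (E n) (E' n)) => //.
  - exact: (is_derive_mul (df1 _ hr) (dc n _)).
  - exact: (is_derive_mul (dT _ ht) (dd n _)).
  - have dV : is_derive (prad p) (1 : R) (fun r : R => r^-1) (- 1 / prad p ^+ 2).
      by apply: (@is_derive_inv _ _ id) => //; have /andP[r0 _] := hr; rewrite gt_eqF.
    exact: (is_derive_mul (is_derive_mul dV (df _ hr)) (dc n _)).
  - exact: (is_derive_mul (dT1 _ ht) (dd n _)).
(* First factor: [f2 c], then [f1 c'] with the two poles of [c'] absorbed by [|f1| <= C r] and
   [|f1| <= C (1 - r)], then [f1 / r]; all times [|T| <= C]. The rest bounds the [T2] term and the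
   [d'] term, where [b - |theta|] absorbs each of the two poles of [d'], whence the factor 2. *)
pose M' := (C + K * (C + C) + C) * C + (C + C * (L * 2)).
have c01' n x : `|c n x| <= 1 by have /andP[? ?] := c01 n x; rewrite ger0_norm.
have d01' n x : `|d n x| <= 1 by have /andP[? ?] := d01 n x; rewrite ger0_norm.
have dvb n p : wedge b p -> `|dv n p| <= M'.
  move=> /wedgeP[p0 hr ht]; have [h1 h2 h5] := hf _ hr; have [h3 h6 h4] := hT _ _ hr ht.
  have /andP[r0 r1] := hr; have C0 : 0 <= C by exact: le_trans h3.
  have rV0 : 0 <= (prad p)^-1 by rewrite invr_ge0 ltW.
  apply: ler_norm_add.
    apply: ler_norm_mul; last by rewrite -[leRHS]mulr1; exact: ler_norm_mul.
    apply: ler_norm_add.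
      apply: ler_norm_add; first by rewrite -[leRHS]mulr1; exact: ler_norm_mul.
      rewrite normrM; apply: (le_trans (ler_wpM2l (normr_ge0 _) (c'b n _ hr))).
      rewrite mulrCA ler_wpM2l ?(ltW K0)// mulrDr subr0; apply: lerD.
        by rewrite ler_pdivrMr.
      by rewrite ler_pdivrMr// subr_gt0.
    rewrite mulrA -[leRHS]mulr1; apply: ler_norm_mul => //.
    by rewrite normrM ger0_norm// mulrC ler_pdivrMr.
  have -> : (prad p)^-1 * G n (prad p) * E' n (pang p) =
     (prad p ^- 2 * (f (prad p) * T2 (pang p))) * (c n (prad p) * d n (pang p)) +
     (prad p ^- 2 * (f (prad p) * T1 (pang p))) * d' n (pang p) * c n (prad p).
    by rewrite /G /E'; field; rewrite gt_eqF.
  have s0 : 0 < prad p ^+ 2 by rewrite exprn_gt0.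
  apply: ler_norm_add.
    rewrite -[leRHS]mulr1; apply: ler_norm_mul; last by rewrite -[leRHS]mulr1; exact: ler_norm_mul.
    by rewrite normrM ger0_norm ?invr_ge0 ?(ltW s0)// mulrC ler_pdivrMr.
  rewrite -[leRHS]mulr1; apply: ler_norm_mul => //.
  have /andP[tl tr] := ht; have tb : `|pang p| < b by rewrite ltr_norml tl.
  have u0 : 0 < pang p - - b by rewrite subr_gt0.
  have w0 : 0 < b - pang p by rewrite subr_gt0.
  have q0 : 0 < b - `|pang p| by rewrite subr_gt0.
  rewrite normrM; apply: (@le_trans _ _ (C * (b - `|pang p|) * (L * ((pang p - - b)^-1 + (b - pang p)^-1)))).
    apply: ler_pM => //; last exact: d'b.
    rewrite normrM ger0_norm ?invr_ge0 ?(ltW s0)// mulrC ler_pdivrMr//.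
    by rewrite (le_trans h6)// mulrA mulrAC.
  rewrite -mulrA ler_wpM2l// mulrCA ler_wpM2l ?(ltW L0)// mulrDr.
  have -> : (2 : R) = 1 + 1 by [].
  apply: lerD; rewrite ler_pdivrMr// mul1r.
    by rewrite opprK [leRHS]addrC lerD2l lerNl -normrN ler_norm.
  by rewrite lerD2l lerN2 ler_norm.
have Fb n p : wedge b p -> `|F1 n p| <= N /\ `|F2 n p| <= N.
  move=> wp; have [p0 hr ht] := wedgeP wp.
  have h0 : `|f1 (prad p) * T (pang p) * (c n (prad p) * d n (pang p))| +
     `|(prad p)^-1 * f (prad p) * T1 (pang p) * (c n (prad p) * d n (pang p))| <= N.
    apply: le_trans (pgrad_bound hm wp); rewrite -!normrM.
    have k : `|c n (prad p) * d n (pang p)| <= 1 by rewrite -[leRHS]mulr1; exact: ler_norm_mul.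
    by apply: lerD; rewrite [leLHS]normrM; apply: ler_piMr.
  rewrite /F1 /F2 /pol p0; split.
    have [+ _] := trig _ _ _ _ (cs1 (pang p)) (sn1 (pang p)) h0.
    by congr (`|_| <= _); rewrite /A /B /G /E; ring.
  have [_ +] := trig _ _ _ _ (sn1 (pang p)) (cs1 (pang p)) h0.
  by congr (`|_| <= _); rewrite /A /B /G /E; ring.
pose lim p := v p * plap f f1 f2 T T2 p + dot (h p) (pgrad f f1 T T1 p).
have i1 : rint (area R) (wedge b) (fun p => v p * plap f f1 f2 T T2 p).
  by apply: (rint_mulbounded mW iv ml) => p; exact: plap_bound hm.
have i2 : rint (area R) (wedge b) (fun p => dot (h p) (pgrad f f1 T T1 p)).
  apply: rintD => //.
    exact: (rint_mulbounded mW ih1 mg1 (fun p wp => (gb p wp).1)).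
  exact: (rint_mulbounded mW ih2 mg2 (fun p wp => (gb p wp).2)).
split => //; apply/eqP; rewrite -addr_eq0 addrC; apply/eqP.
rewrite -RintD//.
apply: (@Rint_dct_eq _ _ _ (area R) _ mW fn _
  (fun p => M' * `|v p| + N * (`|(h p).1| + `|(h p).2|))).
- move=> n; apply: measurable_funD; apply: measurable_funD; apply: measurable_funM => //; exact: continuous_mfun.
- by apply: measurable_funD; [exact: rint_mfun i1|exact: rint_mfun i2].
- by apply: rintD => //; apply: rintZ => //; [|apply: rintD => //]; exact: integrable_norm.
- move=> n p wp; rewrite fnE//; have [k1 k2] := Fb n p wp.
  apply: ler_norm_add; first by rewrite mulrC; apply: ler_norm_mul => //; exact: dvb.
  by rewrite [leRHS]mulrC [leRHS]mulrDl; apply: ler_norm_add; exact: ler_norm_mul.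
- move=> p wp; have [p0 hr ht] := wedgeP wp.
  rewrite (_ : fn ^~ p = (fun n => v p * dv n p + ((h p).1 * F1 n p + (h p).2 * F2 n p))); last first.
    by apply/funext => n; rewrite fnE.
  have C1 := c1 _ hr; have C0 := c'0 _ hr; have D1 := d1 _ ht; have D0 := d'0 _ ht.
  have cc (x : R) : (fun _ : nat => x) @ \oo --> x by exact: cvg_cst.
  have MM (x y : nat -> R) (k l : R) : x @ \oo --> k -> y @ \oo --> l ->
    (fun n => x n * y n) @ \oo --> k * l by exact: cvgM.
  have DD (x y : nat -> R) (k l : R) : x @ \oo --> k -> y @ \oo --> l ->
    (fun n => x n + y n) @ \oo --> k + l by exact: cvgD.
  have NN (x : nat -> R) (k : R) : x @ \oo --> k -> (fun n => - x n) @ \oo --> - k.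
    exact: cvgN.
  have hA := MM _ _ _ _ (cc (f1 (prad p))) C1.
  have hA' := DD _ _ _ _ (MM _ _ _ _ (cc (f2 (prad p))) C1) (MM _ _ _ _ (cc (f1 (prad p))) C0).
  have hB := MM _ _ _ _ (cc (T (pang p))) D1.
  have hG := MM _ _ _ _ (cc ((prad p)^-1 * f (prad p))) C1.
  have hE := MM _ _ _ _ (cc (T1 (pang p))) D1.
  have hE' := DD _ _ _ _ (MM _ _ _ _ (cc (T2 (pang p))) D1) (MM _ _ _ _ (cc (T1 (pang p))) D0).
  have hdv := DD _ _ _ _ (MM _ _ _ _ (DD _ _ _ _ hA' (MM _ _ _ _ (cc (prad p)^-1) hA)) hB) (MM _ _ _ _ (MM _ _ _ _ (cc (prad p)^-1) hG) hE').
  have hF1 := DD _ _ _ _ (MM _ _ _ _ hA (MM _ _ _ _ (cc (cos (pang p))) hB)) (MM _ _ _ _ (NN _ _ hG) (MM _ _ _ _ (cc (sin (pang p))) hE)).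
  have hF2 := DD _ _ _ _ (MM _ _ _ _ hA (MM _ _ _ _ (cc (sin (pang p))) hB)) (MM _ _ _ _ hG (MM _ _ _ _ (cc (cos (pang p))) hE)).
  have := DD _ _ _ _ (MM _ _ _ _ (cc (v p)) hdv) (DD _ _ _ _ (MM _ _ _ _ (cc (h p).1) hF1) (MM _ _ _ _ (cc (h p).2) hF2)).
  rewrite !mulr1 !mulr0 !addr0 => h0.
  rewrite (_ : _ + dot _ _ = v p * ((f2 (prad p) + (prad p)^-1 * f1 (prad p)) * T (pang p) +
       (prad p)^-1 * ((prad p)^-1 * f (prad p)) * T2 (pang p)) +
      ((h p).1 * (f1 (prad p) * (cos (pang p) * T (pang p)) +
        - ((prad p)^-1 * f (prad p)) * (sin (pang p) * T1 (pang p))) +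
       (h p).2 * (f1 (prad p) * (sin (pang p) * T (pang p)) +
        (prad p)^-1 * f (prad p) * (cos (pang p) * T1 (pang p))))); last first.
    by rewrite /dot /plap /pgrad /=; field; have /andP[r0 _] := hr; rewrite gt_eqF.
  apply: cvg_trans h0; apply: near_eq_cvg; apply: nearW => n.
  by rewrite /F1 /F2 /pol p0.
- exact: nearW.
Qed.

End fixed_b.

End green.

(** * Functions with bounded continuous gradient belong to H^1 *)

Section calculus_integrals.
Context {R : realType}.
Notation mu := (@lebesgue_measure R).

Lemma ftc_segment (f F : R -> R) (a b : R) : a < b ->
  (forall x, a <= x <= b -> is_derive x (1 : R) F (f x)) ->
  (forall x, a <= x <= b -> {for x, continuous f}) ->
  (\int[mu]_(x in `[a, b]) (f x)%:E = (F b)%:E - (F a)%:E)%E.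
Proof.
move=> ab dF cf; have cF x : a <= x <= b -> {for x, continuous F}.
  by move=> xab; exact: is_derive_continuous (dF x xab).
apply: continuous_FTC2 => //.
- by apply: continuous_in_subspaceT => x; rewrite inE /= in_itv /=; exact: cf.
- split.
  + move=> x; rewrite in_itv /= => /andP[ax xb].
    by have [] := dF x _; rewrite ?(ltW ax) ?(ltW xb).
  + by apply: cvg_at_right_filter; apply: cF; rewrite lexx ltW.
  + by apply: cvg_at_left_filter; apply: cF; rewrite lexx ltW.
- move=> x; rewrite in_itv /= => /andP[ax xb].
  have h : a <= x <= b by rewrite (ltW ax) (ltW xb).
  by rewrite derive1E; have [_] := dF x h.
Qed.

Lemma integral_derivative0 (f F : R -> R) (M : R) :
  (forall x, is_derive x (1 : R) F (f x)) -> continuous f ->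
  (forall x, F x != 0 -> `|x| <= M) -> (forall x, f x != 0 -> `|x| <= M) ->
  (\int[mu]_x (f x)%:E = 0)%E.
Proof.
move=> dF cf hF hf; pose N := `|M| + 1.
have MN : M < N by rewrite (le_lt_trans (ler_norm M))// ltrDl.
have N0 : 0 < N by rewrite ltr_wpDl.
have NN : - N < N by lra.
transitivity (\int[mu]_(x in `[(- N)%R, N]) (f x)%:E)%E.
  rewrite [RHS]integral_mkcond; apply: eq_integral => x _.
  have xN (y : R) : `|y| <= M -> - N <= y <= N by rewrite ler_norml; lra.
  rewrite patchE; case: ifPn => //; rewrite notin_setE /= in_itv /= => nx.
  by have [->//|/hf/xN/nx] := eqVneq (f x) 0.
have -> := @ftc_segment f F _ _ NN (fun x _ => dF x) (fun x _ => cf x).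
have F0 (x : R) : M < `|x| -> F x = 0.
  by move=> h; apply/eqP; apply: contraTT h => /hF; rewrite -leNgt.
by rewrite !F0 ?subee// ?normrN ger0_norm// ltW.
Qed.

Lemma is_derive_slice1 (F : R * R -> R) (x y d : R) :
  is_derive (x, y) ((1, 0) : R * R) F d -> is_derive x (1 : R) (fun t => F (t, y)) d.
Proof.
move=> /is_derive_line h; apply/is_derive_line.
rewrite (_ : (fun t => _) = (fun t => F (t *: (1, 0) + (x, y)))) //.
by apply/funext => t; congr F; congr pair; rewrite /= scaler0 add0r.
Qed.

Lemma is_derive_slice2 (F : R * R -> R) (x y d : R) :
  is_derive (x, y) ((0, 1) : R * R) F d -> is_derive y (1 : R) (fun t => F (x, t)) d.
Proof.
move=> /is_derive_line h; apply/is_derive_line.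
rewrite (_ : (fun t => _) = (fun t => F (t *: (0, 1) + (x, y)))) //.
by apply/funext => t; congr F; congr pair; rewrite /= scaler0 add0r.
Qed.

Lemma slice1_continuous (F : R * R -> R) (y : R) : continuous F ->
  continuous (fun t => F (t, y)).
Proof.
move=> cF x; apply: (@continuous_comp _ _ _ (fun t => (t, y)) F); last exact: cF.
exact: (cvg_pair (@cvg_id _ _) (@cvg_cst _ y _ _ _)).
Qed.

Lemma slice2_continuous (F : R * R -> R) (x : R) : continuous F ->
  continuous (fun t => F (x, t)).
Proof.
move=> cF y; apply: (@continuous_comp _ _ _ (fun t => (x, t)) F); last exact: cF.
exact: (cvg_pair (@cvg_cst _ x _ _ _) (@cvg_id _ _)).
Qed.

Definition in_box (M : R) (p : R * R) := `|p.1| <= M /\ `|p.2| <= M.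

Lemma compact_in_box (K : set (R * R)) : compact K ->
  exists M : R, forall p, K p -> in_box M p.
Proof.
move=> cK; have [->|K0] := eqVneq K set0; first by exists 0.
have K0' : K !=set0 by exact/set0P.
have cf1 : {within K, continuous (fun p : R * R => `|p.1|)}.
  apply: continuous_subspaceT => p; apply: continuous_comp; [exact: fst_continuous|exact: norm_continuous].
have cf2 : {within K, continuous (fun p : R * R => `|p.2|)}.
  apply: continuous_subspaceT => p; apply: continuous_comp; [exact: snd_continuous|exact: norm_continuous].
have [c _ hc] := compact_EVT_max K0' cK cf1.
have [d _ hd] := compact_EVT_max K0' cK cf2.
exists (Num.max `|c.1| `|d.2|) => p Kp.
by split; rewrite le_max; [rewrite hc ?inE|rewrite hd ?inE// orbT].
Qed.

Lemma rint_plane_box (F : R * R -> R) (M : R) : continuous F ->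
  (forall p, F p != 0 -> in_box M p) -> rint (area R) setT F.
Proof.
move=> cF hF; pose B : set (mplane R) := `[- M, M]%classic `*` `[- M, M]%classic.
have mB : measurable B by apply: measurableX; exact: measurable_itv.
have Boo : (area R B < +oo)%E.
  have -> : area R B = (mu (`[(- M)%R, M]%classic : set R) * mu (`[(- M)%R, M]%classic : set R))%E.
    by apply: product_measure1E; exact: measurable_itv.
  by rewrite !lebesgue_measure_itv /= !lte_fin; case: ifP => _; rewrite ?mule0 -?EFinB -?EFinM ltry.
have mF : measurable_fun setT (F : mplane R -> R).
  by apply: (@open_continuous_mfun _ setT) => [|p _]; [exact: openT|exact: cF].
have [C hC] : exists C : R, forall p, B p -> `|F p| <= C.
  have [B0|nB] := pselect (B !=set0); last first.
    by exists 0 => p Bp; exfalso; apply: nB; exists p.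
  have [|||c _ hc] := @compact_EVT_max _ R (fun p => `|F p|) (`[- M, M] `*` `[- M, M]).
  - exact: B0.
  - by apply: compact_setX; exact: segment_compact.
  - by apply: continuous_subspaceT => p; apply: continuous_comp; [exact: cF|exact: norm_continuous].
  by exists `|F c| => p Bp; apply: hc; rewrite inE.
have iB : rint (area R) B F.
  by apply: (rint_bounded mB Boo _ hC); exact: measurable_funTS.
have : (area R).-integrable (setT `&` B) (fun p => (F p)%:E) by rewrite setTI.
move/(integrable_restrict (area R) mB measurableT); apply: eq_integrable => // p _.
rewrite patchE; case: ifPn => //; rewrite notin_setE => nB.
have [->//|/hF[h1 h2]] := eqVneq (F p) 0; exfalso; apply: nB.
by split; rewrite /= in_itv /= -ler_norml.
Qed.

Lemma integral_partial1 (F F1 : R * R -> R) (M : R) :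
  (forall p, is_derive p ((1, 0) : R * R) F (F1 p)) -> continuous F1 ->
  (forall p, F p != 0 -> in_box M p) -> (forall p, F1 p != 0 -> in_box M p) ->
  \int[area R]_p F1 p = 0.
Proof.
move=> dF cF1 hF hF1; have iF := rint_plane_box cF1 hF1.
rewrite /Rintegral -(integral21_prod_meas1 iF) /fubini_G.
rewrite (eq_integral (fun=> 0%E)) ?integral0// => y _ /=.
apply: (@integral_derivative0 (fun x => F1 (x, y)) (fun x => F (x, y)) M).
- by move=> x; apply: is_derive_slice1; exact: dF.
- exact: slice1_continuous.
- by move=> x /hF[].
- by move=> x /hF1[].
Qed.

Lemma integral_partial2 (F F2 : R * R -> R) (M : R) :
  (forall p, is_derive p ((0, 1) : R * R) F (F2 p)) -> continuous F2 ->
  (forall p, F p != 0 -> in_box M p) -> (forall p, F2 p != 0 -> in_box M p) ->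
  \int[area R]_p F2 p = 0.
Proof.
move=> dF cF2 hF hF2; have iF := rint_plane_box cF2 hF2.
rewrite /Rintegral -(integral12_prod_meas1 iF) /fubini_F.
rewrite (eq_integral (fun=> 0%E)) ?integral0// => x _ /=.
apply: (@integral_derivative0 (fun y => F2 (x, y)) (fun y => F (x, y)) M).
- by move=> y; apply: is_derive_slice2; exact: dF.
- exact: slice2_continuous.
- by move=> y /hF[].
- by move=> y /hF2[].
Qed.

End calculus_integrals.

Section classical.
Context {R : realType}.
Implicit Types (p e : R * R) (w : R * R -> R) (g : R * R -> R * R).

Section domain.
Variables (Om : set (R * R)) (oOm : open Om).

Let ext (F : R * R -> R) p := if p \in Om then F p else 0.

Let ext_local (F phi : R * R -> R) p : test_function Om phi ->
  (forall q, phi q = 0 -> ~ closure [set p | phi p != 0] q -> F q = 0) -> ~ Om p ->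
  exists2 D : set (R * R), open D /\ D p & forall q, D q -> 0 = ext F q.
Proof.
move=> [_ _ clO] hF nO; exists (~` closure [set p | phi p != 0]).
  by split; [exact/closed_openC/closed_closure|move=> /clO].
move=> q nq; rewrite /ext; case: ifP => // _; rewrite hF//.
by apply/eqP; apply: contra_notT nq => h; exact: subset_closure.
Qed.

(** Every point outside [Om] has a neighbourhood on which the test function vanishes, so the
    extension by zero of [w * phi] keeps a continuous derivative on the whole plane, whatever [w]
    does at the boundary. *)
Lemma ibp w (g1 phi phi1 : R * R -> R) e : test_function Om phi ->
  (forall p, Om p -> is_derive p e w (g1 p)) ->
  (forall p, Om p -> {for p, continuous w}) ->
  (forall p, Om p -> {for p, continuous g1}) ->
  (forall p, is_derive p e phi (phi1 p)) -> continuous phi1 ->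
  exists F F1 : R * R -> R, exists M : R,
    [/\ forall p, is_derive p e F (F1 p), continuous F1,
        forall p, F p != 0 -> in_box M p, forall p, F1 p != 0 -> in_box M p &
        forall p, F1 p = ext (fun q => g1 q * phi q + w q * phi1 q) p].
Proof.
move=> hphi dw cw cg dphi cphi1; have [sphi cK KO] := hphi.
have cphi : continuous phi by have [] := sphi 0%N.
have phi10 q : ~ closure [set p | phi p != 0] q -> phi1 q = 0.
  move=> nq; have [_ <-] := dphi q; suff: is_derive q e phi 0 by case.
  apply: (@is_derive_near _ _ (~` closure [set p | phi p != 0]) (fun=> 0)) => //.
    exact/closed_openC/closed_closure.
  by move=> r nr; apply/esym/eqP; apply: contra_notT nr => h; exact: subset_closure.
have [M hM] := compact_in_box cK.
pose F := ext (fun q => w q * phi q).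
pose F1 := ext (fun q => g1 q * phi q + w q * phi1 q).
exists F, F1, M; split.
- move=> p; have [Op|nOp] := pselect (Om p).
    apply: (is_derive_near oOm Op (f := fun q => w q * phi q)).
      by move=> q Oq; rewrite /F /ext mem_set.
    by rewrite /F1 /ext mem_set//; exact: (is_derive_mul (dw p Op) (dphi p)).
  have [|D [oD Dp] D0] := ext_local (F := fun q => w q * phi q) hphi _ nOp.
    by move=> q -> _; rewrite mulr0.
  apply: (is_derive_near oD Dp D0); rewrite /F1 /ext memNset//.
  exact: is_derive_const.
- move=> p; have [Op|nOp] := pselect (Om p).
    apply: (continuous_near oOm Op (f := fun q => g1 q * phi q + w q * phi1 q)).
      by move=> q Oq; rewrite /F1 /ext mem_set.
    by apply: cvgD; apply: cvgM; [exact: cg|exact: cphi|exact: cw|exact: cphi1].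
  have [|D [oD Dp] D0] := ext_local (F := fun q => g1 q * phi q + w q * phi1 q) hphi _ nOp.
    by move=> q -> nq; rewrite mulr0 phi10// mulr0 addr0.
  by apply: (continuous_near oD Dp D0); exact: cst_continuous.
- move=> p; rewrite /F /ext; case: ifP => // _; last by rewrite eqxx.
  rewrite mulf_eq0 negb_or => /andP[_ h]; apply: hM; exact: subset_closure.
- move=> p; rewrite /F1 /ext; case: ifP => // _; last by rewrite eqxx.
  move=> h; apply: hM; apply: contrapT => nK.
  have p0 : phi p = 0 by apply/eqP; apply: contra_notT nK => h'; exact: subset_closure.
  by move: h; rewrite p0 phi10// !mulr0 addr0 eqxx.
- by [].
Qed.

(* A test function times [w], extended by zero, is C^1 on the plane, so the
   integration by parts reduces to Fubini. *)
Lemma classical_H1 w g (C : R) : (area R Om < +oo)%E ->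
  (forall p, Om p -> is_derive p ((1, 0) : R * R) w (g p).1) ->
  (forall p, Om p -> is_derive p ((0, 1) : R * R) w (g p).2) ->
  (forall p, Om p -> [/\ {for p, continuous w}, {for p, continuous (fun q => (g q).1)}
     & {for p, continuous (fun q => (g q).2)}]) ->
  (forall p, Om p -> [/\ `|w p| <= C, `|(g p).1| <= C & `|(g p).2| <= C]) ->
  H1 Om w g.
Proof.
move=> Ooo d1 d2 cc bb.
have mO : measurable (Om : set (mplane R)) := open_measurable_plane oOm.
have mw : measurable_fun (Om : set (mplane R)) (w : mplane R -> R).
  exact: (open_continuous_mfun oOm (fun p Op => let: And3 a _ _ := cc p Op in a)).
have mg1 : measurable_fun (Om : set (mplane R)) (fun p : mplane R => (g p).1).
  exact: (open_continuous_mfun oOm (fun p Op => let: And3 _ a _ := cc p Op in a)).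
have mg2 : measurable_fun (Om : set (mplane R)) (fun p : mplane R => (g p).2).
  exact: (open_continuous_mfun oOm (fun p Op => let: And3 _ _ a := cc p Op in a)).
have hF (f f1 phi : R * R -> R) (F1 : R * R -> R) :
    (forall p, F1 p = ext (fun q => f q * phi q + f1 q) p) -> \int[area R]_p F1 p = 0 ->
    \int[area R]_(p in Om) (f p * phi p + f1 p) = 0.
  move=> hF1 <-; rewrite [LHS]Rintegral_mkcond; apply: eq_Rintegral => p _.
  by rewrite hF1 /ext patchE.
split.
- by apply: (L2_bounded mO Ooo mw) => p /bb[? _ _]; eassumption.
- by apply: (L2_bounded mO Ooo mg1) => p /bb[_ ? _]; eassumption.
- by apply: (L2_bounded mO Ooo mg2) => p /bb[_ _ ?]; eassumption.
- move=> phi hphi; have [sphi cK KO] := hphi.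
  have [cphi [e1 e2 [c1 _] [c2 _]]] := sphi 1%N.
  have bphi (f : R * R -> R) : continuous f -> (forall p, f p != 0 -> closure [set p | phi p != 0] p) ->
     rint (area R) Om f.
    move=> cf hf; have [M hM] := compact_in_box cK.
    have := rint_plane_box cf (fun p h => hM _ (hf p h)).
    by apply: (integrableS measurableT mO).
  have r0 : rint (area R) Om phi by apply: bphi => // p h; exact: subset_closure.
  have z e q : ~ closure [set p | phi p != 0] q -> 'D_e phi q = 0.
    move=> nq; suff: is_derive q e phi 0 by case.
    apply: (@is_derive_near _ _ (~` closure [set p | phi p != 0]) (fun=> 0)) => //.
      exact/closed_openC/closed_closure.
    by move=> r nr; apply/esym/eqP; apply: contra_notT nr => h; exact: subset_closure.
  have r1 : rint (area R) Om (partial1 phi).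
    by apply: bphi => // p; apply: contraNP => /z zz; rewrite /partial1 zz.
  have r2 : rint (area R) Om (partial2 phi).
    by apply: bphi => // p; apply: contraNP => /z zz; rewrite /partial2 zz.
  have rm (f f' : R * R -> R) : measurable_fun (Om : set (mplane R)) (f' : mplane R -> R) ->
     (forall p, Om p -> `|f' p| <= C) -> rint (area R) Om f -> rint (area R) Om (fun p => f' p * f p).
    move=> mf' bf' rf; have := rint_mulbounded mO rf mf' bf'.
    by congr (rint _ _ _); apply/funext => p; rewrite mulrC.
  have [F [F1 [M [dF cF1 hF1 hF1' E1]]]] := ibp hphi d1 (fun p Op => let: And3 a _ _ := cc p Op in a)
    (fun p Op => let: And3 _ a _ := cc p Op in a) (fun p => derivableP (e1 p)) c1.
  have [G [G1 [N [dG cG1 hG1 hG1' E2]]]] := ibp hphi d2 (fun p Op => let: And3 a _ _ := cc p Op in a)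
    (fun p Op => let: And3 _ _ a := cc p Op in a) (fun p => derivableP (e2 p)) c2.
  have I1 := hF _ _ _ _ E1 (integral_partial1 dF cF1 hF1 hF1').
  have I2 := hF _ _ _ _ E2 (integral_partial2 dG cG1 hG1 hG1').
  rewrite RintD// in I1; last 2 first.
  + by apply: rm => // p /bb[].
  + by apply: rm => // p /bb[].
  rewrite RintD// in I2; last 2 first.
  + by apply: rm => // p /bb[].
  + by apply: rm => // p /bb[].
  by split; apply/eqP; rewrite -addr_eq0 addrC; apply/eqP; [exact: I1|exact: I2].
Qed.

End domain.

End classical.

(** * Completeness of the angular cosine modes *)

Section dynkin_integral.
Context d (T : measurableType d) (R : realType) (m : {measure set T -> \bar R}).
Context d' (X : measurableType d').
Variables (D : set T) (mD : measurable D) (w : T -> R) (phi : T -> X).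
Hypotheses (iw : rint m D w) (mphi : measurable_fun D phi).

Lemma indic_comp_mfun (E : set X) : measurable E ->
  measurable_fun D (fun x => \1_E (phi x) : R).
Proof. by move=> mE; apply: (measurableT_comp (f := \1_E : X -> R)) => //; exact: measurable_indic. Qed.

Lemma rint_mul_indic (E : set X) : measurable E ->
  rint m D (fun x => w x * \1_E (phi x)).
Proof.
move=> mE; apply: (@rint_mulbounded _ _ _ _ _ mD _ _ 1 iw (indic_comp_mfun mE)).
by move=> x _; rewrite indicE; case: (_ \in _); rewrite ?normr1 ?normr0.
Qed.

(** The measurable sets [E] with vanishing integral form a lambda-system: proper differences by
    linearity, increasing unions by dominated convergence. *)
Lemma dynkin_integral (G : set (set X)) : setI_closed G ->
  (@measurable _ X) = <<s G >> -> \int[m]_(x in D) w x = 0 ->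
  (forall E, G E -> \int[m]_(x in D) (w x * \1_E (phi x)) = 0) ->
  forall E, measurable E -> \int[m]_(x in D) (w x * \1_E (phi x)) = 0.
Proof.
move=> GI mG w0 hG.
pose H := [set E : set X | measurable E /\ \int[m]_(x in D) (w x * \1_E (phi x)) = 0].
have lH : lambda_system setT H.
  split.
  - by [].
  - by split; [exact: measurableT|rewrite -[RHS]w0; apply: eq_Rintegral => x _; rewrite indicT mulr1].
  - move=> A B BA [mA A0] [mB B0]; split; first exact: measurableD.
    rewrite -[RHS](subrr 0) -{1}A0 -B0 -RintB//; [|exact: rint_mul_indic..].
    apply: eq_Rintegral => x _; rewrite -mulrBr; congr (_ * _); rewrite !indicE in_setD.
    have [/[dup] Bx /set_mem/BA/mem_set ->|_] := boolP (phi x \in B); first by rewrite subrr.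
    by rewrite andbT subr0.
  - move=> F ndF hF; split; first by apply: bigcupT_measurable => n; have [] := hF n.
    apply: (@Rint_dct_eq _ _ _ m D mD (fun n x => w x * \1_(F n) (phi x)) _ (fun x => `|w x|)).
    + move=> n; apply: measurable_funM; first exact: rint_mfun iw.
      by apply: indic_comp_mfun; have [] := hF n.
    + apply: measurable_funM; first exact: rint_mfun iw.
      by apply: indic_comp_mfun; apply: bigcupT_measurable => n; have [] := hF n.
    + exact: integrable_norm.
    + move=> n x _; rewrite normrM indicE.
      by case: (_ \in _); rewrite ?normr1 ?normr0 ?mulr1 ?mulr0.
    + move=> x _; apply: cvgM; first exact: cvg_cst.
      have [[n _ Fn]|nF] := pselect ((\bigcup_n F n) (phi x)).
        apply/cvg_ballP => e e0; exists n => // k /= nk.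
        rewrite !indicE !mem_set//; [exact: ballxx| |by exists n].
        by move/subsetPset : (ndF _ _ nk); exact.
      apply/cvg_ballP => e e0; apply: nearW => k; rewrite !indicE !memNset//; first exact: ballxx.
      by move=> Fk; apply: nF; exists k.
    + by apply: nearW => n; have [] := hF n.
have sub : <<s G >> `<=` H.
  apply: lambda_system_subset lH _ _ => //.
  by move=> E GE; split; [rewrite mG; exact: sub_sigma_algebra|exact: hG].
by move=> E mE; have [] : H E by apply: sub; rewrite -mG.
Qed.

End dynkin_integral.

Lemma measurable_fun_pairD d d1 d2 (T : measurableType d) (T1 : measurableType d1)
    (T2 : measurableType d2) (D : set T) (f : T -> T1) (g : T -> T2) :
  measurable D -> measurable_fun D f -> measurable_fun D g ->
  measurable_fun D (fun x => (f x, g x)).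
Proof.
move=> mD mf mg; apply: (measurability _ (measurable_prod_measurableType T1 T2)).
move=> _ [_ [A mA [B mB <-]] <-] /=.
rewrite (_ : _ `&` _ = (D `&` f @^-1` A) `&` (D `&` g @^-1` B)); last first.
  by apply/seteqP; split => x /=; tauto.
by apply: measurableI; [exact: mf|exact: mg].
Qed.

(** * Polynomial approximation of a step *)

Section bernoulli.
Context {R : realType}.
Implicit Types x y a : R.

Lemma bernoulli_le x n : -1 <= x -> 1 + n%:R * x <= (1 + x) ^+ n.
Proof.
move=> x1; elim: n => [|n IH]; first by rewrite mul0r addr0 expr0.
rewrite exprS; apply: (@le_trans _ _ ((1 + x) * (1 + n%:R * x))).
  by rewrite -natr1; have := mulr_ge0 (ler0n R n) (sqr_ge0 x); nra.
by rewrite ler_wpM2l//; lra.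
Qed.

(** Bernoulli's inequality for [(1 + a)^n] together with
    [(1 - a)^n (1 + a)^n = (1 - a^2)^n <= 1]. *)
Lemma bernoulli_inv_le a n : 0 <= a <= 1 -> (1 - a) ^+ n <= (1 + n%:R * a)^-1.
Proof.
move=> /andP[a0 a1]; have p0 : 0 < 1 + n%:R * a by rewrite ltr_pwDl// mulr_ge0.
rewrite -[leRHS]mul1r ler_pdivlMr//.
apply: (@le_trans _ _ ((1 - a) ^+ n * (1 + a) ^+ n)).
  by rewrite ler_wpM2l ?exprn_ge0 ?subr_ge0// bernoulli_le//; lra.
by rewrite -exprMn exprn_ile1//; nra.
Qed.

(* [(1 - y^m)^(2^m)] tends to 1 for [y < 1/2] and to 0 for [1/2 < y < 1]; here
   [y = 1/2] at [x = c + 1 / (n + 1)], which makes the limit the closed step. *)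
Definition pstep (c : R) (n : nat) (x : R) : R :=
  (1 - ((x - c - n.+1%:R^-1 + 3) / 6) ^+ (n.+1 * n.+1)) ^+ (2 ^ (n.+1 * n.+1)).

Lemma pstep_cvg (c x : R) : -1 <= c <= 1 -> -1 <= x <= 1 ->
  (forall n, 0 <= pstep c n x <= 1) /\
  pstep c n x @[n --> \oo] --> ((x <= c)%R%:R : R).
Proof.
move=> /andP[c1 c2] /andP[x1 x2].
pose y n := (x - c - n.+1%:R^-1 + 3) / 6.
have d0 n : 0 < n.+1%:R^-1 :> R by rewrite invr_gt0.
have d1 n : n.+1%:R^-1 <= 1 :> R by rewrite invf_le1// ler1n.
have y01 n : 0 <= y n <= 1.
  by move: (d0 n) (d1 n); rewrite /y; move: (n.+1%:R^-1) => u u0 u1; lra.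
have yp01 n k : 0 <= y n ^+ k <= 1.
  by have /andP[? ?] := y01 n; rewrite exprn_ge0// exprn_ile1.
have k01 n : 0 <= pstep c n x <= 1.
  rewrite /pstep -/(y n); have /andP[? ?] := yp01 n (n.+1 * n.+1)%N.
  by rewrite exprn_ge0 ?exprn_ile1//; lra.
(* With [k] the inner exponent, [2^k y^k = (2 y)^k] is the quantity that decides the limit; [2 y]
   exceeds or falls short of 1 by a third of the shifted distance to [c]. *)
have two n k : (2 ^ k)%:R * y n ^+ k = (1 + (x - c - n.+1%:R^-1) / 3) ^+ k.
  by rewrite natrX -exprMn; congr (_ ^+ _); rewrite /y; field.
split => //; have inv0 : (n.+1%:R^-1 : R) @[n --> \oo] --> 0.
  apply/cvgrPdist_lt => e e0; near=> n; rewrite sub0r normrN ger0_norm ?invr_ge0//.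
  by near: n; exact: (near_infty_natSinv_lt (PosNum e0)).
have inv0C (C : R) : (C * n.+1%:R^-1) @[n --> \oo] --> 0.
  by rewrite -[X in _ --> X](mulr0 C); apply: cvgM => //; exact: cvg_cst.
have [xc|cx] := leP x c.
  (* For [x <= c] one has [2 y <= 1 - 1 / (3 (n + 1))]. The exponent [(n + 1)^2] outweighs the shift
     [1 / (n + 1)], so that [(2 y)^k] is at most [3 / (n + 1)]. *)
  have low n : 1 - 3 * n.+1%:R^-1 <= pstep c n x.
    rewrite /pstep -/(y n).
    apply: (@le_trans _ _ (1 + (2 ^ (n.+1 * n.+1))%:R * - y n ^+ (n.+1 * n.+1))); last first.
      by apply: bernoulli_le; rewrite lerN2; have /andP[] := yp01 n (n.+1 * n.+1)%N.
    rewrite mulrN lerD2l lerN2 two.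
    apply: (@le_trans _ _ ((1 - n.+1%:R^-1 / 3) ^+ (n.+1 * n.+1))).
      by apply: lerXn2r; rewrite ?nnegrE; move: (d0 n) (d1 n); move: (n.+1%:R^-1) => u u0 u1; lra.
    apply: le_trans (bernoulli_inv_le _ _) _; first by move: (d0 n) (d1 n); move: (n.+1%:R^-1) => u u0 u1; lra.
    have N0 : 0 < n.+1%:R :> R by [].
    have -> : 1 + (n.+1 * n.+1)%:R * (n.+1%:R^-1 / 3) = 1 + n.+1%:R / 3 :> R.
      by rewrite natrM; move: n.+1%:R N0 => u u0; field; rewrite gt_eqF.
    have -> : 3 * n.+1%:R^-1 = (n.+1%:R / 3)^-1 :> R by move: n.+1%:R N0 => u u0; field; rewrite gt_eqF.
    by rewrite lef_pV2 ?posrE ?divr_gt0// ?ltr_wpDl ?divr_gt0//; lra.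
  have l1 : (fun n : nat => 1 - 3 * n.+1%:R^-1 : R) @ \oo --> (1 : R).
    have h := cvgB (@cvg_cst _ (1 : R) _ _ _) (inv0C 3); rewrite subr0 in h; exact: h.
  have l2 : (fun _ : nat => 1 : R) @ \oo --> (1 : R) by exact: cvg_cst.
  apply: squeeze_cvgr l1 l2.
  by apply: nearW => n; rewrite low; have /andP[] := k01 n.
(* For [x > c] the shift is eventually below [(x - c) / 2], so [2 y >= 1 + a]; then the step is at
   most [1 / (1 + (2 y)^k)], which Bernoulli bounds by [a^-1 / (n + 1)]. *)
pose a := (x - c) / 6; have a0 : 0 < a by rewrite divr_gt0// subr_gt0.
have l1 : (fun _ : nat => 0 : R) @ \oo --> (0 : R) by exact: cvg_cst.
apply: squeeze_cvgr l1 (inv0C a^-1).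
have h0 : 0 < (x - c) / 2 by rewrite divr_gt0// subr_gt0.
near=> n; have dn : n.+1%:R^-1 < (x - c) / 2 :> R by near: n; exact: (near_infty_natSinv_lt (PosNum h0)).
have ha : a <= (x - c - n.+1%:R^-1) / 3.
  by move: dn; rewrite /a; move: (n.+1%:R^-1) => u; lra.
have /andP[-> _] := k01 n; rewrite /=.
rewrite /pstep -/(y n).
apply: le_trans (bernoulli_inv_le _ (yp01 n _)) _; rewrite two -invfM lef_pV2 ?posrE ?mulr_gt0//.
  apply: (@le_trans _ _ ((1 + a) ^+ (n.+1 * n.+1))); last first.
    move: ((x - c - n.+1%:R^-1) / 3) ha => u ha.
    rewrite -[leLHS]add0r lerD//; apply: lerXn2r; rewrite ?nnegrE; lra.
  apply: le_trans (bernoulli_le _ _); last by lra.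
  have u1 : 1 <= n.+1%:R :> R by rewrite ler1n.
    rewrite natrM; move: (n.+1%:R) u1 => u u1.
    have u2 : 0 <= u - 1 by rewrite subr_ge0.
    by have := mulr_ge0 (mulr_ge0 (ltW a0) (le_trans ler01 u1)) u2; nra.
  move: ((x - c - n.+1%:R^-1) / 3) ha => u ha.
  rewrite ltr_pwDl// exprn_ge0//; lra.
Unshelve. all: first [by end_near|by rewrite subr_gt0]. Qed.

End bernoulli.

Section completeness.
Context {R : realType}.
Variables (b : R) (b0 : 0 < b) (b_pi2 : b <= pi / 2).
Notation W := (wedge b).
Notation om := (pi / (2 * b)).

(** The Neumann eigenfunctions of the interval [[-b, b]], even about 0 for even [n] and odd for odd
    [n]. In particular [cmode 1] is [- sin (om * t)]. *)
Definition cmode (n : nat) (t : R) : R := cos (n%:R * (om * (t + b))).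

Lemma cmode1 (t : R) : cmode 1 t = cos (om * (t + b)).
Proof. by rewrite /cmode mul1r. Qed.

(** The Chebyshev recurrence: it turns orthogonality to all modes into orthogonality to all
    polynomials in [cmode 1]. *)
Lemma cmodeM n (t : R) : cmode 1 t * cmode n.+1 t = 2^-1 * (cmode n.+2 t + cmode n t).
Proof.
rewrite cmode1 /cmode; set x := om * (t + b).
have -> : n.+2%:R * x = n.+1%:R * x + x by rewrite -(natr1 n.+1); ring.
have -> : n%:R * x = n.+1%:R * x - x by rewrite -(natr1 n); ring.
by rewrite cosD cosB; field.
Qed.

Lemma cmode_le1 n (t : R) : `|cmode n t| <= 1.
Proof. by rewrite ler_norml cos_geN1 cos_le1. Qed.

Lemma smooth1_cmode n (I : set R) : smooth1 I (cmode n).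
Proof.
move=> k; apply: Sk_cos; apply: Sk_scale; apply: Sk_scale.
by apply: Sk_add; [exact: Sk_id|exact: Sk_cst].
Qed.

Lemma bump_bounded lo hi (A : R -> R) : bumpfun lo hi A ->
  exists2 C : R, 0 < C & forall r, `|A r| <= C.
Proof.
move=> [sA [c [d [lc dh h]]]].
have [|C C0 hC] := @segment_bounded _ A c d.
  by move=> x /andP[cx xd]; apply: (sA 0%N); rewrite /itvoo /= (lt_le_trans lc)//= (le_lt_trans xd).
by exists C => // r; have [->|/h/hC//] := eqVneq (A r) 0; rewrite normr0 ltW.
Qed.

Lemma prad_mfun (A : R -> R) : smooth1 (itvoo 0 1) A ->
  measurable_fun (W : set (mplane R)) (fun q : mplane R => A (prad q)).
Proof.
move=> sA; apply: (open_continuous_mfun (f := fun q : R * R => A (prad q)) (@open_wedge R b)) => p wp.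
refine (prad_comp_continuous wp sA).
Qed.

Lemma pang_mfun (B : R -> R) : smooth1 (itvoo (- b) b) B ->
  measurable_fun (W : set (mplane R)) (fun q : mplane R => B (pang q)).
Proof.
move=> sB; apply: (open_continuous_mfun (f := fun q : R * R => B (pang q)) (@open_wedge R b)) => p wp.
refine (pang_comp_continuous wp sB).
Qed.

Variable (v : R * R -> R).
Hypothesis iv : rint (area R) W v.
Hypothesis hv : forall n A, bumpfun 0 1 A ->
  \int[area R]_(p in W) (v p * (A (prad p) * cmode n (pang p))) = 0.

Let mW := @measurable_wedge R b.

Section fixed_A.
Variables (A : R -> R) (bA : bumpfun 0 1 A).

Let vA p := v p * A (prad p).

Let ivA : rint (area R) W vA.
Proof.
have [C _ hC] := bump_bounded bA.
by apply: (rint_mulbounded mW iv (prad_mfun bA.1)) => p _; exact: hC.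
Qed.

Let rint_ang (B : R -> R) (C : R) : smooth1 (itvoo (- b) b) B ->
  (forall t, `|B t| <= C) -> rint (area R) W (fun p => vA p * B (pang p)).
Proof. by move=> sB hB; apply: (rint_mulbounded mW ivA (pang_mfun sB)) => p _; exact: hB. Qed.

Let sCm m n : smooth1 (itvoo (- b) b) (fun t => cmode 1 t ^+ m * cmode n t).
Proof. by move=> k; apply: Sk_mul; [apply: Sk_expn|]; exact: smooth1_cmode. Qed.

Let bCm m n t : `|cmode 1 t ^+ m * cmode n t| <= 1.
Proof.
rewrite normrM normrX -[leRHS]mulr1; apply: ler_pM => //; last exact: cmode_le1.
by apply: exprn_ile1 => //; exact: cmode_le1.
Qed.

Let step1 m n : \int[area R]_(p in W) (vA p * (cmode 1 (pang p) ^+ m * cmode n (pang p))) = 0.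
Proof.
elim: m n => [|m IH] [|n].
- by rewrite -[RHS](hv 0 bA); apply: eq_Rintegral => p _; rewrite /vA expr0; ring.
- by rewrite -[RHS](hv n.+1 bA); apply: eq_Rintegral => p _; rewrite /vA expr0; ring.
- rewrite -[RHS](IH 1%N); apply: eq_Rintegral => p _.
  by rewrite /cmode mul0r cos0 -/(cmode 1 (pang p)) exprS; ring.
- transitivity (\int[area R]_(p in W) (2^-1 * (vA p * (cmode 1 (pang p) ^+ m * cmode n.+2 (pang p))) +
     2^-1 * (vA p * (cmode 1 (pang p) ^+ m * cmode n (pang p))))).
    apply: eq_Rintegral => p _; rewrite exprSr -[_ * cmode 1 _ * _]mulrA cmodeM; ring.
  have i1 := rint_ang (sCm m n.+2) (bCm m n.+2).
  have i2 := rint_ang (sCm m n) (bCm m n).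
  rewrite RintD//; [|exact: rintZ..].
  by rewrite !RintZ// !IH !mulr0 addr0.
Qed.

Let step2 (q : {poly R}) m :
  \int[area R]_(p in W) (vA p * (q.[cmode 1 (pang p)] * cmode 1 (pang p) ^+ m)) = 0 /\
  rint (area R) W (fun p => vA p * (q.[cmode 1 (pang p)] * cmode 1 (pang p) ^+ m)).
Proof.
elim/poly_ind: q m => [|q c IH] m.
  split; first by under eq_Rintegral do rewrite horner0 mul0r mulr0; rewrite Rintegral_cst// mul0r.
  apply: (@rint_le _ _ _ _ _ mW _ (fun p => `|vA p|)); last 2 first.
  - exact: integrable_norm.
  - by move=> p _; rewrite horner0 mul0r mulr0 normr0.
  rewrite (_ : (fun _ => _) = (fun=> 0)); first exact: measurable_cst.
  by apply/funext => p; rewrite horner0 mul0r mulr0.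
have [e1 i1] := IH m.+1; have e2 := step1 m 0; have i2 := rint_ang (sCm m 0) (bCm m 0).
have E p : vA p * ((q * 'X + c%:P).[cmode 1 (pang p)] * cmode 1 (pang p) ^+ m) =
   vA p * (q.[cmode 1 (pang p)] * cmode 1 (pang p) ^+ m.+1) +
   c * (vA p * (cmode 1 (pang p) ^+ m * cmode 0 (pang p))).
  have -> : cmode 0 (pang p) = 1 by rewrite /cmode mul0r cos0.
  by rewrite hornerD hornerMX hornerC exprS; ring.
split; last first.
  rewrite (_ : (fun _ => _) = (fun p => vA p * (q.[cmode 1 (pang p)] * cmode 1 (pang p) ^+ m.+1) +
    c * (vA p * (cmode 1 (pang p) ^+ m * cmode 0 (pang p))))); last exact/funext.
  by apply: rintD => //; exact: rintZ.
under eq_Rintegral do rewrite E.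
rewrite RintD//; last exact: rintZ.
by rewrite RintZ// e1 e2 mulr0 addr0.
Qed.

(** [pstep c n] is a polynomial in its last argument, so the polynomial case applies to it and
    dominated convergence gives the sublevel sets of [cmode 1]. *)
Let step3 (c : R) : -1 <= c <= 1 ->
  \int[area R]_(p in W) (vA p * (cmode 1 (pang p) <= c)%R%:R) = 0.
Proof.
move=> c1; have Cx t : -1 <= cmode 1 t <= 1 by rewrite -ler_norml cmode_le1.
pose q n : {poly R} := (1 - ((6^-1)%:P * ('X + (- c - n.+1%:R^-1 + 3)%:P)) ^+ (n.+1 * n.+1)) ^+ (2 ^ (n.+1 * n.+1)).
have qE n t : (q n).[t] = pstep c n t.
  by rewrite /q /pstep !hornerE; congr ((1 - _ ^+ _) ^+ _); rewrite mulrC; congr (_ / _); ring.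
have k01 n t : `|pstep c n (cmode 1 t)| <= 1.
  by have [/(_ n)/andP[h1 h2] _] := pstep_cvg c1 (Cx t); rewrite ger0_norm.
have sq n : smooth1 (itvoo (- b) b) (fun t => pstep c n (cmode 1 t)).
  move=> k; rewrite /pstep; apply: Sk_expn; apply: Sk_sub_fun; first exact: Sk_cst.
  apply: Sk_expn; apply: Sk_mul; last exact: Sk_cst.
  do 2 (apply: Sk_add; last exact: Sk_cst).
  by apply: Sk_sub_fun; [exact: smooth1_cmode|exact: Sk_cst].
have mle : measurable_fun (W : set (mplane R)) (fun p : mplane R => ((cmode 1 (pang p) <= c)%R%:R : R)).
  apply: (measurable_fun_cvg (h := fun n (p : mplane R) => pstep c n (cmode 1 (pang p)))).
    by move=> n; exact: (pang_mfun (sq n)).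
  by move=> p _; have [] := pstep_cvg c1 (Cx (pang p)).
apply: (@Rint_dct_eq _ _ _ (area R) _ mW (fun n p => vA p * pstep c n (cmode 1 (pang p))) _ (fun p => `|vA p|)).
- by move=> n; apply: measurable_funM; [exact: rint_mfun ivA|exact: (pang_mfun (sq n))].
- by apply: measurable_funM; [exact: rint_mfun ivA|exact: mle].
- exact: integrable_norm.
- by move=> n p _; rewrite normrM ler_piMr.
- move=> p _; apply: cvgM; first exact: cvg_cst.
  by have [] := pstep_cvg c1 (Cx (pang p)).
- apply: nearW => n; have [e _] := step2 (q n) 0; rewrite -[RHS]e.
  by apply: eq_Rintegral => p _; rewrite expr0 mulr1 qE.
Qed.

Let om_range (t : R) : - b <= t <= b -> 0 <= om * (t + b) <= pi.
Proof.
move=> /andP[h1 h2]; have p0 := @pi_gt0 R; apply/andP; split.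
  by rewrite mulr_ge0 ?divr_ge0 ?(ltW p0) ?mulr_ge0 ?(ltW b0)//; lra.
by rewrite mulrAC ler_pdivrMr ?mulr_gt0// ler_wpM2l ?(ltW p0)//; lra.
Qed.

Let cmode_decr (t s : R) : - b <= t <= b -> - b <= s <= b ->
  (cmode 1 t <= cmode 1 s) = (s <= t).
Proof.
move=> ht hs; rewrite !cmode1.
rewrite leNgt ltr_cos ?in_itv/= ?om_range// -leNgt ler_pM2l ?divr_gt0 ?pi_gt0 ?mulr_gt0//.
by rewrite lerD2r.
Qed.

Lemma integral_bump_indic (E : set (measurableTypeR R)) : measurable E ->
  \int[area R]_(p in W) (v p * A (prad p) * \1_E (pang p)) = 0.
Proof.
have mang : measurable_fun (W : set (mplane R)) (pang : mplane R -> measurableTypeR R).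
  by apply: (pang_mfun (B := id)) => k; exact: Sk_id.
move=> mE; apply: (@dynkin_integral _ _ _ _ _ _ _ mW vA pang ivA mang (@RGenCInfty.G R) _ _ _ _ E mE).
- move=> _ _ [x ->] [y ->]; exists (Num.max x y).
  apply/seteqP; split => z /=; rewrite !in_itv /= !andbT ge_max.
    by move=> [-> ->].
  by move=> /andP[-> ->].
- exact: RGenCInfty.measurableE.
- rewrite -[RHS](step1 0 0); apply: eq_Rintegral => p _.
  by rewrite expr0 /cmode mul0r cos0; ring.
- move=> _ [t0 ->].
  have wang p : W p -> - b <= pang p <= b.
    by move=> /wedgeP[_ _ /andP[h1 h2]]; rewrite !ltW.
  have I01 (t : R) : -1 <= cmode 1 t <= 1 by rewrite -ler_norml cmode_le1.
  have [tb|bt] := leP t0 b; last first.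
    transitivity (\int[area R]_(p in W) (0 : R)); last by rewrite Rintegral_cst// mul0r.
    apply: eq_Rintegral => p /set_mem/wang/andP[h1 h2]; rewrite indicE memNset ?mulr0//= in_itv /= andbT => h3.
    by have := le_lt_trans h2 (lt_le_trans bt h3); rewrite ltxx.
  (* On the wedge the half-line from [t0] is the sublevel set of the decreasing function [cmode 1]
     at its value in [s]; clamping at [- b] is needed because monotonicity holds only on
     [[-b, b]]. *)
  pose s := Num.max t0 (- b).
  have hs : - b <= s <= b.
    by apply/andP; split; rewrite /s ?le_max ?lexx ?orbT// ge_max tb /=; move: b0; lra.
  rewrite -[RHS](step3 (I01 s)); apply: eq_Rintegral => p /set_mem wp.
  congr (_ * _); rewrite cmode_decr//; last exact: wang.
  by rewrite indicE mem_setE in_itv /= andbT /s ge_max; have /andP[-> _] := wang _ wp; rewrite andbT.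
Qed.

End fixed_A.

Let mrad : measurable_fun (W : set (mplane R)) (prad : mplane R -> measurableTypeR R).
Proof. by apply: (prad_mfun (A := id)) => k; exact: Sk_id. Qed.

Let mang : measurable_fun (W : set (mplane R)) (pang : mplane R -> measurableTypeR R).
Proof. by apply: (pang_mfun (B := id)) => k; exact: Sk_id. Qed.

(** Cutoffs on [(0, a)] with [a <= 1] are admissible radial bumps, and on the wedge they converge to
    the indicator of [r < a]. *)
Let integral_radius (E : set (measurableTypeR R)) (a : R) : measurable E -> 0 < a <= 1 ->
  \int[area R]_(p in W) (v p * \1_E (pang p) * \1_(`]-oo, a[%classic) (prad p)) = 0.
Proof.
move=> mE /andP[a0 a1].
have [c [c' [K [K0 hc dc c01 [c'b c'0 c1]]]]] := @cutoff R 0 a.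
have bc n : bumpfun 0 1 (c n).
  have [[_ [x [y [x0 ya h]]]] s] := hc n; split; first by move=> k; apply: Sk_sub (s k).
  by exists x, y; split => //; exact: lt_le_trans a1.
apply: (@Rint_dct_eq _ _ _ (area R) _ mW (fun n p => v p * c n (prad p) * \1_E (pang p)) _ (fun p => `|v p|)).
- move=> n; apply: measurable_funM; last exact: indic_comp_mfun.
  by apply: measurable_funM; [exact: rint_mfun iv|apply: prad_mfun; exact: (bc n).1].
- apply: measurable_funM; last by apply: indic_comp_mfun => //; exact: measurable_itv.
  by apply: measurable_funM; [exact: rint_mfun iv|exact: indic_comp_mfun].
- exact: integrable_norm.
- move=> n p _; rewrite -mulrA normrM ler_piMr// normrM -[leRHS]mulr1; apply: ler_pM => //.
    by have /andP[? ?] := c01 n (prad p); rewrite ger0_norm.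
  by rewrite indicE; case: (_ \in _); rewrite ?normr1 ?normr0.
- move=> p wp; rewrite mulrAC; apply: cvgM; last exact: cvg_cst.
  apply: cvgM; first exact: cvg_cst.
  rewrite indicE mem_setE in_itv /=; have [_ /andP[r0 _] _] := wedgeP wp.
  have [ra|ar] := ltP (prad p) a; first by apply: c1; rewrite /itvoo /= r0.
  apply/cvg_ballP => e e0; apply: nearW => n.
  suff -> : c n (prad p) = 0 by exact: ballxx.
  have [[_ [x [y [x0 ya h]]]] _] := hc n.
  apply/eqP; apply: contraTT ar => /h /andP[_ ry]; rewrite -ltNge.
  exact: le_lt_trans ya.
- by apply: nearW => n; apply: integral_bump_indic.
Qed.

Let integral_rect (E F : set (measurableTypeR R)) : measurable E -> measurable F ->
  \int[area R]_(p in W) (v p * \1_E (pang p) * \1_F (prad p)) = 0.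
Proof.
move=> mE; have ivE := rint_mul_indic mW iv mang mE.
have r01 p : W p -> 0 < prad p < 1 by move=> /wedgeP[_].
move=> mF; apply: (@dynkin_integral _ _ _ _ _ _ _ mW _ prad ivE mrad (@RGenInftyO.G R) _ _ _ _ F mF).
- move=> _ _ [x ->] [y ->]; exists (Num.min x y).
  apply/seteqP; split => z /=; rewrite !in_itv /= lt_min.
    by move=> [-> ->].
  by move=> /andP[-> ->].
- exact: RGenInftyO.measurableE.
- rewrite -[RHS](integral_radius mE (a := 1)) ?ltr01 ?lexx//.
  apply: eq_Rintegral => p /set_mem/r01/andP[_ r1].
  by rewrite [\1__ (prad p)]indicE mem_setE in_itv /= r1 mulr1.
- move=> _ [a ->]; have [a0|a0] := leP a 0.
    transitivity (\int[area R]_(p in W) (0 : R)); last by rewrite Rintegral_cst// mul0r.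
    apply: eq_Rintegral => p /set_mem/r01/andP[r0 _]; rewrite [\1__ (prad p)]indicE mem_setE in_itv /=.
    by rewrite ltNge (le_trans a0 (ltW r0)) mulr0.
  have ha : 0 < Num.min a 1 <= 1 by rewrite lt_min a0 ltr01 ge_min lexx orbT.
  rewrite -[RHS](integral_radius mE ha).
  apply: eq_Rintegral => p /set_mem/r01/andP[r0 r1]; congr (_ * _).
  by rewrite !indicE !mem_setE !in_itv /= lt_min r1 andbT.
Qed.

(* [cmode 1] is strictly monotone on [-b, b] and its polynomials are combinations
   of the [cmode n], so the indicators of polar rectangles are limits of
   admissible test functions. *)
Lemma completeness : ae_zero W v.
Proof.
have mP : measurable_fun (W : set (mplane R)) (fun p : mplane R => ((prad p, pang p) : mplane R)).
  exact: measurable_fun_pairD.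
have all0 (E : set (mplane R)) : measurable E ->
    \int[area R]_(p in W) (v p * \1_E ((prad p, pang p) : mplane R)) = 0.
  have rectE (X Y : set (measurableTypeR R)) p :
      v p * \1_(X `*` Y) ((prad p, pang p) : mplane R) = v p * \1_Y (pang p) * \1_X (prad p).
    by rewrite -mulrA; congr (_ * _); rewrite !indicE in_setX /= andbC -mulnb natrM.
  move=> mE; apply: (@dynkin_integral _ _ _ _ _ _ _ mW v _ iv mP
    [set X `*` Y | X in @measurable _ (measurableTypeR R) & Y in @measurable _ (measurableTypeR R)] _ _ _ _ E mE).
  - move=> _ _ [X mX [Y mY <-]] [X' mX' [Y' mY' <-]].
    exists (X `&` X'); first exact: measurableI.
    by exists (Y `&` Y'); [exact: measurableI|rewrite setXI].
  - exact: measurable_prod_measurableType.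
  - rewrite -[RHS](integral_rect (E := setT) (F := setT))//.
    by apply: eq_Rintegral => p _; rewrite !indicT !mulr1.
  - move=> _ [X mX [Y mY <-]]; rewrite -[RHS](integral_rect mY mX).
    by apply: eq_Rintegral => p _; exact: rectE.
have mpol : measurable_fun setT (fun q : mplane R => polar q.1 q.2 : mplane R).
  have m1 : measurable_fun setT (fun q : mplane R => q.1 * cos q.2 : measurableTypeR R).
    apply: (@open_continuous_mfun _ setT (fun q : R * R => q.1 * cos q.2)); first exact: openT.
    move=> p _; apply: cvgM; first exact: fst_continuous.
    by apply: continuous_comp; [exact: snd_continuous|exact: continuous_cos].
  have m2 : measurable_fun setT (fun q : mplane R => q.1 * sin q.2 : measurableTypeR R).
    apply: (@open_continuous_mfun _ setT (fun q : R * R => q.1 * sin q.2)); first exact: openT.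
    move=> p _; apply: cvgM; first exact: fst_continuous.
    by apply: continuous_comp; [exact: snd_continuous|exact: continuous_sin].
  exact: (measurable_fun_pair m1 m2).
have mv := rint_mfun iv.
(* Polar coordinates are injective on the wedge, so the part of it where [v] lies in [E] corresponds
   to a measurable set of pairs [(r, theta)], to which [all0] applies. Applied to the two signs of
   [v] this kills the integral of [|v|]. *)
have part (E : set R) : measurable (E : set (measurableTypeR R)) ->
    \int[area R]_(p in W) (v p * \1_E (v p)) = 0.
  move=> mE; have mE0 : measurable (W `&` v @^-1` E : set (mplane R)) by exact: mv.
  have := mpol measurableT _ mE0; rewrite setTI => /all0 <-.
  apply: eq_Rintegral => p /set_mem wp; congr (_ * _).
  have [p0 _ _] := wedgeP wp; rewrite !indicE; congr ((_ : bool)%:R).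
  apply/idP/idP => /set_mem h; apply/mem_set; rewrite /= polar_prad_pang// in h *.
  by case: h.
have mitv (I : interval R) : measurable ([set` I] : set (measurableTypeR R)) by exact: measurable_itv.
have abs0 : \int[area R]_(p in W) `|v p| = 0.
  transitivity (\int[area R]_(p in W) (v p * \1_(`]0, +oo[%classic : set R) (v p) -
     v p * \1_(`]-oo, 0[%classic : set R) (v p))).
    apply: eq_Rintegral => p _; rewrite !indicE !mem_setE !in_itv /= andbT.
    by case: ltrgt0P => [h|h|->] /=; rewrite ?mulr1 ?mulr0 ?subr0 ?sub0r.
  by rewrite RintB//; [rewrite !part// subrr|exact: rint_mul_indic..].
have h0 : (\int[area R]_(p in W) `|(v p)%:E| = 0)%E.
  have fin : (\int[area R]_(p in W) `|(v p)%:E|)%E \is a fin_num.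
    by apply: integrable_fin_num => //; exact: integrable_norm.
  by rewrite -(fineK fin); congr EFin; exact: abs0.
have mEv : measurable_fun (W : set (mplane R)) (fun p => (v p)%:E) by exact/measurable_EFinP.
have := (ae_eq_integral_abs (area R) mW mEv).1 h0.
by apply: filterS => p h wp; have [] := h wp.
Qed.

End completeness.

(** * Bessel functions *)

Section bessel.
Context {R : realType}.
Implicit Types s t r : R.

(** In closed form [(-1)^m / (m! (s + 1) ... (s + m))]. *)
Fixpoint bcoef (s : R) (m : nat) : R :=
  if m is k.+1 then - bcoef s k / (k.+1%:R * (s + k.+1%:R)) else 1.

Lemma bcoef_diff s m : 0 <= s ->
  m.+1%:R * bcoef s m.+1 = - (s + 1)^-1 * bcoef (s + 1) m.
Proof.
move=> s0; have pos (k : nat) : s + k.+1%:R != 0.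
  by rewrite gt_eqF// ltr_wpDl// ltr0n.
elim: m => [|m IH]; first by have := pos 0%N; rewrite /= => h; field.
have E : bcoef (s + 1) m = - (s + 1) * (m.+1%:R * bcoef s m.+1).
  by rewrite IH; have := pos 0%N; rewrite /= => h; field.
have -> : bcoef (s + 1) m.+1 = - bcoef (s + 1) m / (m.+1%:R * (s + 1 + m.+1%:R)) by [].
rewrite E (_ : bcoef s m.+2 = - bcoef s m.+1 / (m.+2%:R * (s + m.+2%:R)))//.
have h0 := pos 0%N; have h1 := pos m.+1; have hm : m.+1%:R != 0 :> R by rewrite pnatr_eq0.
have hm2 : m.+2%:R != 0 :> R by rewrite pnatr_eq0.
have e2 : s + 1 + m.+1%:R = s + m.+2%:R by rewrite -(natr1 m.+1); ring.
rewrite e2; move: (bcoef s m.+1) (m.+1%:R) (m.+2%:R) hm hm2 h1 => x u w hm hm2 h1.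
by field; rewrite h0 h1 hm hm2.
Qed.

Lemma bcoef_bound s m : 0 <= s -> `|bcoef s m| <= (m`!%:R)^-1.
Proof.
move=> s0; elim: m => [|m IH]; first by rewrite /= normr1 fact0 invr1.
have p0 : 0 < m.+1%:R * (s + m.+1%:R) by rewrite mulr_gt0// ltr_wpDl.
have -> : ((m.+1)`!%:R)^-1 = (m`!%:R)^-1 * m.+1%:R^-1 :> R by rewrite factS natrM invfM mulrC.
rewrite /= normrM normrN normfV (gtr0_norm p0); apply: ler_pM => //.
  by rewrite invr_ge0 ltW.
rewrite lef_pV2 ?posrE// ler_peMr// (le_trans _ (_ : m.+1%:R <= _))// ?ler1n// lerDr//.
Qed.

Lemma pseries_bcoef_cvg s t : 0 <= s -> cvgn (pseries (bcoef s) t).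
Proof.
move=> s0; apply: normed_cvg.
apply: (@series_le_cvg _ _ (fun n => exp_coeff `|t| n)) => [n|n|n|].
- by rewrite /= normr_ge0.
- by rewrite exp_coeff_ge0.
- rewrite /= normrM normrX /exp_coeff /= mulrC ler_wpM2l// ?exprn_ge0//; exact: bcoef_bound.
- exact: is_cvg_series_exp_coeff.
Qed.

(* J_s(x) = (x / 2)^s bes s (x^2 / 4) / Gamma(s + 1). *)
Definition bes (s t : R) : R := limn (pseries (bcoef s) t).

Lemma bes_cvg s t : 0 <= s -> pseries (bcoef s) t @ \oo --> bes s t.
Proof. by move=> s0; exact: pseries_bcoef_cvg. Qed.

Lemma bcoef_diffs s : 0 <= s ->
  pseries_diffs (bcoef s) = (fun m => - (s + 1)^-1 * bcoef (s + 1) m).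
Proof. by move=> s0; apply/funext => m; rewrite /pseries_diffs bcoef_diff. Qed.

Lemma pseries_scale (c : R) (f : nat -> R) t :
  pseries (fun m => c * f m) t = (fun n => c * pseries f t n).
Proof.
apply/funext => n; rewrite /pseries /series /= mulr_sumr.
by apply: eq_bigr => i _; rewrite mulrA.
Qed.

(** The classical rule that the derivative of [x^(-s) J_s] is [- x^(-s) J_(s+1)], written in the
    variable [x^2 / 4]. *)
Lemma is_derive_bes s t : 0 <= s ->
  is_derive t (1 : R) (bes s) (- (s + 1)^-1 * bes (s + 1) t).
Proof.
move=> s0; have s1 : 0 <= s + 1 by rewrite addr_ge0.
have cd c u x : 0 <= u -> cvgn (pseries (fun m => c * bcoef u m) x).
  move=> u0; rewrite pseries_scale; apply: is_cvgM; first exact: is_cvg_cst.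
  exact: pseries_bcoef_cvg.
have := @pseries_snd_diffs R (bcoef s) (`|t| + 1) t.
rewrite bcoef_diffs//.
have -> : pseries_diffs (fun m => - (s + 1)^-1 * bcoef (s + 1) m) =
   (fun m => - (s + 1)^-1 * - (s + 1 + 1)^-1 * bcoef (s + 1 + 1) m).
  apply/funext => m; rewrite /pseries_diffs mulrCA bcoef_diff//; ring.
move=> h; apply: (is_derive_eq (h _ _ _ _)).
- exact: pseries_bcoef_cvg.
- exact: cd.
- by apply: cd; rewrite addr_ge0.
- by rewrite [ltRHS]ger0_norm ?addr_ge0// ltrDl.
rewrite pseries_scale; apply/cvg_lim => //.
by apply: cvgM; [exact: cvg_cst|exact: bes_cvg].
Qed.

Lemma bes0 s : 0 <= s -> bes s 0 = 1.
Proof.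
move=> s0; apply/cvg_lim => //; apply/cvg_ballP => e e0; exists 1%N => // n /= n1.
suff -> : pseries (bcoef s) 0 n = 1 by exact: ballxx.
case: n n1 => // n _; rewrite /pseries /series /= big_nat_recl//= expr0 mulr1 big1 ?addr0// => i _.
by rewrite exprS mul0r mulr0.
Qed.

(** The three-term recurrence between [J_s], [J_(s+1)] and [J_(s+2)]. Since differentiation raises
    the order, it is also the Bessel equation in the form [t f'' + (s + 1) f' + f = 0]. *)
Lemma bes_contiguous s t : 0 <= s ->
  bes s t = bes (s + 1) t - t / ((s + 1) * (s + 2)) * bes (s + 2) t.
Proof.
move=> s0; have s1 : 0 <= s + 1 by rewrite addr_ge0. have s2 : 0 <= s + 2 by rewrite addr_ge0.
have key n : pseries (bcoef s) t n.+1 =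
    pseries (bcoef (s + 1)) t n.+1 - t / ((s + 1) * (s + 2)) * pseries (bcoef (s + 2)) t n.
  have hs : s + 1 != 0 by rewrite gt_eqF// ltr_wpDl.
  have hs2 : s + 2 != 0 by rewrite gt_eqF// ltr_wpDl.
  rewrite /pseries /series /=; elim: n => [|n IH].
    by rewrite !big_nat1 big_geq// mulr0 subr0.
  rewrite [LHS]big_nat_recr//= IH [X in _ = X - _]big_nat_recr//= [X in _ = _ - _ * X]big_nat_recr//=.
  have h1 := bcoef_diff n s0; have h2 := bcoef_diff n s1.
  have hn : n.+1%:R != 0 :> R by rewrite pnatr_eq0.
  have hsn : s + n.+1%:R != 0 by rewrite gt_eqF// ltr_wpDl.
  have hsn2 : s + 1 + n.+1%:R != 0 by rewrite gt_eqF// ltr_wpDl.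
  have hB : bcoef (s + 1) n.+1 = - bcoef (s + 1) n / (n.+1%:R * (s + 1 + n.+1%:R)) by [].
  have e2 : s + 1 + 1 = s + 2 by rewrite -addrA.
  have hC : bcoef (s + 2) n = - (s + 2) * (n.+1%:R * bcoef (s + 1) n.+1).
    by rewrite h2 e2; field.
  have hA : bcoef s n.+1 = - (s + 1)^-1 * bcoef (s + 1) n / n.+1%:R by rewrite -h1; field.
  rewrite -/(bcoef s n.+1) -/(bcoef (s + 1) n.+1) hC hA hB exprS.
  move: (bcoef (s + 1) n) (n.+1%:R) (t ^+ n) hn hsn hsn2 => x u w hn hsn hsn2.
  by field; rewrite hs hs2 hn hsn2.
have l1 : (fun n => pseries (bcoef s) t n.+1) @ \oo --> bes s t.
  by have := @bes_cvg _ t s0; rewrite -(cvg_shiftS).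
have l2 : (fun n => pseries (bcoef (s + 1)) t n.+1) @ \oo --> bes (s + 1) t.
  by have := @bes_cvg _ t s1; rewrite -(cvg_shiftS).
have l3 : (fun n => pseries (bcoef (s + 1)) t n.+1 -
    t / ((s + 1) * (s + 2)) * pseries (bcoef (s + 2)) t n) @ \oo -->
    bes (s + 1) t - t / ((s + 1) * (s + 2)) * bes (s + 2) t.
  by apply: cvgB => //; apply: cvgM; [exact: cvg_cst|exact: bes_cvg].
rewrite -(funext key) in l3.
exact: (cvg_unique (@Rhausdorff R) l1 l3).
Qed.

Lemma Sk_bes I k s : 0 <= s -> Sk I k (bes s).
Proof.
elim: k s => [|k IH] s s0.
  by move=> t _; exact: is_derive_continuous (is_derive_bes t s0).
exists (fun t => - (s + 1)^-1 * bes (s + 1) t); first by move=> t _; exact: is_derive_bes.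
by apply: Sk_scale; apply: IH; rewrite addr_ge0.
Qed.

Lemma nonincreasing_of_derivative (f f' : R -> R) (a b : R) : a <= b ->
  (forall x, a <= x <= b -> is_derive x (1 : R) f (f' x)) ->
  (forall x, a <= x <= b -> f' x <= 0) -> f b <= f a.
Proof.
move=> ab df hf; have [c cab E] := mean_value ab df.
by rewrite -subr_le0 E mulr_le0_ge0// ?subr_ge0// hf.
Qed.

(* The energy [f^2 + t f'^2] of a solution of [t f'' + (s + 1) f' + f = 0] is
   nonincreasing. *)
Lemma bes_le1 s t : 0 <= s -> 0 <= t -> `|bes s t| <= 1.
Proof.
move=> s0 t0; have s1 : 0 <= s + 1 by rewrite addr_ge0.
have hs : s + 1 != 0 by rewrite gt_eqF// ltr_wpDl.
have hs2 : s + 1 + 1 != 0 by rewrite gt_eqF// ltr_wpDl.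
pose E x := bes s x * bes s x + x * ((- (s + 1)^-1 * bes (s + 1) x) * (- (s + 1)^-1 * bes (s + 1) x)).
have dE x : is_derive x (1 : R) E (- (2 * s + 1) * (- (s + 1)^-1 * bes (s + 1) x) ^+ 2).
  have d1 := is_derive_bes x s0.
  have d2 := is_derive_scale (- (s + 1)^-1) (is_derive_bes x s1).
  apply: (is_derive_eq (is_derive_add (is_derive_mul d1 d1)
    (is_derive_mul (is_derive_id x (1 : R)) (is_derive_mul d2 d2)))).
  rewrite (bes_contiguous x s0).
  have -> : s + 2 = s + 1 + 1 by rewrite -addrA.
  by field; rewrite hs hs2.
have h : E t <= E 0.
  apply: (nonincreasing_of_derivative t0 (fun x _ => dE x)) => x _.
  by rewrite mulNr oppr_le0 mulr_ge0 ?sqr_ge0// addr_ge0// mulr_ge0.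
rewrite -(@expr_le1 _ 2)// real_normK ?num_real// expr2.
apply: le_trans (_ : E 0 <= 1); last by rewrite /E bes0// mul0r addr0 mulr1.
apply: le_trans h; rewrite /E lerDl mulr_ge0// -expr2 sqr_ge0//.
Qed.

Definition btaylor (N : nat) (s t : R) : R := \sum_(m < N) bcoef s m * t ^+ m.

Lemma is_derive_btaylor N s t : 0 <= s ->
  is_derive t (1 : R) (btaylor N.+1 s) (- (s + 1)^-1 * btaylor N (s + 1) t).
Proof.
move=> s0; elim: N => [|N IH].
  rewrite /btaylor big_ord0 mulr0 (_ : (fun t => _) = fun=> 1); first exact: is_derive_const.
  by apply/funext => x; rewrite big_ord_recr big_ord0 /= expr0 mulr1 add0r.
rewrite (_ : btaylor N.+2 s = fun x => btaylor N.+1 s x + bcoef s N.+1 * x ^+ N.+1); last first.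
  by apply/funext => x; rewrite /btaylor [LHS]big_ord_recr.
apply: (is_derive_eq (is_derive_add IH (is_derive_scale (bcoef s N.+1) (is_derive_expn N.+1 (is_derive_id t (1 : R)))))).
have -> : btaylor N.+1 (s + 1) t = btaylor N (s + 1) t + bcoef (s + 1) N * t ^+ N.
  by rewrite /btaylor big_ord_recr.
rewrite mulrDr; congr (_ + _).
have := bcoef_diff N s0; rewrite /= => h.
by rewrite mulr1 mulrA [_ * N.+1%:R]mulrC h mulrA.
Qed.

Lemma btaylor0 N s : btaylor N.+1 s 0 = 1.
Proof.
rewrite /btaylor big_ord_recl /= expr0 mulr1 big1 ?addr0// => i _.
by rewrite /bump /= exprS mul0r mulr0.
Qed.

(** The partial sums bound [bes] alternately from above and below for every [t >= 0], even where the
    terms do not yet decrease: differentiating reduces the claim to one term fewer at order [s + 1],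
    and the start of the induction is the global bound [bes <= 1]. *)
Lemma bes_btaylor N s t : 0 <= s -> 0 <= t ->
  0 <= (-1) ^+ N * (btaylor N.+1 s t - bes s t).
Proof.
elim: N s t => [|N IH] s t s0 t0.
  rewrite expr0 mul1r /btaylor big_ord_recr big_ord0 /= expr0 mulr1 add0r subr_ge0.
  by apply: le_trans (bes_le1 s0 t0); exact: ler_norm.
have s1 : 0 <= s + 1 by rewrite addr_ge0.
pose g x := (-1) ^+ N.+1 * (bes s x - btaylor N.+2 s x).
have dg x : is_derive x (1 : R) g ((-1) ^+ N.+1 * (- (s + 1)^-1 * bes (s + 1) x - - (s + 1)^-1 * btaylor N.+1 (s + 1) x)).
  by apply: is_derive_scale; apply: is_derive_sub; [exact: is_derive_bes|exact: is_derive_btaylor].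
have h : g t <= g 0.
  apply: (nonincreasing_of_derivative t0 (fun x _ => dg x)) => x /andP[x0 _].
  have := IH (s + 1) x s1 x0; rewrite exprS -mulrBr => h.
  have i0 : 0 <= (s + 1)^-1 by rewrite invr_ge0.
  rewrite (_ : _ * _ = - ((s + 1)^-1 * ((-1) ^+ N * (btaylor N.+1 (s + 1) x - bes (s + 1) x)))).
    by rewrite oppr_le0 mulr_ge0.
  by ring.
move: h; rewrite /g bes0// btaylor0 subrr mulr0 => h.
by rewrite -opprB mulrN oppr_ge0.
Qed.

Lemma bes_ge_btaylor N s t : 0 <= s -> 0 <= t -> odd N -> btaylor N.+1 s t <= bes s t.
Proof.
move=> s0 t0 oN; have := bes_btaylor N s0 t0.
by rewrite -signr_odd oN expr1 mulN1r oppr_ge0 subr_le0.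
Qed.

Lemma bes_le_btaylor N s t : 0 <= s -> 0 <= t -> ~~ odd N -> bes s t <= btaylor N.+1 s t.
Proof.
move=> s0 t0 /negbTE oN; have := bes_btaylor N s0 t0.
by rewrite -signr_odd oN expr0 mul1r subr_ge0.
Qed.

Lemma btaylor_error N s t : 0 <= s -> 0 <= t ->
  `|bes s t - btaylor N.+1 s t| <= t ^+ N.+1 / (N.+1)`!%:R.
Proof.
move=> s0 t0; have h1 := bes_btaylor N s0 t0; have := bes_btaylor N.+1 s0 t0.
have -> : btaylor N.+2 s t = btaylor N.+1 s t + bcoef s N.+1 * t ^+ N.+1.
  by rewrite /btaylor [LHS]big_ord_recr.
move=> h2; have hb : `|bcoef s N.+1 * t ^+ N.+1| <= t ^+ N.+1 / (N.+1)`!%:R.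
  by rewrite normrM mulrC [`|t ^+ _|]ger0_norm ?exprn_ge0// ler_wpM2l ?exprn_ge0// bcoef_bound.
apply: le_trans hb; move: h1 h2; rewrite exprS mulN1r.
rewrite -signr_odd; case: (odd N); rewrite ?expr0 ?expr1 => h1 h2; rewrite ler_norml.
  have : bcoef s N.+1 * t ^+ N.+1 <= `|bcoef s N.+1 * t ^+ N.+1| by exact: ler_norm.
  by lra.
have := ler_norm (- (bcoef s N.+1 * t ^+ N.+1)); rewrite normrN.
by lra.
Qed.

Lemma btaylor_continuous N t (s : R) : 0 <= s -> {for s, continuous (fun s => btaylor N s t)}.
Proof.
move=> s0; have cb m : {for s, continuous (fun s => bcoef s m)}.
  elim: m => [|m IH]; first exact: cst_continuous.
  apply: cvgM; first exact: cvgN.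
  apply: cvgV; first by rewrite mulf_neq0 ?pnatr_eq0// gt_eqF// ltr_wpDl.
  by apply: cvgM; [exact: cvg_cst|apply: cvgD; [exact: cvg_id|exact: cvg_cst]].
elim: N => [|N IH].
  rewrite (_ : (fun s => _) = fun=> 0); first exact: cst_continuous.
  by apply/funext => x; rewrite /btaylor big_ord0.
rewrite (_ : (fun s => _) = fun s => btaylor N s t + bcoef s N * t ^+ N); last first.
  by apply/funext => x; rewrite /btaylor big_ord_recr.
by apply: cvgD; [exact: IH|apply: cvgM; [exact: cb|exact: cvg_cst]].
Qed.

(** The Taylor remainder bound [t^(N+1) / (N+1)!] does not depend on the order, so [bes] is a
    uniform limit of the partial sums, which are continuous in [s]. *)
Lemma bes_continuous_order t (s : R) : 0 < s -> 0 <= t -> {for s, continuous (fun s => bes s t)}.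
Proof.
move=> s0 t0; apply/cvgrPdist_lt => e e0.
have e3 : 0 < e / 3 by rewrite divr_gt0.
have [N hN] : exists N, t ^+ N.+1 / (N.+1)`!%:R < e / 3.
  have := @cvg_exp_coeff R t; rewrite /exp_coeff => /cvgrPdist_lt /(_ _ e3)[N _ hN].
  exists N; have := hN N.+1 (leqnSn N); rewrite /= sub0r normrN ger0_norm//.
  by rewrite divr_ge0// exprn_ge0.
have cT := @btaylor_continuous N.+1 t s (ltW s0).
near=> u; have u0 : 0 <= u by apply: ltW; near: u; exact: lt_nbhsr.
have h1 := le_lt_trans (btaylor_error N (ltW s0) t0) hN.
have h2 := le_lt_trans (btaylor_error N u0 t0) hN.
have h3 : `|btaylor N.+1 s t - btaylor N.+1 u t| < e / 3.
  by near: u; move/cvgrPdist_lt : cT; exact.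
have -> : bes s t - bes u t = (bes s t - btaylor N.+1 s t) +
   (btaylor N.+1 s t - btaylor N.+1 u t) - (bes u t - btaylor N.+1 u t) by ring.
rewrite (le_lt_trans (ler_normB _ _))//; have := ler_normD (bes s t - btaylor N.+1 s t) (btaylor N.+1 s t - btaylor N.+1 u t).
by lra.
Unshelve. all: by end_near. Qed.

End bessel.

(** * Numerical bounds *)

Section numerics.
Context {R : realType}.
Implicit Types s t : R.

(* The derivative at [r = 1] of [r^s * bes s (t r^2)]. *)
Definition bder s t : R := s * bes s t - 2 * t / (s + 1) * bes (s + 1) t.

Lemma is_derive_bder s t : 0 <= s ->
  is_derive t (1 : R) (bder s) (s / (s + 1) * bes (s + 1) t - 2 * bes s t).
Proof.
move=> s0; have s1 : 0 <= s + 1 by rewrite addr_ge0.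
have hs : s + 1 != 0 by rewrite gt_eqF// ltr_wpDl.
have hs2 : s + 1 + 1 != 0 by rewrite gt_eqF// ltr_wpDl.
have d1 := is_derive_scale s (is_derive_bes t s0).
have d2 : is_derive t (1 : R) (fun x : R => 2 * x / (s + 1)) (2 / (s + 1)).
  apply: (is_derive_eq (is_derive_mul (is_derive_scale 2 (is_derive_id t (1 : R)))
    (is_derive_const (s + 1)^-1 t (1 : R)))).
  by rewrite mulr0 addr0 mulr1.
apply: (is_derive_eq (is_derive_sub d1 (is_derive_mul d2 (is_derive_bes t s1)))).
rewrite (bes_contiguous t s0) (_ : s + 2 = s + 1 + 1); last by rewrite -addrA.
by field; rewrite hs hs2.
Qed.

Lemma bder_continuous_order t s : 0 < s -> 0 <= t -> {for s, continuous (fun s => bder s t)}.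
Proof.
move=> s0 t0; apply: cvgB; apply: cvgM.
- exact: cvg_id.
- exact: bes_continuous_order.
- apply: cvgM; first exact: cvg_cst.
  apply: cvgV; first by rewrite gt_eqF// addr_gt0.
  by apply: cvgD; [exact: cvg_id|exact: cvg_cst].
- apply: (@continuous_comp _ _ _ (fun s => s + 1) (fun s => bes s t)).
    by apply: cvgD; [exact: cvg_id|exact: cvg_cst].
  by apply: bes_continuous_order => //; rewrite addr_gt0.
Qed.

Lemma bes_horner4 s t : 0 <= s -> 0 <= t ->
  1 - t / (s + 1) * (1 - t / (2 * (s + 2)) * (1 - t / (3 * (s + 3)))) <= bes s t.
Proof.
move=> s0 t0; apply: le_trans (bes_ge_btaylor (N := 3) s0 t0 _) => //.
rewrite le_eqVlt; apply/orP; left; apply/eqP.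
rewrite /btaylor !big_ord_recr big_ord0 /=; field.
by rewrite !gt_eqF// ltr_wpDl.
Qed.

Lemma bes_horner3 s t : 0 <= s -> 0 <= t ->
  bes s t <= 1 - t / (s + 1) * (1 - t / (2 * (s + 2))).
Proof.
move=> s0 t0; apply: le_trans (bes_le_btaylor (N := 2) s0 t0 _) _ => //.
rewrite le_eqVlt; apply/orP; left; apply/eqP.
rewrite /btaylor !big_ord_recr big_ord0 /=; field.
by rewrite !gt_eqF// ltr_wpDl.
Qed.

Lemma bes_horner2 s t : 0 <= s -> 0 <= t -> 1 - t / (s + 1) <= bes s t.
Proof.
move=> s0 t0; apply: le_trans (bes_ge_btaylor (N := 1) s0 t0 _) => //.
rewrite le_eqVlt; apply/orP; left; apply/eqP.
rewrite /btaylor !big_ord_recr big_ord0 /=; field.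
by rewrite !gt_eqF// ltr_wpDl.
Qed.

(** Slightly above the upper bound [92 / 25] for [t0] in [bes1_root], so that all levels of interest
    lie in [[0, T]]. *)
Notation T := (369 / 100 : R).

Lemma div_bounds (t u d e : R) : 0 <= t -> 0 < d -> d <= u -> u <= e -> t / e <= t / u <= t / d.
Proof.
move=> t0 d0 du ue; have u0 := lt_le_trans d0 du; have e0 := lt_le_trans u0 ue.
by apply/andP; split; apply: ler_wpM2l => //; rewrite lef_pV2.
Qed.

(** The four-term bound in Horner form with the worst factors for [5 / 2 <= s <= 3]: [2 / 7] is the
    inverse of the least [s + 1], and [97 / 1250] combines [t / 10] from the middle factor with the
    lower bound [97 / 125] for the innermost one. *)
Lemma bes_mid_lower s t : 5 / 2 <= s <= 3 -> 0 <= t <= T ->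
  1 - t * (2 / 7) * (1 - t * (97 / 1250)) <= bes s t.
Proof.
move=> /andP[s1 s2] /andP[t0 t1].
apply: le_trans (bes_horner4 _ t0); last by lra.
have /andP[_ h1] : t / 4 <= t / (s + 1) <= t / (7 / 2) by apply: div_bounds; lra.
have /andP[h2 _] : t / 10 <= t / (2 * (s + 2)) <= t / 9 by apply: div_bounds; lra.
have /andP[_ h3] : t / 18 <= t / (3 * (s + 3)) <= t / (33 / 2) by apply: div_bounds; lra.
have k1 : 0 <= t / (s + 1) by apply: divr_ge0; lra.
move: (t / (s + 1)) (t / (2 * (s + 2))) (t / (3 * (s + 3))) h1 h2 h3 k1 => x y z h1 h2 h3 k1.
have z1 : 97 / 125 <= 1 - z by lra.
have yz : t * (97 / 1250) <= y * (1 - z) by nra.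
have w0 : 0 <= 1 - t * (97 / 1250) by lra.
have : x * (1 - y * (1 - z)) <= x * (1 - t * (97 / 1250)) by apply: ler_wpM2l => //; lra.
have : x * (1 - t * (97 / 1250)) <= t / (7 / 2) * (1 - t * (97 / 1250)) by apply: ler_wpM2r.
by move=> ? ?; lra.
Qed.

Lemma bes_mid_gt0 s t : 5 / 2 <= s <= 3 -> 0 <= t <= T -> 0 < bes s t.
Proof.
move=> hs ht; apply: lt_le_trans (bes_mid_lower hs ht).
by move: ht => /andP[t0 t1]; nra.
Qed.

(** This expression is the derivative of [bder s]. Its sign shows that a root of [bder s] is the
    only one in the range and that [bder s] is positive before it. *)
Lemma bder_mid_decreasing s t : 5 / 2 <= s <= 3 -> 0 <= t <= T ->
  s / (s + 1) * bes (s + 1) t - 2 * bes s t < 0.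
Proof.
move=> hs ht; have h := bes_mid_lower hs ht.
move: hs ht => /andP[s1 s2] /andP[t0 t1].
have hG : bes (s + 1) t <= 1 - t / 5 * (1 - t / 11).
  apply: le_trans (bes_horner3 _ t0) _; first by lra.
  have /andP[h1 _] : t / 5 <= t / (s + 1 + 1) <= t / (9 / 2) by apply: div_bounds; lra.
  have /andP[_ h2] : t / 12 <= t / (2 * (s + 1 + 2)) <= t / 11 by apply: div_bounds; lra.
  move: (t / (s + 1 + 1)) (t / (2 * (s + 1 + 2))) h1 h2 => x y h1 h2.
  have k : 0 <= 1 - t / 11 by lra.
  have k' : 0 <= x by lra.
  have a := ler_wpM2r k h1.
  have b : x * (1 - t / 11) <= x * (1 - y) by apply: ler_wpM2l => //; lra.
  by lra.
have hc : 0 <= s / (s + 1) <= 3 / 4.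
  apply/andP; split; first by apply: divr_ge0; lra.
  by rewrite ler_pdivrMr; lra.
move: (s / (s + 1)) (bes (s + 1) t) hc hG => c G /andP[c0 c1] hG.
have u0 : 0 <= 1 - t / 5 * (1 - t / 11) by nra.
have h1 : c * G <= 3 / 4 * (1 - t / 5 * (1 - t / 11)).
  by apply: (@le_trans _ _ (c * (1 - t / 5 * (1 - t / 11)))); [exact: ler_wpM2l|exact: ler_wpM2r].
by nra.
Qed.

Lemma bder_mid_lt s t u : 5 / 2 <= s <= 3 -> 0 <= t -> t < u -> u <= T ->
  bder s u < bder s t.
Proof.
move=> hs t0 tu uT; have s0 : 0 <= s by case/andP: hs => ? _; lra.
have [c /andP[tc cu] E] := mean_value (ltW tu) (fun x _ => is_derive_bder x s0).
rewrite -subr_lt0 E nmulr_rlt0 ?subr_gt0//.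
by apply: bder_mid_decreasing => //; rewrite (le_trans t0 tc) (le_trans cu).
Qed.

(** From order 5 on the two-term Taylor bound suffices: [bes] stays above [1 - T / 6 = 231 / 600].
    This disposes of the angular modes with [n >= 2], whose frequency [n * nu] is at least 5. *)
Lemma bes_high s t : 5 <= s -> 0 <= t <= T -> 0 < bes s t /\ 0 < bder s t.
Proof.
move=> s5 /andP[t0 t1]; have s0 : 0 <= s by lra.
have h := bes_horner2 s0 t0.
have /andP[_ h1] : t / (s + 1) <= t / (s + 1) <= t / 6 by apply: div_bounds; lra.
have F0 : 231 / 600 <= bes s t by lra.
split; first by lra.
have h2 : bes (s + 1) t <= 1.
  by apply: le_trans (bes_le1 _ t0); [exact: ler_norm|lra].
have e : 2 * t / (s + 1) = 2 * (t / (s + 1)) by rewrite mulrA.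
have k : 0 <= t / (s + 1) by apply: divr_ge0; lra.
rewrite /bder e; move: (bes (s + 1) t) (t / (s + 1)) h2 h1 k => G x h2 h1 k.
have : x * G <= x by rewrite ler_piMr.
have : 5 * bes s t <= s * bes s t by rewrite ler_wpM2r//; lra.
by lra.
Qed.

Lemma bes2_gt0 t : 0 <= t <= T -> 0 < bes 2 t.
Proof.
move=> /andP[t0 t1]; apply: lt_le_trans (bes_horner4 _ t0) => //.
have -> : 1 - t / (2 + 1) * (1 - t / (2 * (2 + 2)) * (1 - t / (3 * (2 + 3)))) =
  1 - t / 3 * (1 - t / 8 * (1 - t / 15)) by field.
have k : 754 / 1000 <= 1 - t / 15 by lra.
have k2 : t / 8 * (754 / 1000) <= t / 8 * (1 - t / 15) by apply: ler_wpM2l => //; lra.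
have : t / 3 * (1 - t / 8 * (1 - t / 15)) <= t / 3 * (1 - t / 8 * (754 / 1000)).
  by apply: ler_wpM2l; lra.
by nra.
Qed.

Lemma is_derive_bes1 t : is_derive t (1 : R) (bes 1) (- (1 + 1)^-1 * bes 2 t).
Proof. exact: is_derive_bes. Qed.

Lemma bes1_lt t u : 0 <= t -> t < u -> u <= T -> bes 1 u < bes 1 t.
Proof.
move=> t0 tu uT; have [c /andP[tc cu] E] := mean_value (ltW tu) (fun x _ => is_derive_bes1 x).
rewrite -subr_lt0 E mulNr mulNr oppr_lt0 !mulr_gt0 ?subr_gt0//.
by apply: bes2_gt0; rewrite (le_trans t0 tc) (le_trans cu).
Qed.

(** Here [t0] is [j^2 / 4], because [J_0' = - J_1]. The bracket comes from the six-term sum, a lower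
    bound, and the seven-term sum, an upper bound. *)
Lemma bes1_root : exists t0, [/\ 183 / 50 < t0 < 92 / 25, bes 1 t0 = 0 &
  forall t, 0 <= t -> t < t0 -> 0 < bes 1 t].
Proof.
have h1 : 0 < bes 1 (183 / 50 : R).
  apply: lt_le_trans (bes_ge_btaylor (N := 5) _ _ _); try lra; last by [].
  have -> : btaylor 6 1 (183 / 50 : R) = 1 - 183 / 50 / 2 * (1 - 183 / 50 / 6 * (1 - 183 / 50 / 12 *
     (1 - 183 / 50 / 20 * (1 - 183 / 50 / 30)))).
    by rewrite /btaylor !big_ord_recr big_ord0 /=; field.
  lra.
have h2 : bes 1 (92 / 25 : R) < 0.
  apply: le_lt_trans (bes_le_btaylor (N := 6) _ _ _) _; try lra; first by [].
  have -> : btaylor 7 1 (92 / 25 : R) = 1 - 92 / 25 / 2 * (1 - 92 / 25 / 6 * (1 - 92 / 25 / 12 *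
     (1 - 92 / 25 / 20 * (1 - 92 / 25 / 30 * (1 - 92 / 25 / 42))))).
    by rewrite /btaylor !big_ord_recr big_ord0 /=; field.
  lra.
have [|||c] := @IVT R (bes 1) (183 / 50) (92 / 25) 0; first by lra.
- apply: continuous_in_subspaceT => x _.
  exact: is_derive_continuous (is_derive_bes1 x).
- by rewrite ge_min le_max (ltW h1) (ltW h2) orbT.
rewrite in_itv /= => /andP[c1 c2] c0; exists c; split => //.
- apply/andP; split; rewrite lt_neqAle ?c1 ?c2 andbT.
    by apply: contraTneq h1 => ->; rewrite c0 ltxx.
  by apply: contraTneq h2 => <-; rewrite c0 ltxx.
- by move=> t t0 tc; rewrite -c0; apply: bes1_lt => //; lra.
Qed.

(** Intermediate values in the order [s]. As [bder s] decreases in [t], the negative sign at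
    [s = 5 / 2] is computed only for the smallest [t] and the positive sign at [s = 3] only for the
    largest. *)
Lemma bder_root t : 183 / 50 <= t <= T -> exists2 s, 5 / 2 <= s <= 3 & bder s t = 0.
Proof.
move=> /andP[t1 t2].
have d1 : bder (5 / 2) (183 / 50) < 0 :> R.
  rewrite /bder; have hF : bes (5 / 2) (183 / 50) <= 1 - 183 / 50 / 7 * 2 * (1 - 183 / 50 / 9 * (1 - 183 / 50 / 33 * 2 * (1 - 183 / 50 / 26))) :> R.
    apply: le_trans (bes_le_btaylor (N := 4) _ _ _) _; try lra; first by [].
    rewrite le_eqVlt; apply/orP; left; apply/eqP.
    by rewrite /btaylor !big_ord_recr big_ord0 /=; field.
  have hG : 1 - 183 / 50 / 9 * 2 * (1 - 183 / 50 / 11 * (1 - 183 / 50 / 39 * 2)) <= bes (5 / 2 + 1) (183 / 50) :> R.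
    apply: le_trans (bes_ge_btaylor (N := 3) _ _ _); try lra; last by [].
    rewrite le_eqVlt; apply/orP; left; apply/eqP.
    by rewrite /btaylor !big_ord_recr big_ord0 /=; field.
  have -> : 2 * (183 / 50) / (5 / 2 + 1) = 2 * (183 / 50) * 2 / 7 :> R by field.
  by lra.
have d2 : 0 < bder 3 T.
  rewrite /bder; have hF : 1 - T / 4 * (1 - T / 10 * (1 - T / 18)) <= bes 3 T :> R.
    apply: le_trans (bes_ge_btaylor (N := 3) _ _ _); try lra; last by [].
    rewrite le_eqVlt; apply/orP; left; apply/eqP.
    by rewrite /btaylor !big_ord_recr big_ord0 /=; field.
  have hG : bes (3 + 1) T <= 1 - T / 5 * (1 - T / 12) :> R.
    apply: le_trans (bes_le_btaylor (N := 2) _ _ _) _; try lra; first by [].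
    rewrite le_eqVlt; apply/orP; left; apply/eqP.
    by rewrite /btaylor !big_ord_recr big_ord0 /=; field.
  have -> : 2 * T / (3 + 1) = T / 2 :> R by field.
  by lra.
have d1' : bder (5 / 2) t < 0.
  move: t1; rewrite le_eqVlt => /predU1P[<-//|t1].
  by apply: lt_trans d1; apply: bder_mid_lt => //; lra.
have d2' : 0 < bder 3 t.
  move: t2; rewrite le_eqVlt => /predU1P[->//|t2].
  by apply: lt_trans d2 _; apply: bder_mid_lt => //; lra.
have [|||c] := @IVT R (fun s => bder s t) (5 / 2) 3 0; first by lra.
- apply: continuous_in_subspaceT => x; rewrite inE /= in_itv /= => /andP[x1 x2].
  by apply: bder_continuous_order; lra.
- by rewrite ge_min le_max (ltW d1') (ltW d2') orbT.
by rewrite in_itv /= => hc c0; exists c.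
Qed.

(** The number bounded is [J_0(j)], about -0.403. At a zero of [bes 1] contiguity expresses it
    through [bes 2], which is positive and decreasing there. *)
Lemma bes0_root_lower t0 : 183 / 50 < t0 < 92 / 25 -> bes 1 t0 = 0 ->
  - (41 / 100) <= bes 0 t0.
Proof.
move=> /andP[h1 h2] b1.
have -> : bes 0 t0 = - (t0 / 2 * bes 2 t0).
  have := bes_contiguous t0 (lexx 0); rewrite !add0r b1 => ->.
  by rewrite mul1r add0r.
have d2 x : is_derive x (1 : R) (bes 2) (- (2 + 1)^-1 * bes (2 + 1) x) by exact: is_derive_bes.
have hm : bes 2 t0 <= bes 2 (183 / 50).
  apply: (nonincreasing_of_derivative (ltW h1) (fun x _ => d2 x)) => x /andP[x1 x2].
  rewrite mulNr oppr_le0 mulr_ge0// ltW//; apply: bes_mid_gt0; lra.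
have hu : bes 2 (183 / 50) <= 1 - 183 / 50 / 3 * (1 - 183 / 50 / 8 * (1 - 183 / 50 / 15 * (1 - 183 / 50 / 24))) :> R.
  apply: le_trans (bes_le_btaylor (N := 4) _ _ _) _; try lra; first by [].
  rewrite le_eqVlt; apply/orP; left; apply/eqP.
  by rewrite /btaylor !big_ord_recr big_ord0 /=; field.
have b20 : 0 <= bes 2 t0 by apply/ltW/bes2_gt0; lra.
have : t0 / 2 * bes 2 t0 <= 46 / 25 * bes 2 t0 by apply: ler_wpM2r => //; lra.
by lra.
Qed.

(** Each Taylor bound for sine or cosine follows from the preceding one by monotonicity of the
    difference. It is used at [8 / 5], where it shows the cosine to be negative. *)
Lemma cos_le_taylor (x : R) : 0 <= x -> cos x <= 1 - x ^+ 2 / 2 + x ^+ 4 / 24.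
Proof.
have mono (f f' : R -> R) : (forall x, is_derive x (1 : R) f (f' x)) -> f 0 = 0 ->
    (forall x, 0 <= x -> f' x <= 0) -> forall x, 0 <= x -> f x <= 0.
  move=> df f0 hf y y0; rewrite -f0.
  by apply: (nonincreasing_of_derivative y0 (fun z _ => df z)) => z /andP[z0 _]; exact: hf.
have dX n c (y : R) : is_derive y (1 : R) (fun z : R => z ^+ n.+1 / c) (n.+1%:R * y ^+ n / c).
  have h := is_derive_expn n.+1 (is_derive_id y (1 : R)).
  apply: (is_derive_eq (is_derive_mul h (is_derive_const c^-1 y (1 : R)))).
  by rewrite /= mulr0 addr0 mulr1.
have s1 (y : R) : 0 <= y -> sin y - y <= 0.
  apply: (mono (fun y => sin y - y) (fun z => cos z - 1)).
  - by rewrite sin0 subr0.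
  - by move=> z _; rewrite subr_le0 cos_le1.
have c2 (y : R) : 0 <= y -> 1 - y ^+ 2 / 2 - cos y <= 0.
  apply: (mono (fun y => 1 - y ^+ 2 / 2 - cos y) (fun z => sin z - z)).
  - move=> z; apply: (is_derive_eq (is_derive_sub (is_derive_sub (is_derive_const 1 z (1 : R)) (dX 1%N 2 z)) (is_derive_cos z))).
    by rewrite expr1; field.
  - by rewrite cos0 expr0n /=; ring.
  - by move=> z; exact: s1.
have s3 (y : R) : 0 <= y -> y - y ^+ 3 / 6 - sin y <= 0.
  apply: (mono (fun y => y - y ^+ 3 / 6 - sin y) (fun z => 1 - z ^+ 2 / 2 - cos z)).
  - move=> z; apply: (is_derive_eq (is_derive_sub (is_derive_sub (is_derive_id z (1 : R)) (dX 2%N 6 z)) (is_derive_sin z))).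
    by field.
  - by rewrite sin0 expr0n /=; ring.
  - by move=> z; exact: c2.
move=> x0; suff : cos x - (1 - x ^+ 2 / 2 + x ^+ 4 / 24) <= 0 by rewrite subr_le0.
apply: (mono (fun x => cos x - (1 - x ^+ 2 / 2 + x ^+ 4 / 24)) (fun z => z - z ^+ 3 / 6 - sin z)) => //.
- move=> z; have h := is_derive_add (is_derive_sub (is_derive_const 1 z (1 : R)) (dX 1%N 2 z)) (dX 3%N 24 z).
  apply: (is_derive_eq (is_derive_sub (is_derive_cos z) h)).
  by rewrite expr1; field.
- by rewrite cos0 !expr0n /=; ring.
Qed.

Lemma pi_lt_16_5 : pi < 16 / 5 :> R.
Proof.
have h : cos (8 / 5 : R) < 0.
  by apply: le_lt_trans (cos_le_taylor _) _; lra.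
rewrite ltNge; apply: contraTN h => h; rewrite -leNgt.
by apply: cos_ge0_pihalf; apply/andP; split; have := pi_gt0 R; lra.
Qed.

End numerics.

(** * Separated solutions of the inhomogeneous problem *)

Section resolvent.
Context {R : realType}.
Implicit Types (a B r s t : R) (f g A : R -> R).

Lemma bump_smooth lo hi A : bumpfun lo hi A -> smooth1 setT A.
Proof.
have out (x : R) C : bumpfun lo hi C -> ~~ (lo < x < hi) -> is_derive x (1 : R) C 0.
  move=> [_ [a [c [la ch h]]]]; rewrite negb_and -!leNgt => xI.
  have C0 (y : R) : ~~ (a <= y <= c) -> 0 = C y.
    by move=> ny; apply/esym/eqP; apply: contraNT ny => /h.
  have D0 := is_derive_const (0 : R) x (1 : R).
  case/orP: xI => xI.
    apply: (is_derive_near (@open_lt R a) _ _ D0) => /=; first exact: le_lt_trans xI la.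
    by move=> y /= ya; apply: C0; rewrite negb_and -!ltNge ya.
  apply: (is_derive_near (@open_gt R c) _ _ D0) => /=; first exact: lt_le_trans ch xI.
  by move=> y /= ya; apply: C0; rewrite negb_and -!ltNge ya orbT.
move=> bA k; elim: k A bA => [|k IH] A bA.
  move=> x _; have [xI|nx] := boolP (lo < x < hi); first by have [sA _] := bA; exact: (sA 0%N).
  exact: is_derive_continuous (out x A bA nx).
have [A' dA bA'] := bump_derive bA; exists A'; last exact: IH.
move=> x _; have [xI|nx] := boolP (lo < x < hi); first exact: dA.
suff -> : A' x = 0 by exact: out.
have [_ [a [c [la ch h]]]] := bA'.
apply/eqP; apply: contraNT nx => /h /andP[h1 h2].
by rewrite (lt_le_trans la h1) (le_lt_trans h2 ch).
Qed.

Lemma antiderivative_vanishing f a B : 0 < a ->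
  smooth1 (itvoo 0 B) f -> (forall x, 0 < x < a -> f x = 0) ->
  exists2 F, (forall x, itvoo 0 B x -> is_derive x (1 : R) F (f x)) &
    forall x, 0 < x < a -> F x = 0.
Proof.
move=> a0 sf f0; pose c := a / 2.
have c0 : 0 < c by rewrite divr_gt0.
have ca : c < a by rewrite /c; lra.
(* The base point lies where [f] vanishes, so integrability at 0 never matters, and for [x < c] the
   empty integral has the right value 0. *)
pose F x := \int[@lebesgue_measure R]_(y in [set` `[c, x]]) f y.
have F0 x : 0 < x < a -> F x = 0.
  move=> /andP[x0 xa]; rewrite /F /Rintegral integral0_eq// => y; rewrite /= in_itv /= => /andP[cy yx].
  by rewrite f0// (lt_le_trans c0 cy) (le_lt_trans yx xa).
exists F => // x /andP[x0 xB].
have [xa|ax] := ltP x a.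
  rewrite f0 ?x0//; apply: (is_derive_near (@open_itvoo _ 0 a) _ _ (is_derive_const (0 : R) x (1 : R))).
    by rewrite /itvoo /= x0.
  by move=> y; rewrite /itvoo /= => /F0.
have cx := lt_le_trans ca ax.
pose u := (x + B) / 2; have xu : x < u by rewrite /u; lra.
have uB : u < B by rewrite /u; lra.
have fi : (@lebesgue_measure R).-integrable `[c, u] (EFin \o f).
  apply: continuous_compact_integrable; first exact: segment_compact.
  apply: continuous_in_subspaceT => y; rewrite inE /= in_itv /= => /andP[cy yu].
  by apply: (sf 0%N); rewrite /itvoo /= (lt_le_trans c0 cy) (le_lt_trans yu uB).
have cf : {for x, continuous f} by apply: (sf 0%N); rewrite /itvoo /= x0.
have [d1 d2] := continuous_FTC1_closed xu fi cx cf.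
by apply: DeriveDef; [exact: d1|rewrite -derive1E; exact: d2].
Qed.

Lemma bound_near0 g a B c (k : nat) : 0 < a -> 1 < B ->
  (forall x, itvoo 0 B x -> {for x, continuous g}) ->
  (forall x, 0 < x < a -> `|g x| <= c * x ^+ k) ->
  exists2 C, 0 <= C & forall x, 0 < x <= 1 -> `|g x| <= C * x ^+ k.
Proof.
move=> a0 B1 cg hc.
have [|M M0 hM] := @segment_bounded R g a 1.
  by move=> x /andP[ax x1]; apply: cg; rewrite /itvoo /= (lt_le_trans a0 ax) (le_lt_trans x1 B1).
have ak : 0 < a ^+ k by rewrite exprn_gt0.
exists (`|c| + M / a ^+ k); first by rewrite addr_ge0// divr_ge0// ltW.
move=> x /andP[x0 x1]; have xk : 0 <= x ^+ k by rewrite exprn_ge0// ltW.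
rewrite mulrDl; have [xa|ax] := ltP x a.
  have h1 := hc x; rewrite x0 xa in h1.
  have h2 : c * x ^+ k <= `|c| * x ^+ k by rewrite ler_wpM2r// ler_norm.
  have h3 : 0 <= M / a ^+ k * x ^+ k by rewrite mulr_ge0// divr_ge0// ltW.
  by have := h1 isT; lra.
have h1 : `|g x| <= M by apply: hM; rewrite ax.
have h2 : M <= M / a ^+ k * x ^+ k.
  rewrite mulrAC ler_pdivlMr// ler_pM2l//; apply: lerXn2r => //; rewrite nnegrE; exact: ltW.
have h3 : 0 <= `|c| * x ^+ k by rewrite mulr_ge0.
by lra.
Qed.

(* Reduction of order: if [phi] solves [phi'' + phi' / r = V phi], then so does
   [g = phi y] with right-hand side [A], where [r phi^2 y' = z] and
   [z' = r phi A]. *)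
Lemma reduction_of_order (phi phi1 V A : R -> R) (kappa : R -> R) B : 1 < B ->
  smooth1 (itvoo 0 B) phi -> (forall x, itvoo 0 B x -> phi x != 0) ->
  (forall x, itvoo 0 B x -> is_derive x (1 : R) phi (phi1 x)) ->
  (forall x, itvoo 0 B x -> is_derive x (1 : R) phi1 (- (phi1 x / x) + V x * phi x)) ->
  bumpfun 0 1 A ->
  exists a c (g g1 : R -> R) (z : R), 
   [/\ 0 < a < 1, smooth1 (itvoo 0 B) g,
       (forall x, itvoo 0 B x -> is_derive x (1 : R) g (g1 x)),
       (forall x, itvoo 0 B x -> is_derive x (1 : R) g1 (A x - g1 x / x + V x * g x)) &
       [/\ (forall x, 0 < x < a -> [/\ A x = 0, g x = c * phi x & g1 x = c * phi1 x]), g 1 = kappa z * phi 1 &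
         g1 1 = kappa z * phi1 1 + z / phi 1]].
Proof.
move=> B1 sphi phi0 dphi dphi1 bA; have sA := bump_smooth bA.
have [_ [a [b [a0 b1 hab]]]] := bA.
pose a' := Num.min a (1 / 2); have a'0 : 0 < a' by rewrite lt_min a0/=; lra.
have a'1 : a' < 1 by rewrite /a' gt_min; apply/orP; right; lra.
have A0 x : 0 < x < a' -> A x = 0.
  move=> /andP[_ xa]; apply/eqP; apply: contraTT xa => /hab/andP[ax _].
  by rewrite -leNgt ge_min ax.
have sz : smooth1 (itvoo 0 B) (fun x => x * phi x * A x).
  move=> k; apply: Sk_mul; last by apply: Sk_sub (sA k).
  by apply: Sk_mul; [exact: Sk_id|exact: sphi].
have [|z dz z0] := antiderivative_vanishing a'0 sz; first by move=> x /A0 ->; rewrite mulr0.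
have szz : smooth1 (itvoo 0 B) z by exact: smooth1_antiderivative dz sz.
have nz x : itvoo 0 B x -> x * phi x ^+ 2 != 0.
  by move=> Ix; rewrite mulf_neq0 ?expf_neq0 ?phi0//; case/andP: Ix => h _; rewrite gt_eqF.
have sy : smooth1 (itvoo 0 B) (fun x => z x * (x * phi x ^+ 2)^-1).
  move=> k; apply: Sk_mul; first exact: szz.
  apply: Sk_inv => //; apply: Sk_mul; first exact: Sk_id.
  by apply: Sk_expn; exact: sphi.
have [|y0 dy y00] := antiderivative_vanishing a'0 sy; first by move=> x /z0 ->; rewrite mul0r.
have syy : smooth1 (itvoo 0 B) y0 by exact: smooth1_antiderivative dy sy.
have I1 : itvoo 0 B 1 by rewrite /itvoo /= B1 ltr01.
(* The free constant of integration is spent on [y 1 = kappa (z 1)], through which each application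
   imposes its own condition at the arc. *)
pose c := kappa (z 1) - y0 1.
have dyc x : itvoo 0 B x -> is_derive x (1 : R) (fun x => y0 x + c) (z x * (x * phi x ^+ 2)^-1).
  by move=> Ix; apply: (is_derive_eq (is_derive_add (dy x Ix) (is_derive_const c x (1 : R)))); rewrite addr0.
exists a', c, (fun x => phi x * (y0 x + c)), (fun x => phi1 x * (y0 x + c) + z x * (x * phi x)^-1), (z 1); split.
- by rewrite a'0.
- by move=> k; apply: Sk_mul; [exact: sphi|apply: Sk_add; [exact: syy|exact: Sk_cst]].
- move=> x Ix; apply: (is_derive_eq (is_derive_mul (dphi x Ix) (dyc x Ix))).
  have := phi0 x Ix; have /andP[/lt0r_neq0 x0 _] := Ix => p0.
  by field; rewrite x0 p0.
- move=> x Ix; have p0 := phi0 x Ix; have /andP[/lt0r_neq0 x0 _] := Ix.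
  have d1 := is_derive_mul (dphi1 x Ix) (dyc x Ix).
  have d2 := is_derive_inv (f := fun x => x * phi x) (mulf_neq0 x0 p0) (is_derive_mul (is_derive_id x (1 : R)) (dphi x Ix)).
  apply: (is_derive_eq (is_derive_add d1 (is_derive_mul (dz x Ix) d2))).
  by field; rewrite x0 p0.
- split.
  + by move=> x xa; rewrite y00// z0// add0r mul0r addr0; split; [exact: A0|exact: mulrC|exact: mulrC].
  + by rewrite /c addrC subrK mulrC.
  + by rewrite /c [y0 1 + _]addrC subrK mul1r mulrC.
Qed.

(** For [t > 0] a constant multiple of [J_s(2 sqrt(t) r)], hence the radial factor at the spectral
    level [4 * t]; for [t = 0] it is the harmonic factor [r^s]. *)
Definition radial s t r : R := r `^ s * bes s (t * r ^+ 2).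

Definition radial' s t r : R :=
  s * (radial s t r / r) - 2 * t / (s + 1) * (r * r `^ s * bes (s + 1) (t * r ^+ 2)).

Lemma is_derive_bes_sq s t r : 0 <= s ->
  is_derive r (1 : R) (fun r => bes s (t * r ^+ 2)) (- (2 * t / (s + 1)) * r * bes (s + 1) (t * r ^+ 2)).
Proof.
move=> s0; have d := is_derive_scale t (is_derive_expn 2 (is_derive_id r (1 : R))).
apply: (is_derive_eq (is_derive_comp (is_derive_bes _ s0) d)).
by rewrite expr1; field; rewrite gt_eqF// ltr_wpDl.
Qed.

Lemma is_derive_powR_div s r : 0 < r -> is_derive r (1 : R) (fun r => r `^ s) (s * (r `^ s / r)).
Proof.
move=> r0; apply: (is_derive_eq (is_derive1_powR s r0)).
by rewrite powRB ?(gt_eqF r0) ?implybT// powRr1// ltW.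
Qed.

Lemma is_derive_radial s t r : 0 <= s -> 0 < r -> is_derive r (1 : R) (radial s t) (radial' s t r).
Proof.
move=> s0 r0.
apply: (is_derive_eq (is_derive_mul (is_derive_powR_div s r0) (is_derive_bes_sq t r s0))).
by rewrite /radial' /radial; field; rewrite !gt_eqF// ltr_wpDl.
Qed.

Lemma is_derive_radial' s t r : 0 <= s -> 0 < r ->
  is_derive r (1 : R) (radial' s t)
    (- (radial' s t r / r) + (s ^+ 2 / r ^+ 2 - 4 * t) * radial s t r).
Proof.
move=> s0 r0; have s1 : 0 <= s + 1 by rewrite addr_ge0.
have rn : r != 0 by rewrite gt_eqF.
have di := is_derive_inv (f := id) rn (is_derive_id r (1 : R)).
have d1 := is_derive_scale s (is_derive_mul (is_derive_radial t s0 r0) di).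
have d2 := is_derive_mul (is_derive_id r (1 : R)) (is_derive_powR_div s r0).
have d3 := is_derive_scale (2 * t / (s + 1)) (is_derive_mul d2 (is_derive_bes_sq t r s1)).
apply: (is_derive_eq (is_derive_sub d1 d3)).
rewrite /radial' /radial (bes_contiguous _ s0) -[s + 1 + 1]addrA.
by field; rewrite !gt_eqF// ltr_wpDl.
Qed.

Lemma smooth1_radial s t B : 0 <= s -> smooth1 (itvoo 0 B) (radial s t).
Proof.
move=> s0 k; apply: Sk_mul.
  by apply: Sk_sub (Sk_powR s k) => x /andP[].
apply: (@Sk_comp _ _ setT) => //; first exact: Sk_bes.
by apply: Sk_scale; apply: Sk_expn; exact: Sk_id.
Qed.

Lemma bes_sq_le1 s t r : 0 <= s -> 0 <= t -> `|bes s (t * r ^+ 2)| <= 1.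
Proof. by move=> s0 t0; apply: bes_le1 => //; rewrite mulr_ge0// sqr_ge0. Qed.

Lemma powR_le_expn s (k : nat) r : k%:R <= s -> 0 < r <= 1 -> r `^ s <= r ^+ k.
Proof.
move=> ks /andP[r0 r1]; rewrite -(powR_mulrn _ (ltW r0)).
by apply: ger_powR => //; rewrite r0.
Qed.

Lemma radial_bound s t (k : nat) r : 0 <= s -> k%:R <= s -> 0 <= t -> 0 < r <= 1 ->
  `|radial s t r| <= r ^+ k.
Proof.
move=> s0 ks t0 r01; rewrite /radial -[leRHS]mulr1; apply: ler_norm_mul; last exact: bes_sq_le1.
by rewrite ger0_norm ?powR_ge0//; exact: powR_le_expn.
Qed.

Lemma radial'_bound s t (k : nat) r : 0 <= s -> k.+1%:R <= s -> 0 <= t -> 0 < r <= 1 ->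
  `|radial' s t r| <= (s + 2 * t) * r ^+ k.
Proof.
move=> s0 ks t0 /[dup] r01 /andP[r0 r1].
have s1 : 0 <= s + 1 by rewrite addr_ge0.
have h1 : `|radial s t r / r| <= r ^+ k.
  rewrite normrM normfV (gtr0_norm r0) ler_pdivrMr// -exprSr.
  exact: radial_bound.
have h2 : `|r * r `^ s * bes (s + 1) (t * r ^+ 2)| <= r ^+ k.
  rewrite -[leRHS]mulr1; apply: ler_norm_mul; last exact: bes_sq_le1.
  rewrite -[leRHS]mul1r; apply: ler_norm_mul; first by rewrite gtr0_norm.
  rewrite ger0_norm ?powR_ge0//; apply: powR_le_expn => //.
  by apply: le_trans ks; rewrite ler_nat.
have rk : 0 <= r ^+ k by rewrite exprn_ge0// ltW.
have q0 : 0 <= 2 * t / (s + 1) by rewrite divr_ge0// mulr_ge0.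
have q1 : 2 * t / (s + 1) <= 2 * t.
  by rewrite ler_pdivrMr ?ltr_wpDl// ler_peMr ?mulr_ge0// lerDr.
rewrite /radial'; apply: (le_trans (ler_normB _ _)); rewrite [leRHS]mulrDl; apply: lerD.
  by rewrite normrM (ger0_norm s0) ler_wpM2l.
by rewrite normrM (ger0_norm q0); apply: ler_pM.
Qed.

Lemma radial'1 s t : radial' s t 1 = bder s t.
Proof. by rewrite /radial' /radial powR1 !expr1n !mulr1 divr1 !mul1r. Qed.

Lemma flux_bound g1 g2 B C : 1 < B ->
  (forall x, itvoo 0 B x -> is_derive x (1 : R) g1 (g2 x)) -> g1 1 = 0 ->
  (forall x, 0 < x <= 1 -> `|g2 x| <= C) ->
  forall r, 0 < r <= 1 -> `|g1 r| <= C * (1 - r).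
Proof.
move=> B1 dg g0 hC r /andP[r0 r1]; rewrite -normrN -sub0r -g0.
apply: (is_derive_bound r1) => x /andP[rx x1].
  by apply: dg; rewrite /itvoo /= (lt_le_trans r0 rx) (le_lt_trans x1 B1).
by apply: hC; rewrite (lt_le_trans r0 rx).
Qed.

(** Gives room beyond the arc: on [(0, B)] the radial factor still does not vanish, so 1 is an
    interior point and boundary values are ordinary values of smooth functions. *)
Lemma enlarge_radius t tau : 0 <= t -> t < tau -> exists2 B, 1 < B & t * B ^+ 2 <= tau.
Proof.
move=> t0 tt; have T0 := le_lt_trans t0 tt.
have d0 : 0 < (tau - t) / (3 * tau) by rewrite divr_gt0 ?subr_gt0// mulr_gt0.
have d1 : (tau - t) / (3 * tau) <= 1 by rewrite ler_pdivrMr ?mulr_gt0//; lra.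
have E : 3 * tau * ((tau - t) / (3 * tau)) = tau - t by rewrite mulrCA divff ?mulr1// gt_eqF// mulr_gt0.
exists (1 + (tau - t) / (3 * tau)); first by lra.
move: ((tau - t) / (3 * tau)) d0 d1 E => d d0 d1 E.
have h : (1 + d) ^+ 2 <= 1 + 3 * d by nra.
apply: (le_trans (ler_wpM2l t0 h)); nra.
Qed.

Lemma radial_neq0 s t tau B : 0 <= t -> t * B ^+ 2 <= tau ->
  (forall x, 0 <= x <= tau -> bes s x != 0) -> forall r, itvoo 0 B r -> radial s t r != 0.
Proof.
move=> t0 tB h r /andP[r0 rB]; apply: mulf_neq0; first by rewrite gt_eqF// powR_gt0.
apply: h.
rewrite mulr_ge0 ?sqr_ge0//=; apply: le_trans tB; rewrite ler_wpM2l//.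
by apply: lerXn2r; rewrite ?nnegrE ltW// (lt_trans r0).
Qed.

Lemma high_mode_solution s t tau A : 2 <= s -> 0 <= t -> t < tau ->
  (forall x, 0 <= x <= tau -> bes s x != 0) -> bder s t != 0 -> bumpfun 0 1 A ->
  exists f f1 f2 C, [/\ 0 <= C, smooth1 (itvoo 0 1) f,
    (forall r, itvoo 0 1 r -> is_derive r (1 : R) f (f1 r)) /\
    (forall r, itvoo 0 1 r -> is_derive r (1 : R) f1 (f2 r)),
    (forall r, itvoo 0 1 r -> [/\ `|f r| <= C * r ^+ 2, `|f1 r| <= C * r,
       `|f1 r| <= C * (1 - r) & `|f2 r| <= C]) &
    forall r, itvoo 0 1 r ->
      f2 r + r^-1 * f1 r - s ^+ 2 * (r^-2 * f r) + 4 * t * f r = A r].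
Proof.
move=> s2 t0 tt hF hD bA; have s0 : 0 <= s by lra.
have [B B1 tB] := enlarge_radius t0 tt.
have dphi r : itvoo 0 B r -> is_derive r (1 : R) (radial s t) (radial' s t r).
  by move=> /andP[r0 _]; exact: is_derive_radial.
have dphi1 r : itvoo 0 B r -> is_derive r (1 : R) (radial' s t)
    (- (radial' s t r / r) + (s ^+ 2 / r ^+ 2 - 4 * t) * radial s t r).
  by move=> /andP[r0 _]; exact: is_derive_radial'.
have p0 := radial_neq0 t0 tB hF.
(* This [kappa] solves [kappa z * phi1 1 + z / phi 1 = 0], the Neumann condition at the arc. The
   division is possible because [radial' s t 1] is [bder s t], which is nonzero off resonance. *)
have [a [c [f [f1 [z [/andP[a0 a1] sf df df1 [hc h1 h1']]]]]]] :=
  reduction_of_order (fun z => - z / (radial s t 1 * radial' s t 1)) B1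
    (smooth1_radial t B s0) p0 dphi dphi1 bA.
have sub r : itvoo 0 1 r -> itvoo 0 B r by move=> /andP[r0 r1]; rewrite /itvoo /= r0 (lt_trans r1).
have I1 : itvoo 0 B 1 by rewrite /itvoo /= B1 ltr01.
have f10 : f1 1 = 0.
  by rewrite h1' radial'1; have := p0 1 I1 => p1; field; rewrite p1 hD.
have sf1 : smooth1 (itvoo 0 B) f1 by apply: smooth1_deriv df => //; exact: open_itvoo.
pose f2 x := A x - f1 x / x + (s ^+ 2 / x ^+ 2 - 4 * t) * f x.
have sf2 : smooth1 (itvoo 0 B) f2 by apply: (smooth1_deriv _ sf1 df1); exact: open_itvoo.
have xa1 x : 0 < x < a -> 0 < x <= 1 by move=> /andP[-> xa]; rewrite (le_trans (ltW xa) (ltW a1)).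
have [|C0 C00 b0] := @bound_near0 f a B (`|c|) 2 a0 B1 (sf 0%N).
  by move=> x /[dup] /xa1 x1 /hc[_ -> _]; rewrite normrM ler_wpM2l//; exact: radial_bound.
have [|C1 C10 b1] := @bound_near0 f1 a B (`|c| * (s + 2 * t)) 1 a0 B1 (sf1 0%N).
  by move=> x /[dup] /xa1 x1 /hc[_ _ ->]; rewrite normrM -mulrA ler_wpM2l//; exact: radial'_bound.
have [|C2 C20 b2] := @bound_near0 f2 a B (`|c| * (s + 2 * t) + (s ^+ 2 + 4 * t) * `|c|) 0 a0 B1 (sf2 0%N).
  move=> x /[dup] /xa1 /[dup] x1 /andP[x0 x1'] /hc[A0 fx f1x].
  rewrite /f2 A0 fx f1x sub0r expr0 mulr1; apply: ler_norm_add.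
    rewrite normrN normrM normfV (gtr0_norm x0) ler_pdivrMr// normrM -mulrA ler_wpM2l//.
    by rewrite -[X in _ * X]expr1; exact: radial'_bound.
  have -> : (s ^+ 2 / x ^+ 2 - 4 * t) * (c * radial s t x) =
      (s ^+ 2 - 4 * t * x ^+ 2) * (c * (radial s t x / x ^+ 2)) by field; rewrite gt_eqF.
  apply: ler_norm_mul.
    have xx : x ^+ 2 <= 1 by rewrite expr_le1// ltW.
    have xx0 := sqr_ge0 x; have ss0 := sqr_ge0 s.
    have k : 4 * t * x ^+ 2 <= 4 * t by rewrite ler_piMr// mulr_ge0.
    have k0 : 0 <= 4 * t * x ^+ 2 by rewrite mulr_ge0// mulr_ge0.
    by rewrite ler_norml; lra.
  rewrite normrM -[leRHS]mulr1 ler_wpM2l// normrM normfV (ger0_norm (sqr_ge0 x)).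
  by rewrite ler_pdivrMr ?exprn_gt0// mul1r; exact: radial_bound.
have fb : forall r, 0 < r <= 1 -> `|f1 r| <= C2 * (1 - r).
  by apply: (flux_bound B1 df1 f10) => x /b2; rewrite expr0 mulr1.
exists f, f1, f2, (C0 + C1 + C2); split.
- by rewrite !addr_ge0.
- by move=> k; apply: Sk_sub (sf k).
- by split=> r /sub Ir; [exact: df|exact: df1].
- move=> r /andP[r0 r1]; have r01 : 0 < r <= 1 by rewrite r0 ltW.
  have r2 := sqr_ge0 r; have r1' : 0 <= 1 - r by rewrite subr_ge0 ltW.
  split.
  + by apply: (le_trans (b0 r r01)); rewrite ler_wpM2r// -addrA lerDl addr_ge0.
  + by apply: (le_trans (b1 r r01)); rewrite expr1 ler_wpM2r ?(ltW r0)// addrAC lerDr addr_ge0.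
  + by apply: (le_trans (fb r r01)); rewrite ler_wpM2r// lerDr addr_ge0.
  + by apply: (le_trans (b2 r r01)); rewrite expr0 mulr1 lerDr addr_ge0.
- by move=> r /andP[r0 r1]; rewrite /f2; field; rewrite gt_eqF.
Qed.

Lemma radial_antiderivative t : 0 <= t ->
  exists2 H, smooth1 setT H & forall r, 0 < r -> is_derive r (1 : R) H (radial 1 t r).
Proof.
move=> t0; have [->|tn] := eqVneq t 0.
  exists (fun r => 2^-1 * r ^+ 2); first by move=> k; apply: Sk_scale; apply: Sk_expn; exact: Sk_id.
  move=> r r0; apply: (is_derive_eq (is_derive_scale 2^-1 (is_derive_expn 2 (is_derive_id r (1 : R))))).
  by rewrite /radial mul0r bes0// powRr1 ?ltW// expr1; field.
exists (fun r => - (2 * t)^-1 * bes 0 (t * r ^+ 2)).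
  move=> k; apply: Sk_scale; apply: (@Sk_comp _ _ setT) => //; first exact: Sk_bes.
  by apply: Sk_scale; apply: Sk_expn; exact: Sk_id.
move=> r r0; apply: (is_derive_eq (is_derive_scale _ (is_derive_bes_sq t r (lexx 0)))).
by rewrite /radial powRr1 ?ltW// add0r; field.
Qed.

(* The radial equation itself cannot be solved by reduction of order, because
   [bes 0] vanishes in the range of interest. Its derivative is an equation of
   order one for [f1], with a Dirichlet condition at 1. *)
Lemma zero_mode_solution t tau A : 0 <= t -> t < tau ->
  (forall x, 0 <= x <= tau -> bes 1 x != 0) -> bumpfun 0 1 A ->
  exists f f1 f2 C k, [/\ 0 <= C, smooth1 (itvoo 0 1) f,
    (forall r, itvoo 0 1 r -> is_derive r (1 : R) f (f1 r)) /\
    (forall r, itvoo 0 1 r -> is_derive r (1 : R) f1 (f2 r)),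
    (forall r, itvoo 0 1 r -> [/\ `|f1 r| <= C * r,
       `|f1 r| <= C * (1 - r) & `|f2 r| <= C]) &
    forall r, itvoo 0 1 r -> f2 r + r^-1 * f1 r + 4 * t * f r = A r + k].
Proof.
move=> t0 tt hF bA; have s0 : 0 <= 1 :> R by [].
have [B B1 tB] := enlarge_radius t0 tt.
have dphi r : itvoo 0 B r -> is_derive r (1 : R) (radial 1 t) (radial' 1 t r).
  by move=> /andP[r0 _]; exact: is_derive_radial.
have dphi1 r : itvoo 0 B r -> is_derive r (1 : R) (radial' 1 t)
    (- (radial' 1 t r / r) + (1 ^+ 2 / r ^+ 2 - 4 * t) * radial 1 t r).
  by move=> /andP[r0 _]; exact: is_derive_radial'.
have p0 := radial_neq0 t0 tB hF.
have [A' dA bA'] := bump_derive bA.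
have [a [c [g [g1 [z [/andP[a0 a1] sg dg dg1 [hc h1 h1']]]]]]] :=
  reduction_of_order (fun=> 0) B1 (smooth1_radial t B s0) p0 dphi dphi1 bA'.
have sub r : itvoo 0 1 r -> itvoo 0 B r by move=> /andP[r0 r1]; rewrite /itvoo /= r0 (lt_trans r1).
have g10 : g 1 = 0 by rewrite h1 mul0r.
have sg1 : smooth1 (itvoo 0 B) g1 by apply: (smooth1_deriv _ sg dg); exact: open_itvoo.
have xa1 x : 0 < x < a -> 0 < x <= 1 by move=> /andP[-> xa]; rewrite (le_trans (ltW xa) (ltW a1)).
have [|C1 C10 b1] := @bound_near0 g a B (`|c|) 1 a0 B1 (sg 0%N).
  by move=> x /[dup] /xa1 x1 /hc[_ -> _]; rewrite normrM ler_wpM2l//; exact: radial_bound.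
have [|C2 C20 b2] := @bound_near0 g1 a B (`|c| * (1 + 2 * t)) 0 a0 B1 (sg1 0%N).
  by move=> x /[dup] /xa1 x1 /hc[_ _ ->]; rewrite normrM -mulrA ler_wpM2l//; exact: radial'_bound.
have fb : forall r, 0 < r <= 1 -> `|g r| <= C2 * (1 - r).
  by apply: (flux_bound B1 dg g10) => x /b2; rewrite expr0 mulr1.
have [H sH dH] := radial_antiderivative t0.
(* Near 0 the function [g] is [c * radial 1 t], whose primitive [H] is explicit; only the remainder,
   which vanishes near 0, has to be integrated. *)
have [||G dG _] := @antiderivative_vanishing (fun r => g r - c * radial 1 t r) a B a0.
- by move=> k; apply: Sk_sub_fun; [exact: sg|apply: Sk_scale; exact: smooth1_radial].
- by move=> x /hc[_ -> _]; rewrite subrr.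
pose f r := c * H r + G r.
have df r : itvoo 0 B r -> is_derive r (1 : R) f (g r).
  move=> Ir; have /andP[r0 _] := Ir.
  apply: (is_derive_eq (is_derive_add (is_derive_scale c (dH r r0)) (dG r Ir))).
  by rewrite addrC subrK.
(* The equation satisfied by [g] is the derivative of the radial equation for [f], so [W] is
   constant; its value is the undetermined [k]. *)
pose W r := g1 r + r^-1 * g r + 4 * t * f r - A r.
have dW r : itvoo 0 1 r -> is_derive r (1 : R) W 0.
  move=> Ir; have /andP[r0 r1] := Ir; have IB := sub r Ir.
  have di := is_derive_inv (f := id) (lt0r_neq0 r0) (is_derive_id r (1 : R)).
  apply: (is_derive_eq (is_derive_sub (is_derive_add (is_derive_add (dg1 r IB)
    (is_derive_mul di (dg r IB))) (is_derive_scale (4 * t) (df r IB))) (dA r Ir))).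
  by field; rewrite gt_eqF.
exists f, g, g1, (C1 + C2), (W (1 / 2)); split.
- exact: addr_ge0.
- by move=> k; apply: Sk_sub sub _; apply: (smooth1_antiderivative df sg).
- by split=> r /sub Ir; [exact: df|exact: dg].
- move=> r /andP[r0 r1]; have r01 : 0 < r <= 1 by rewrite r0 ltW.
  have r1' : 0 <= 1 - r by rewrite subr_ge0 ltW.
  split.
  + by apply: (le_trans (b1 r r01)); rewrite expr1 ler_wpM2r ?(ltW r0)// lerDl.
  + by apply: (le_trans (fb r r01)); rewrite ler_wpM2r// lerDr.
  + by apply: (le_trans (b2 r r01)); rewrite expr0 mulr1 lerDr.
- move=> r Ir; have -> : W (1 / 2) = W r; last by rewrite /W; ring.
  move: Ir => /andP[r0 r1]; have [rh|hr] := leP r (1 / 2).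
    apply: (is_derive0_eq rh) => x /andP[rx xh]; apply: dW.
    by rewrite /itvoo /= (lt_le_trans r0 rx); lra.
  apply/esym; apply: (is_derive0_eq (ltW hr)) => x /andP[hx xr]; apply: dW.
  by rewrite /itvoo /= (le_lt_trans xr r1) andbT; lra.
Qed.

End resolvent.

(** * Cosine modes as Neumann modes and their resolvents *)

Section modes.
Context {R : realType}.
Variable b : R.
Hypothesis b0 : 0 < b.
Implicit Types (n : nat) (t r C : R) (f A : R -> R).

Definition mode_freq n : R := n%:R * (pi / (2 * b)).

Definition cmode' n t : R := - mode_freq n * sin (mode_freq n * (t + b)).

Lemma cmodeE n t : cmode b n t = cos (mode_freq n * (t + b)).
Proof. by rewrite /cmode /mode_freq !mulrA. Qed.

Lemma is_derive_mode_arg n t : is_derive t (1 : R) (fun t => mode_freq n * (t + b)) (mode_freq n).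
Proof.
apply: (is_derive_eq (is_derive_scale (mode_freq n) (is_derive_add (is_derive_id t (1 : R)) (is_derive_const b t (1 : R))))).
by rewrite addr0 mulr1.
Qed.

Lemma is_derive_cmode n t : is_derive t (1 : R) (cmode b n) (cmode' n t).
Proof.
rewrite (_ : cmode b n = fun t => cos (mode_freq n * (t + b))); last by apply/funext => x; exact: cmodeE.
apply: (is_derive_eq (is_derive_comp (is_derive_cos _) (is_derive_mode_arg n t))).
by rewrite /cmode' mulNr mulrC mulNr.
Qed.

Lemma is_derive_cmode' n t : is_derive t (1 : R) (cmode' n) (- mode_freq n ^+ 2 * cmode b n t).
Proof.
apply: (is_derive_eq (is_derive_scale (- mode_freq n) (is_derive_comp (is_derive_sin _) (is_derive_mode_arg n t)))).
by rewrite cmodeE; ring.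
Qed.

Lemma norm_sin_le (x : R) : 0 <= x -> `|sin x| <= x.
Proof.
move=> x0; have := is_derive_bound (C := 1) x0 (fun y _ => is_derive_sin y).
rewrite sin0 !subr0 mul1r; apply => y _.
by rewrite ler_norml cos_le1 cos_geN1.
Qed.

Lemma mode_freq_ge0 n : 0 <= mode_freq n.
Proof. by rewrite mulr_ge0// divr_ge0 ?pi_ge0// mulr_ge0// ltW. Qed.

Lemma sin_npi_sub n (x : R) : `|sin (n%:R * pi - x)| = `|sin x|.
Proof.
elim: n => [|n IH]; first by rewrite mul0r sub0r sinN normrN.
rewrite -natr1 mulrDl mul1r addrAC -IH.
by rewrite sinD cospi sinpi mulr0 addr0 mulrN1 normrN.
Qed.

(** The sine vanishes at both radii. For [t >= 0] its argument is measured backwards from [n * pi],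
    for [t < 0] forwards from 0, so the distance to the nearer radius appears. *)
Lemma cmode'_bound n t : itvoo (- b) b t -> `|cmode' n t| <= mode_freq n ^+ 2 * (b - `|t|).
Proof.
move=> /andP[t1 t2]; have w0 := mode_freq_ge0 n.
rewrite /cmode' normrM normrN (ger0_norm w0) expr2 -mulrA ler_wpM2l//.
have [tp|tn] := leP 0 t.
  have -> : mode_freq n * (t + b) = n%:R * pi - mode_freq n * (b - t).
    by rewrite /mode_freq; field; rewrite gt_eqF.
  rewrite sin_npi_sub (ger0_norm tp); apply: norm_sin_le.
  by rewrite mulr_ge0// subr_ge0 ltW.
rewrite (ltr0_norm tn) opprK [b + t]addrC; apply: norm_sin_le.
by rewrite mulr_ge0//; lra.
Qed.

Lemma cmode''_bound n t : `|- mode_freq n ^+ 2 * cmode b n t| <= mode_freq n ^+ 2.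
Proof.
rewrite mulNr normrN normrM (ger0_norm (sqr_ge0 _)) ler_piMr ?sqr_ge0//.
exact: cmode_le1.
Qed.

(** Quadratic decay of [f] at the vertex is asked only at nonzero frequency: both angular
    derivatives of the constant mode vanish. *)
Lemma neumann_mode_cmode n f f1 f2 C : 0 <= C -> smooth1 (itvoo 0 1) f ->
  (forall r, itvoo 0 1 r -> is_derive r (1 : R) f (f1 r)) ->
  (forall r, itvoo 0 1 r -> is_derive r (1 : R) f1 (f2 r)) ->
  (forall r, itvoo 0 1 r -> [/\ `|f1 r| <= C * r, `|f1 r| <= C * (1 - r) & `|f2 r| <= C]) ->
  (forall r, itvoo 0 1 r -> mode_freq n != 0 -> `|f r| <= C * r ^+ 2) ->
  exists C', neumann_mode b f f1 f2 (cmode b n) (cmode' n) (fun t => - mode_freq n ^+ 2 * cmode b n t) C'.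
Proof.
move=> C0 sf df df1 h1 h0; set K := mode_freq n ^+ 2; have K0 : 0 <= K := sqr_ge0 _.
have CK : 0 <= C * K by exact: mulr_ge0.
exists (1 + C + C * K); split.
- by split=> //; exact: smooth1_cmode.
- by [].
- by split=> t _; [exact: is_derive_cmode|exact: is_derive_cmode'].
- move=> r Ir; have [a1 a2 a3] := h1 r Ir; have /andP[r0 r1] := Ir.
  have r1' : 0 <= 1 - r by rewrite subr_ge0 ltW.
  split.
  + by apply: (le_trans a1); rewrite ler_wpM2r ?(ltW r0)//; lra.
  + by apply: (le_trans a2); rewrite ler_wpM2r//; lra.
  + by lra.
- move=> r t Ir It; have /andP[r0 r1] := Ir.
  have bt : 0 <= b - `|t| by rewrite subr_ge0 ler_norml; move/andP: It => [? ?]; rewrite !ltW.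
  have r2 : 0 <= r ^+ 2 := sqr_ge0 r.
  split; first by apply: (le_trans (cmode_le1 b n t)); lra.
    have [w0|wn] := eqVneq (mode_freq n) 0.
      rewrite /cmode' w0 oppr0 mul0r mulr0 normr0 mulr_ge0//; first by lra.
      exact: mulr_ge0.
    apply: le_trans (ler_norm_mul (h0 r Ir wn) (cmode'_bound n It)) _.
    rewrite mulrACA -/K ler_wpM2r//; first exact: mulr_ge0.
    by lra.
  have [w0|wn] := eqVneq (mode_freq n) 0.
    have K00 : K = 0 by rewrite /K w0 expr0n.
    by rewrite K00 oppr0 mul0r mulr0 normr0 mulr_ge0//; lra.
  apply: le_trans (ler_norm_mul (h0 r Ir wn) (cmode''_bound n t)) _.
  by rewrite mulrAC -/K ler_wpM2r//; lra.
Qed.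

Lemma high_mode_resolvent n t tau A : 2 <= mode_freq n -> 0 <= t -> t < tau ->
  (forall x, 0 <= x <= tau -> bes (mode_freq n) x != 0) -> bder (mode_freq n) t != 0 ->
  bumpfun 0 1 A ->
  exists f f1 f2 T1 T2 C, neumann_mode b f f1 f2 (cmode b n) T1 T2 C /\
    forall p, wedge b p -> plap f f1 f2 (cmode b n) T2 p +
      4 * t * (f (prad p) * cmode b n (pang p)) = A (prad p) * cmode b n (pang p).
Proof.
move=> s2 t0 tt hF hD bA.
have [f [f1 [f2 [C [C0 sf [df df1] hb E]]]]] := high_mode_solution s2 t0 tt hF hD bA.
have hb1 r : itvoo 0 1 r -> [/\ `|f1 r| <= C * r, `|f1 r| <= C * (1 - r) & `|f2 r| <= C].
  by move=> /hb[].
have hb0 r : itvoo 0 1 r -> mode_freq n != 0 -> `|f r| <= C * r ^+ 2 by move=> /hb[].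
have [C' hm] := neumann_mode_cmode C0 sf df df1 hb1 hb0.
exists f, f1, f2, (cmode' n), (fun t => - mode_freq n ^+ 2 * cmode b n t), C'; split => //.
move=> p [p1 p2 _]; rewrite -E; last by rewrite /itvoo /= prad_gt0.
by rewrite /plap; ring.
Qed.

(** The radial equation is solved only up to the constant [k], which disappears when paired with a
    function of mean zero. *)
Lemma zero_mode_resolvent t tau A : 0 <= t -> t < tau ->
  (forall x, 0 <= x <= tau -> bes 1 x != 0) -> bumpfun 0 1 A ->
  exists f f1 f2 T1 T2 C k, neumann_mode b f f1 f2 (cmode b 0) T1 T2 C /\
    forall p, wedge b p -> plap f f1 f2 (cmode b 0) T2 p +
      4 * t * (f (prad p) * cmode b 0 (pang p)) = A (prad p) * cmode b 0 (pang p) + k.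
Proof.
move=> t0 tt hF bA.
have [f [f1 [f2 [C [k [C0 sf [df df1] hb E]]]]]] := zero_mode_solution t0 tt hF bA.
have w0 : mode_freq 0 = 0 by rewrite /mode_freq mul0r.
have [|C' hm] := @neumann_mode_cmode 0 f f1 f2 C C0 sf df df1 hb.
  by move=> r _; rewrite w0 eqxx.
exists f, f1, f2, (cmode' 0), (fun t => - mode_freq 0 ^+ 2 * cmode b 0 t), C', k; split => //.
move=> p [p1 p2 _].
have -> : cmode b 0 (pang p) = 1 by rewrite cmodeE w0 mul0r cos0.
rewrite [A _ * 1]mulr1 -E; last by rewrite /itvoo /= prad_gt0.
by rewrite /plap w0 cmodeE w0 mul0r cos0; ring.
Qed.

Lemma eigenmode t : 2 <= mode_freq 1 -> 0 <= t -> bder (mode_freq 1) t = 0 ->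
  exists T2 C, neumann_mode b (radial (mode_freq 1) t) (radial' (mode_freq 1) t)
     (fun r => - (radial' (mode_freq 1) t r / r) + (mode_freq 1 ^+ 2 / r ^+ 2 - 4 * t) * radial (mode_freq 1) t r)
     (cmode b 1) (cmode' 1) T2 C /\
    forall p, wedge b p -> plap (radial (mode_freq 1) t) (radial' (mode_freq 1) t)
     (fun r => - (radial' (mode_freq 1) t r / r) + (mode_freq 1 ^+ 2 / r ^+ 2 - 4 * t) * radial (mode_freq 1) t r)
      (cmode b 1) T2 p = - (4 * t) * (radial (mode_freq 1) t (prad p) * cmode b 1 (pang p)).
Proof.
set s := mode_freq 1 => s2 t0 hD; have s0 : 0 <= s by lra.
set f2 := fun r => _.
have b2 r : 0 < r <= 1 -> `|f2 r| <= (s + 2 * t) + (s ^+ 2 + 4 * t).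
  move=> /[dup] x1 /andP[x0 x1'].
  apply: ler_norm_add.
    rewrite normrN normrM normfV (gtr0_norm x0) ler_pdivrMr//.
    by rewrite -[X in _ * X]expr1; exact: radial'_bound.
  have -> : (s ^+ 2 / r ^+ 2 - 4 * t) * radial s t r =
      (s ^+ 2 - 4 * t * r ^+ 2) * (radial s t r / r ^+ 2) by field; rewrite gt_eqF.
  rewrite -[leRHS]mulr1; apply: ler_norm_mul.
    have xx : r ^+ 2 <= 1 by rewrite expr_le1// ltW.
    have xx0 := sqr_ge0 r; have ss0 := sqr_ge0 s.
    have k : 4 * t * r ^+ 2 <= 4 * t by rewrite ler_piMr// mulr_ge0.
    have k0 : 0 <= 4 * t * r ^+ 2 by rewrite mulr_ge0// mulr_ge0.
    by rewrite ler_norml; lra.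
  rewrite normrM normfV (ger0_norm (sqr_ge0 r)) ler_pdivrMr ?exprn_gt0// mul1r.
  exact: radial_bound.
have ss0 := sqr_ge0 s.
have fb : forall r, 0 < r <= 1 -> `|radial' s t r| <= ((s + 2 * t) + (s ^+ 2 + 4 * t)) * (1 - r).
  apply: (@flux_bound R (radial' s t) f2 2 _ _ _ _ b2); first by lra.
    by move=> x /andP[x0 _]; exact: is_derive_radial'.
  by rewrite radial'1.
set C := 1 + (s + 2 * t) + (s ^+ 2 + 4 * t).
have C0 : 0 <= C by rewrite /C; lra.
have df r : itvoo 0 1 r -> is_derive r (1 : R) (radial s t) (radial' s t r).
  by move=> /andP[r0 _]; exact: is_derive_radial.
have df1 r : itvoo 0 1 r -> is_derive r (1 : R) (radial' s t) (f2 r).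
  by move=> /andP[r0 _]; exact: is_derive_radial'.
have hb1 r : itvoo 0 1 r ->
    [/\ `|radial' s t r| <= C * r, `|radial' s t r| <= C * (1 - r) & `|f2 r| <= C].
  move=> /andP[r0 r1]; have r01 : 0 < r <= 1 by rewrite r0 ltW.
  have r1' : 0 <= 1 - r by rewrite subr_ge0 ltW.
  split.
  + have := @radial'_bound R s t 1 r s0 s2 t0 r01; rewrite expr1 => h.
    by apply: (le_trans h); rewrite ler_wpM2r ?(ltW r0)// /C; lra.
  + by apply: (le_trans (fb r r01)); rewrite ler_wpM2r// /C; lra.
  + by apply: (le_trans (b2 r r01)); rewrite /C; lra.
have hb0 r : itvoo 0 1 r -> s != 0 -> `|radial s t r| <= C * r ^+ 2.
  move=> /andP[r0 r1] _; have r01 : 0 < r <= 1 by rewrite r0 ltW.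
  have := @radial_bound R s t 2 r s0 s2 t0 r01 => h.
  by apply: (le_trans h); rewrite ler_peMl ?sqr_ge0// /C; lra.
have [C' hm] := neumann_mode_cmode C0 (smooth1_radial t 1 s0) df df1 hb1 hb0.
exists (fun t => - mode_freq 1 ^+ 2 * cmode b 1 t), C'; split => //.
move=> p [p1 p2 _]; have r0 := prad_gt0 p1.
by rewrite /plap /f2 -/s; field; rewrite gt_eqF.
Qed.

End modes.

(** * The low Neumann spectrum of a sector *)

Lemma Rintegral_eq0 d (T : measurableType d) (R : realType)
  (m : {measure set T -> \bar R}) (D : set T) (f : T -> R) :
  (forall x, D x -> f x = 0) -> \int[m]_(x in D) f x = 0.
Proof. by move=> f0; rewrite /Rintegral integral0_eq// => x /f0 ->. Qed.

Section area_facts.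
Context {R : realType}.
Implicit Types (p : R * R) (U : set (R * R)) (u : R * R -> R).

Lemma open_area_gt0 U p : open U -> U p -> (0 < area R U)%E.
Proof.
move=> oU Up; have := open_nbhs_nbhs (conj oU Up).
move=> [[A B] /= [/nbhs_ballP[e e0 hA] /nbhs_ballP[d d0 hB]] AB].
have mI (x c : R) : measurable (`[x, x + c]%classic : set (measurableTypeR R)) by exact: measurable_itv.
have sub : `[p.1, p.1 + e / 2] `*` `[p.2, p.2 + d / 2] `<=` U.
  move=> q [] /=; rewrite !in_itv /= => /andP[h1 h2] /andP[h3 h4]; apply: AB; split => /=.
    by apply: hA; move: e0; rewrite /ball /= => e0; rewrite ltr_norml; lra.
  by apply: hB; move: d0; rewrite /ball /= => d0; rewrite ltr_norml; lra.
apply: (@lt_le_trans _ _ (area R (`[p.1, p.1 + e / 2] `*` `[p.2, p.2 + d / 2]))).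
  have E := product_measure1E (@lebesgue_measure R) (@lebesgue_measure R)
    (mI p.1 (e / 2)) (mI p.2 (d / 2)).
  apply: (lt_le_trans _ (_ : (_ <= _)%E)); last by rewrite le_eqVlt; apply/orP; left; apply/eqP; exact: (esym E).
  have P (x c : R) : 0 < c -> (0 < @lebesgue_measure R (`[x, (x + c)%R]%classic : set R))%E.
    by move=> c0; rewrite lebesgue_measure_itv /= lte_fin ltrDl c0 -EFinB addrC addKr lte_fin.
  have e2 : 0 < e / 2 by rewrite divr_gt0.
  have d2 : 0 < d / 2 by rewrite divr_gt0.
  by apply: mule_gt0; [exact: (P p.1 _ e2)|exact: (P p.2 _ d2)].
apply: le_measure => //; rewrite inE.
  by apply: measurableX; exact: mI.
exact: open_measurable_plane.
Qed.

Lemma continuous_not_ae_zero U u p : open U -> U p -> {for p, continuous u} ->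
  u p != 0 -> ~ ae_zero U u.
Proof.
move=> oU Up cu u0 [N [mN N0 hN]].
have : nbhs p [set q | U q /\ u q != 0].
  apply: filterI; first exact: open_nbhs_nbhs.
  have nz : nbhs (u p) [set x : R | x != 0].
    by apply: open_nbhs_nbhs; split => //; exact: open_neq.
  exact: (cu _ nz).
rewrite nbhsE => -[V [oV Vp] hV].
suff : (area R V <= 0)%E by rewrite leNgt (open_area_gt0 oV Vp).
apply: (@le_trans _ _ (area R N)); last by rewrite N0.
apply: le_measure; rewrite ?inE //; first exact: open_measurable_plane.
by move=> q Vq; apply: hN => /=; have [Uq uq] := hV q Vq; move=> /(_ Uq)/eqP; rewrite (negbTE uq).
Qed.

Lemma L2_not_ae_zero (D : set (mplane R)) u : measurable D -> L2 (area R) D u ->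
  ~ ae_zero D u -> 0 < \int[area R]_(p in D) (u p ^+ 2).
Proof.
move=> mD [mu iu] nz; rewrite lt_neqAle Rintegral_ge0 ?andbT; last by move=> p _; exact: sqr_ge0.
apply/eqP => h; apply: nz.
have h0 : (\int[area R]_(p in D) `|(u p ^+ 2)%:E| = 0)%E.
  have fin : (\int[area R]_(p in D) `|(u p ^+ 2)%:E|)%E \is a fin_num.
    by apply: integrable_fin_num => //; exact: integrable_norm.
  rewrite -(fineK fin); congr EFin; rewrite [RHS]h.
  by apply: eq_Rintegral => p _; rewrite ger0_norm ?sqr_ge0.
have mE : measurable_fun D (fun p => (u p ^+ 2)%:E).
  by apply/measurable_EFinP; exact: measurable_funX.
have := (ae_eq_integral_abs (area R) mD mE).1 h0.
by apply: filterS => p hp Dp; have [/eqP] := hp Dp; rewrite sqrf_eq0 => /eqP.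
Qed.

Lemma Rintegral_ae_zero (D : set (mplane R)) u : measurable D -> measurable_fun D u ->
  ae_zero D u -> \int[area R]_(p in D) u p = 0.
Proof.
move=> mD mu u0.
have mv : measurable_fun D (fun p => (u p)%:E) by exact/measurable_EFinP.
rewrite /Rintegral (@ae_eq_integral _ _ _ (area R) D (cst 0%E) (fun p => (u p)%:E) mD mv) ?integral0//.
by move: u0 => [N [mN N0 hN]]; exists N; split => // p np; apply: hN => h; apply: np => wp /=; rewrite h.
Qed.

Definition reflect_y p : R * R := (p.1, - p.2).

Lemma reflect_yK : involutive reflect_y.
Proof. by case=> x y; rewrite /reflect_y /= opprK. Qed.

Lemma measurable_reflect_y :
  measurable_fun setT (reflect_y : mplane R -> mplane R).
Proof.
apply: measurable_fun_pair; first exact: measurable_fst.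
by apply: (@measurableT_comp _ _ _ _ _ _ (-%R : measurableTypeR R -> measurableTypeR R)); [exact: oppr_measurable|exact: measurable_snd].
Qed.

Lemma area_reflect_y (E : set (mplane R)) : measurable E ->
  pushforward (area R) (reflect_y : mplane R -> mplane R) E = area R E.
Proof.
pose f : {mfun mplane R >-> mplane R} := HB.pack (reflect_y : mplane R -> mplane R)
  (isMeasurableFun.Build _ _ _ _ _ measurable_reflect_y).
move=> mE; apply/esym; apply: (product_measure_unique (m' := pushforward (area R) f)) => // A B mA mB.
have mB' : measurable ((-%R : measurableTypeR R -> measurableTypeR R) @^-1` B).
  by rewrite -[X in measurable X]setTI; exact: oppr_measurable.
rewrite -[X in (_ * X)%E](lebesgue_measureN mB).
exact: (product_measure1E _ _ mA mB').
Qed.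

Section reflected.
Variables (D : set (mplane R)) (mD : measurable D).
Hypothesis symD : forall p, D p -> D (reflect_y p).

Let preD : (reflect_y : mplane R -> mplane R) @^-1` D = D.
Proof. by apply/seteqP; split => p /symD //; rewrite /= reflect_yK. Qed.

Lemma integral_reflect_y (w : mplane R -> \bar R) : 
  measurable_fun D w -> (forall p, D p -> 0 <= w p)%E ->
  (\int[area R]_(p in D) w (reflect_y p) = \int[area R]_(p in D) w p)%E.
Proof.
move=> mw w0.
have := @ge0_integral_pushforward _ _ _ _ R _ measurable_reflect_y (area R) D w mD mw.
rewrite preD => h; apply: etrans (esym (h _)) _.
  by move=> p /set_mem; exact: w0.
apply: eq_measure_integral; first exact: measurable_reflect_y.
by move=> ? A mA _; exact: (area_reflect_y mA).
Qed.

Lemma rint_reflect_y u : rint (area R) D u ->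
  rint (area R) D (fun p => u (reflect_y p)) /\
  \int[area R]_(p in D) u (reflect_y p) = \int[area R]_(p in D) u p.
Proof.
move=> iu; have mu := rint_mfun iu.
have mE : measurable_fun D (fun p => (u p)%:E) by exact/measurable_EFinP.
have mE' : measurable_fun D (fun p => (u (reflect_y p))%:E).
  apply/measurable_EFinP; apply: (measurable_comp mD _ mu).
    by move=> _ [p Dp <-]; exact: symD.
  exact: (measurable_funS measurableT (@subsetT _ D) measurable_reflect_y).
split.
  apply/integrableP; split => //.
  rewrite (integral_reflect_y (w := fun p => `|(u p)%:E|%E)) //; last by exact: measurableT_comp.
  by move/integrableP : iu => [].
rewrite /Rintegral; congr fine; rewrite integralE [in RHS]integralE; congr (_ - _)%E.
  have h := @integral_reflect_y _ (measurable_funepos mE) (fun p _ => funepos_ge0 _ p).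
  by apply: (etrans _ h); apply: eq_integral => p _; rewrite !funeposE.
have h := @integral_reflect_y _ (measurable_funeneg mE) (fun p _ => funeneg_ge0 _ p).
by apply: (etrans _ h); apply: eq_integral => p _; rewrite !funenegE.
Qed.

End reflected.

End area_facts.

(** * Eigenfunctions of the wedge as weak solutions *)

Section spectrum.
Context {R : realType}.
Variables (b : R) (b0 : 0 < b) (b_pi2 : b <= pi / 2).
Notation W := (wedge b).
Implicit Types (u v : R * R -> R) (p : R * R) (t la : R).

Let mW := @measurable_wedge R b.
Let Woo := @area_wedge_lty R b.

Lemma mode_H1 f f1 f2 T T1 T2 C : neumann_mode b f f1 f2 T T1 T2 C ->
  H1 W (fun p => f (prad p) * T (pang p)) (pgrad f f1 T T1) /\
  exists C', forall p, W p -> `|f (prad p) * T (pang p)| <= C'.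
Proof.
move=> hm; have [[sf sT] [df df1] [dT dT1] hf hT] := hm.
have sf1 := smooth1_deriv (@open_itvoo _ _ _) sf df.
have sT1 := smooth1_deriv (@open_itvoo _ _ _) sT dT.
(* [neumann_mode] does not bound [f] itself; the bound on [f1] gives one by comparison with the
   value at [1 / 2]. *)
have fb r : itvoo 0 1 r -> `|f r| <= `|f (1 / 2)| + `|C|.
  move=> /andP[r0 r1]; have Cx x : itvoo 0 1 x -> `|f1 x| <= `|C|.
    move=> Ix; have [h _ _] := hf x Ix; have /andP[x0 x1] := Ix.
    apply: (le_trans h); apply: (@le_trans _ _ (`|C| * x)); first by rewrite ler_wpM2r ?ler_norm// ltW.
    by rewrite ler_piMr// ltW.
  have key x y : itvoo 0 1 x -> itvoo 0 1 y -> x <= y -> `|f y - f x| <= `|C|.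
    move=> /andP[x0 x1] /andP[y0 y1] xy.
    apply: (@le_trans _ _ (`|C| * (y - x))); last by rewrite ler_piMr//; lra.
    apply: (is_derive_bound xy) => z /andP[xz zy].
      by apply: df; rewrite /itvoo /= (lt_le_trans x0 xz) (le_lt_trans zy y1).
    by apply: Cx; rewrite /itvoo /= (lt_le_trans x0 xz) (le_lt_trans zy y1).
  have Ih : itvoo 0 1 (1 / 2 : R) by rewrite /itvoo /=; lra.
  have Ir : itvoo 0 1 r by rewrite /itvoo /= r0.
  have : `|f r - f (1 / 2)| <= `|C|.
    by have [rh|/ltW hr] := leP r (1 / 2); [rewrite distrC; exact: key|exact: key].
  by have := ler_normD (f (1 / 2)) (f r - f (1 / 2)); rewrite addrC subrK; lra.
have wb p : W p -> `|f (prad p) * T (pang p)| <= (`|f (1 / 2)| + `|C|) * C.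
  by move=> /wedgeP[_ hr ht]; apply: ler_norm_mul; [exact: fb|have [] := hT _ _ hr ht].
split; last by exists ((`|f (1 / 2)| + `|C|) * C).
have r0 p : W p -> prad p != 0 by move=> /wedgeP[_ /andP[r0 _] _]; rewrite gt_eqF.
apply: (@classical_H1 R W (@open_wedge R b) _ _ (`|(`|f (1 / 2)| + `|C|) * C| + (C * C + C * b)) Woo).
- move=> p wp; have [p0 hr ht] := wedgeP wp.
  apply: (is_derive_eq (is_derive_prad_pang ((1, 0) : R * R) p0 (df _ hr) (dT _ ht))).
  by rewrite /pgrad /=; field; exact: r0.
- move=> p wp; have [p0 hr ht] := wedgeP wp.
  apply: (is_derive_eq (is_derive_prad_pang ((0, 1) : R * R) p0 (df _ hr) (dT _ ht))).
  by rewrite /pgrad /=; field; exact: r0.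
- have contM (k l : R * R -> R) q : {for q, continuous k} -> {for q, continuous l} ->
      {for q, continuous (fun q => k q * l q)} by exact: cvgM.
  have contD (k l : R * R -> R) q : {for q, continuous k} -> {for q, continuous l} ->
      {for q, continuous (fun q => k q + l q)} by exact: cvgD.
  have contB (k l : R * R -> R) q : {for q, continuous k} -> {for q, continuous l} ->
      {for q, continuous (fun q => k q - l q)} by exact: cvgB.
  move=> p wp.
  have c0 : {for p, continuous (fun q => f (prad q))} by refine (prad_comp_continuous wp sf).
  have c1 : {for p, continuous (fun q => f1 (prad q))} by refine (prad_comp_continuous wp sf1).
  have c2 : {for p, continuous (fun q => T (pang q))} by refine (pang_comp_continuous wp sT).
  have c3 : {for p, continuous (fun q => T1 (pang q))} by refine (pang_comp_continuous wp sT1).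
  have c4 : {for p, continuous (fun q => cos (pang q))} by refine (pang_comp_continuous wp (fun k => (Sk_cos_sin k _).1)).
  have c5 : {for p, continuous (fun q => sin (pang q))} by refine (pang_comp_continuous wp (fun k => (Sk_cos_sin k _).2)).
  have c6 : {for p, continuous (fun q => (prad q)^-1)} by refine (prad_comp_continuous wp smooth1_rV).
  split; first by apply: cvgM; [exact: c0|exact: c2].
  + refine (contB _ _ _ (contM _ _ _ c1 (contM _ _ _ c4 c2)) (contM _ _ _ (contM _ _ _ c6 c0) (contM _ _ _ c5 c3))).
  + refine (contD _ _ _ (contM _ _ _ c1 (contM _ _ _ c5 c2)) (contM _ _ _ (contM _ _ _ c6 c0) (contM _ _ _ c4 c3))).
- move=> p wp; have hb := pgrad_bound hm wp.
  have nn1 (x y z : R) : `|z| <= 1 -> `|x * (z * y)| <= `|x| * `|y|.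
    by move=> z1; rewrite !normrM ler_wpM2l// ler_piMl.
  have c1 : `|cos (pang p)| <= 1 by rewrite ler_norml cos_geN1 cos_le1.
  have s1 : `|sin (pang p)| <= 1 by rewrite ler_norml sin_geN1 sin_le1.
  have K := normr_ge0 ((`|f (1 / 2)| + `|C|) * C).
  split.
  + apply: (le_trans (wb p wp)); apply: (le_trans (ler_norm _)); rewrite lerDl.
    by apply: le_trans hb; rewrite addr_ge0 ?mulr_ge0.
  + rewrite /pgrad /=; apply: (le_trans (ler_normB _ _)).
    have := nn1 (f1 (prad p)) (T (pang p)) _ c1; have := nn1 ((prad p)^-1 * f (prad p)) (T1 (pang p)) _ s1.
    by lra.
  + rewrite /pgrad /=; apply: (le_trans (ler_normD _ _)).
    have := nn1 (f1 (prad p)) (T (pang p)) _ s1; have := nn1 ((prad p)^-1 * f (prad p)) (T1 (pang p)) _ c1.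
    by lra.
Qed.

Lemma const_H1 (c : R) : H1 W (fun=> c) (fun=> (0, 0)).
Proof.
apply: (@classical_H1 R W (@open_wedge R b) _ _ `|c| Woo).
- by move=> p _; split; exact: cst_continuous.
- by move=> p _ /=; rewrite normr0.
Qed.

Lemma wedge_half : W (1 / 2, 0).
Proof.
have -> : ((1 / 2, 0) : R * R) = polar (1 / 2) 0 by rewrite /polar cos0 sin0 mulr1 mulr0.
have h : 0 <= 1 / 2 :> R by lra.
split; first by rewrite /= cos0; lra.
  by rewrite prad_polar//; lra.
by rewrite pang_polar ?normr0//; have := pi_gt0 R; lra.
Qed.

Lemma eigen_const (c : R) : c != 0 -> neumann_eigenfunction W 0 (fun=> c).
Proof.
move=> c0; split.
  apply: (continuous_not_ae_zero (@open_wedge R b) wedge_half) => //.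
  exact: cst_continuous.
exists (fun=> (0, 0)); first exact: const_H1.
move=> v h _; rewrite mul0r.
by apply: Rintegral_eq0 => p _; rewrite /dot /= !mul0r addr0.
Qed.

(* [v] is orthogonal to the range of [Laplacian + la] on separated functions,
   and to constants. *)
Definition weak_solution la v := [/\ rint (area R) W v, \int[area R]_(p in W) v p = 0 &
  forall f f1 f2 T T1 T2 C, neumann_mode b f f1 f2 T T1 T2 C ->
    rint (area R) W (fun p => v p * (plap f f1 f2 T T2 p + la * (f (prad p) * T (pang p)))) /\
    \int[area R]_(p in W) (v p * (plap f f1 f2 T T2 p + la * (f (prad p) * T (pang p)))) = 0].

(** The mode itself is an admissible test function in the eigenvalue identity, and Green's formula
    rewrites the gradient pairing. *)
Lemma eigen_weak la u : neumann_eigenfunction W la u ->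
  forall f f1 f2 T T1 T2 C, neumann_mode b f f1 f2 T T1 T2 C ->
    rint (area R) W (fun p => u p * (plap f f1 f2 T T2 p + la * (f (prad p) * T (pang p)))) /\
    \int[area R]_(p in W) (u p * (plap f f1 f2 T T2 p + la * (f (prad p) * T (pang p)))) = 0.
Proof.
move=> [_ [g Hu he]] f f1 f2 T T1 T2 C hm.
have [Hw [C' hC']] := mode_H1 hm.
have [i1 i2 E] := green b_pi2 hm Hu.
have Lu : L2 (area R) W u by case: Hu.
have Lw : L2 (area R) W (fun p => f (prad p) * T (pang p)) by case: Hw.
have i3 := L2_mul mW Lu Lw.
have EE p : u p * (plap f f1 f2 T T2 p + la * (f (prad p) * T (pang p))) =
  u p * plap f f1 f2 T T2 p + la * (u p * (f (prad p) * T (pang p))) by ring.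
rewrite (funext EE); split; first by apply: (rintD mW i1); exact: (rintZ mW).
rewrite (RintD mW i1 (rintZ mW la i3)) (RintZ mW)// -(he _ _ Hw) E.
by rewrite addrN.
Qed.

Lemma eigen_mean0 la u : neumann_eigenfunction W la u -> la != 0 ->
  \int[area R]_(p in W) u p = 0.
Proof.
move=> [_ [g Hu he]] la0; have := he _ _ (const_H1 1).
have -> : \int[area R]_(p in W) dot (g p) (0, 0) = 0.
  by apply: Rintegral_eq0 => p _; rewrite /dot /= !mulr0 addr0.
move/esym/eqP; rewrite mulf_eq0 (negbTE la0) /= => /eqP <-.
by apply: eq_Rintegral => p _; rewrite mulr1.
Qed.

Lemma eigen_ge0 la u : neumann_eigenfunction W la u -> 0 <= la.
Proof.
move=> [nz [g Hu he]]; have Lu : L2 (area R) W u by case: Hu.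
have u2 := L2_not_ae_zero mW Lu nz.
have := he _ _ Hu; rewrite (_ : \int[area R]_(p in W) (u p * u p) = \int[area R]_(p in W) (u p ^+ 2)); last first.
  by apply: eq_Rintegral => p _; rewrite expr2.
move=> E; rewrite -(pmulr_lge0 _ u2) -E; apply: Rintegral_ge0 => p _.
by rewrite /dot addr_ge0// -expr2 sqr_ge0.
Qed.

Lemma area_wedge_neq0 : \int[area R]_(p in W) (1 : R) != 0.
Proof.
rewrite Rintegral_cst// mul1r gt_eqF// fine_gt0// Woo andbT.
exact: (open_area_gt0 (@open_wedge R b) wedge_half).
Qed.

Lemma rint_const (c : R) : rint (area R) W (fun=> c).
Proof. by apply: (rint_bounded mW (C := `|c|) Woo). Qed.

Definition mean u := (\int[area R]_(p in W) u p) / (\int[area R]_(p in W) (1 : R)).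

(** For [la != 0] the mean vanishes already. For [la = 0] constants are eigenfunctions too, so
    subtracting the mean preserves the orthogonality. *)
Lemma eigen_weak_solution la u : neumann_eigenfunction W la u ->
  weak_solution la (fun p => u p - mean u).
Proof.
move=> hu; have hw := eigen_weak hu.
have iu : rint (area R) W u by case: hu => _ [g [Lu _ _ _] _]; exact: L2_rint.
have ic := rint_const (mean u).
split; first exact: (rintB mW).
  rewrite (RintB mW iu ic) /mean.
  rewrite (_ : \int[area R]_(p in W) (_ / _) = mean u * \int[area R]_(p in W) (1 : R)); last first.
    rewrite -(RintZ mW _ (rint_const 1)); apply: eq_Rintegral => p _.
    by rewrite mulr1.
  by rewrite /mean divfK ?subrr//; exact: area_wedge_neq0.
move=> f f1 f2 T T1 T2 C hm; have [i1 e1] := hw _ _ _ _ _ _ _ hm.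
have [i2 e2] := eigen_weak (eigen_const (oner_neq0 R)) hm.
have [la0|la0] := eqVneq la 0; last first.
  have m0 : mean u = 0 by rewrite /mean (eigen_mean0 hu la0) mul0r.
  have EE p : (u p - mean u) * (plap f f1 f2 T T2 p + la * (f (prad p) * T (pang p))) =
      u p * (plap f f1 f2 T T2 p + la * (f (prad p) * T (pang p))) by rewrite m0 subr0.
  by rewrite (funext EE).
rewrite la0 in i1 e1 *.
have EE p : (u p - mean u) * (plap f f1 f2 T T2 p + 0 * (f (prad p) * T (pang p))) =
  u p * (plap f f1 f2 T T2 p + 0 * (f (prad p) * T (pang p))) -
  mean u * (1 * (plap f f1 f2 T T2 p + 0 * (f (prad p) * T (pang p)))) by ring.
rewrite (funext EE); split; first by apply: (rintB mW i1); exact: (rintZ mW).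
by rewrite (RintB mW i1 (rintZ mW _ i2)) (RintZ mW _ i2) e1 e2 mulr0 subr0.
Qed.

Lemma weak_mode0 t tau v A : weak_solution (4 * t) v -> 0 <= t -> t < tau ->
  (forall x, 0 <= x <= tau -> bes 1 x != 0) -> bumpfun 0 1 A ->
  \int[area R]_(p in W) (v p * (A (prad p) * cmode b 0 (pang p))) = 0.
Proof.
move=> [iv v0 hv] t0 tt hF bA.
have [f [f1 [f2 [T1 [T2 [C [k [hm E]]]]]]]] := zero_mode_resolvent b0 t0 tt hF bA.
have [i1 e1] := hv _ _ _ _ _ _ _ hm.
transitivity (\int[area R]_(p in W) (v p * (plap f f1 f2 (cmode b 0) T2 p + 4 * t * (f (prad p) * cmode b 0 (pang p))) - k * v p)).
  by apply: eq_Rintegral => p /set_mem wp; rewrite (E p wp); ring.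
by rewrite (RintB mW i1 (rintZ mW k iv)) (RintZ mW k iv) e1 v0 mulr0 subr0.
Qed.

Lemma weak_mode_high n t tau v A : weak_solution (4 * t) v ->
  2 <= mode_freq b n -> 0 <= t -> t < tau ->
  (forall x, 0 <= x <= tau -> bes (mode_freq b n) x != 0) -> bder (mode_freq b n) t != 0 ->
  bumpfun 0 1 A ->
  \int[area R]_(p in W) (v p * (A (prad p) * cmode b n (pang p))) = 0.
Proof.
move=> [iv v0 hv] s2 t0 tt hF hD bA.
have [f [f1 [f2 [T1 [T2 [C [hm E]]]]]]] := high_mode_resolvent b0 s2 t0 tt hF hD bA.
have [i1 <-] := hv _ _ _ _ _ _ _ hm.
by apply: eq_Rintegral => p /set_mem wp; rewrite (E p wp).
Qed.

Lemma wedge_reflect_y p : W p -> W (reflect_y p).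
Proof.
move=> [p0 r1 t1]; have r2 : prad (reflect_y p) = prad p by rewrite /prad /= sqrrN.
split; [exact: p0|by rewrite r2|].
by rewrite /pang /= mulNr atanN normrN.
Qed.

Lemma prad_reflect_y p : prad (reflect_y p) = prad p.
Proof. by rewrite /prad /= sqrrN. Qed.

Lemma pang_reflect_y p : pang (reflect_y p) = - pang p.
Proof. by rewrite /pang /= mulNr atanN. Qed.

Lemma cos_npi_sub n (x : R) : cos (n%:R * pi - x) = (-1) ^+ n * cos x.
Proof.
elim: n => [|n IH]; first by rewrite mul0r sub0r cosN mul1r.
rewrite -natr1 mulrDl mul1r addrAC cosD cospi sinpi mulr0 subr0 IH exprS.
by ring.
Qed.

Lemma cmode_opp n t : cmode b n (- t) = (-1) ^+ n * cmode b n t.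
Proof.
rewrite !cmodeE -cos_npi_sub; congr cos; rewrite /mode_freq; field.
by rewrite gt_eqF.
Qed.

Section at_eigenvalue.
(** [4 * ts] is the candidate for the second eigenvalue; in the application [4 * t0] is the first
    radial level. *)
Variables (nu ts t0 : R).
Hypothesis nuE : nu = mode_freq b 1.
Hypothesis nu_itv : 5 / 2 <= nu <= 3.
Hypothesis ts_itv : 0 < ts < t0.
Hypothesis t0_le : t0 < 369 / 100.
Hypothesis nu_ts : bder nu ts = 0.
Hypothesis bes1_gt0 : forall t, 0 <= t -> t < t0 -> 0 < bes 1 t.

Let neq0 (x : R) : 0 < x -> x != 0. Proof. exact: lt0r_neq0. Qed.

Let mode_freqE n : mode_freq b n = n%:R * nu.
Proof. by rewrite nuE /mode_freq mul1r. Qed.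

(** Nonresonance in three ranges: for [n = 0] because [bes 1] is positive below [t0]; for [n = 1]
    because [bder nu] decreases strictly to its zero [ts], which forces [t < ts]; for [n >= 2]
    because the frequency is at least 5. *)
Lemma weak_modes t v n A : weak_solution (4 * t) v -> 0 <= t -> t <= ts ->
  (n = 1%N -> t < ts) -> bumpfun 0 1 A ->
  \int[area R]_(p in W) (v p * (A (prad p) * cmode b n (pang p))) = 0.
Proof.
move=> hv t0' tts n1 bA; move: ts_itv => /andP[ts0 tst0].
have /andP[nu1 nu2] := nu_itv.
have th : t < 369 / 100 := le_lt_trans tts (lt_trans tst0 t0_le).
case: n n1 => [_|[|n] n1].
- have tt : t < (t + t0) / 2 by lra.
  apply: (weak_mode0 hv t0' tt _ bA) => x /andP[x0 xt]; apply: neq0; apply: bes1_gt0 => //.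
  by lra.
- have tlt := n1 erefl.
  apply: (weak_mode_high hv _ t0' th _ _ bA); rewrite -nuE; first by lra.
    by move=> x hx; apply: neq0; exact: bes_mid_gt0.
  apply: neq0; rewrite -nu_ts; apply: bder_mid_lt => //.
  exact: ltW (lt_trans tst0 t0_le).
- have h5 : 5 <= mode_freq b n.+2.
    rewrite mode_freqE; have n2 : 2 <= n.+2%:R :> R by rewrite ler_nat.
    apply: (@le_trans _ _ (2 * nu)); first by lra.
    by rewrite ler_wpM2r//; lra.
  apply: (weak_mode_high hv _ t0' th _ _ bA); first by lra.
    by move=> x hx; apply: neq0; have [] := bes_high h5 hx.
  have [|_ h] := @bes_high R _ t h5; last exact: neq0.
  by rewrite t0' ltW.
Qed.

Lemma low_eigenfunction_const la u : neumann_eigenfunction W la u -> la < 4 * ts ->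
  ae_zero W (fun p => u p - mean u).
Proof.
move=> hu lt4; have la0 := eigen_ge0 hu; have hw := eigen_weak_solution hu.
have E : la = 4 * (la / 4) by field.
rewrite E in hw.
apply: (completeness b0); first by case: hw.
move=> n A bA; apply: (weak_modes hw _ _ _ bA); first by lra.
  by lra.
by move=> _; lra.
Qed.

(* The even part of [u] has no odd cosine coefficient by symmetry, and the even
   modes are not resonant. *)
Lemma eigenfunction_odd u : neumann_eigenfunction W (4 * ts) u -> odd_in_y W u.
Proof.
move=> hu; have hw := eigen_weak_solution hu; move: ts_itv => /andP[ts0 _].
have m0 : mean u = 0 by rewrite /mean (eigen_mean0 hu) ?mul0r//; apply: neq0; lra.
have um : (fun p => u p - mean u) = u by apply/funext => p; rewrite m0 subr0.
rewrite um in hw; have [iu _ _] := hw.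
have [iu' _] := rint_reflect_y mW wedge_reflect_y iu.
suff h : ae_zero W (fun p => u p + u (reflect_y p)).
  move: h => [N [mN N0 hN]]; exists N; split => // p np; apply: hN => h; apply: np => wp.
  by have /eqP := h wp; rewrite addrC addr_eq0 => /eqP.
apply: (completeness b0); first exact: (rintD mW).
move=> n A bA.
have [C _ hC] := bump_bounded bA.
have mF : measurable_fun (W : set (mplane R)) (fun p : mplane R => A (prad p) * cmode b n (pang p)).
  by apply: prad_pang_mfun; [exact: bA.1|exact: smooth1_cmode].
have bF p : W p -> `|A (prad p) * cmode b n (pang p)| <= C * 1.
  by move=> _; apply: ler_norm_mul; [exact: hC|exact: cmode_le1].
have i1 := rint_mulbounded mW iu mF bF.
have i2 := rint_mulbounded mW iu' mF bF.
rewrite (_ : \int[area R]_(p in W) _ = \int[area R]_(p in W) (u p * (A (prad p) * cmode b n (pang p)) +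
   u (reflect_y p) * (A (prad p) * cmode b n (pang p)))); last first.
  by apply: eq_Rintegral => p _; rewrite mulrDl.
rewrite (RintD mW i1 i2).
have [i3] := rint_reflect_y mW wedge_reflect_y i1.
have -> : \int[area R]_(p in W) (u (reflect_y p) * (A (prad (reflect_y p)) * cmode b n (pang (reflect_y p)))) =
    \int[area R]_(p in W) ((-1) ^+ n * (u (reflect_y p) * (A (prad p) * cmode b n (pang p)))).
  by apply: eq_Rintegral => p _; rewrite prad_reflect_y pang_reflect_y cmode_opp; ring.
rewrite (RintZ mW _ i2) => eqJ.
(* For [n = 1] the sign of the reflected mode makes the two integrals cancel; every other mode is
   nonresonant at [ts], so both integrals vanish. *)
have [n1|n1] := eqVneq n 1%N; first by rewrite -eqJ n1 expr1 mulN1r addNr.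
have h : \int[area R]_(p in W) (u p * (A (prad p) * cmode b n (pang p))) = 0.
  by apply: (weak_modes hw) => //; [exact: ltW|move=> E; rewrite E in n1].
by move/eqP: eqJ; rewrite h add0r mulf_eq0 signr_eq0 => /eqP.
Qed.

Let oddmode p := radial nu ts (prad p) * cmode b 1 (pang p).

Lemma oddmode_eigenfunction : neumann_eigenfunction W (4 * ts) oddmode.
Proof.
have /andP[nu1 nu2] := nu_itv; have /andP[ts0 tst0] := ts_itv.
have h2 : 2 <= mode_freq b 1 by rewrite -nuE; lra.
have hD : bder (mode_freq b 1) ts = 0 by rewrite -nuE.
have [T2 [C [hm E]]] := eigenmode b0 h2 (ltW ts0) hD.
rewrite -nuE in hm E.
have [Hw [C' hC']] := mode_H1 hm.
split.
  (* Halfway between the axis and the lower radius the argument of the cosine is [pi / 4], so the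
     mode does not vanish there. *)
  pose p := polar (1 / 2) (- (b / 2)) : R * R.
  have r0 : 0 <= 1 / 2 :> R by lra.
  have hp := pi_gt0 R; have b0' := b0; have bp := b_pi2.
  have tb : `|- (b / 2)| < pi / 2 by rewrite normrN ger0_norm; lra.
  have wp : W p.
    split; rewrite /p.
    - by rewrite /= mulr_gt0 ?cos_gt0_pihalf//; lra.
    - by rewrite prad_polar//; lra.
    - by rewrite pang_polar//; [rewrite normrN ger0_norm|]; lra.
  have [[sf sT] [df df1] [dT dT1] _ _] := hm.
  apply: (continuous_not_ae_zero (@open_wedge R b) wp).
    apply: cvgM; first by refine (prad_comp_continuous wp sf).
    by refine (pang_comp_continuous wp sT).
  rewrite /oddmode /p prad_polar// pang_polar//; last by lra.
  apply: mulf_neq0.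
    apply: mulf_neq0; apply: neq0; first by apply: powR_gt0; lra.
    by apply: bes_mid_gt0 => //; have := t0_le; rewrite expr2; lra.
  rewrite cmodeE; apply: neq0; apply: cos_gt0_pihalf.
  have -> : mode_freq b 1 * (- (b / 2) + b) = pi / 4 by rewrite /mode_freq; field; rewrite gt_eqF.
  lra.
exists (pgrad (radial nu ts) (radial' nu ts) (cmode b 1) (cmode' b 1)) => // v h Hv.
have [i1 i2 G] := green b_pi2 hm Hv.
have Lv : L2 (area R) W v by case: Hv.
have Lu : L2 (area R) W oddmode by case: Hw.
transitivity (\int[area R]_(p in W) dot (h p) (pgrad (radial nu ts) (radial' nu ts) (cmode b 1) (cmode' b 1) p)).
  by apply: eq_Rintegral => p _; rewrite /dot; ring.
rewrite G -(RintZ mW _ (L2_mul mW Lu Lv)) -(RintN mW i1).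
by apply: eq_Rintegral => p /set_mem wp; rewrite (E p wp) /oddmode; ring.
Qed.

Lemma second_eigenvalue : is_neumann_eigenvalue W 2 (4 * ts).
Proof.
have hu := oddmode_eigenfunction; have /andP[ts0 tst0] := ts_itv.
have iu : rint (area R) W oddmode by case: hu => _ [g [Lu _ _ _] _]; exact: L2_rint.
have u0 : \int[area R]_(p in W) oddmode p = 0 by apply: (eigen_mean0 hu); lra.
have ae0 v : ae_zero W v -> rint (area R) W v -> \int[area R]_(p in W) v p = 0.
  by move=> v0 iv; exact: (Rintegral_ae_zero mW (rint_mfun iv)).
split.
  exists (fun i : 'I_2 => if i == ord0 then fun=> 1 else oddmode), (fun i => if i == ord0 then 0 else 4 * ts).
  split.
    move=> i; case: eqP => _; split => //; first by apply: eigen_const; exact: oner_neq0.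
    by lra.
  move=> c hc.
  have hc' : ae_zero W (fun p => c ord0 * 1 + c ord_max * oddmode p).
    apply: (_ : ae_zero W _ -> _) hc; congr ae_zero; apply/funext => p.
    by rewrite big_ord_recr big_ord1 /=; congr (c _ * _ + c _ * _); apply/val_inj.
  have i0 := rintZ mW (c ord0) (rint_const 1).
  have i1 := rintZ mW (c ord_max) iu.
  (* Integration over the wedge separates the two functions, since [oddmode] has mean zero and the
     constant has not. *)
  have := ae0 _ hc' (rintD mW i0 i1).
  rewrite (RintD mW i0 i1) (RintZ mW _ (rint_const 1)) (RintZ mW _ iu) u0 mulr0 addr0.
  move/eqP; rewrite mulf_eq0 (negbTE area_wedge_neq0) orbF => /eqP c0.
  have c1 : c ord_max = 0.
    apply/eqP; apply: contraPT hc' => c1; case: hu => nz _; apply: contra_not nz.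
    move=> [N [mN N0 hN]]; exists N; split => // p np; apply: hN => h; apply: np => wp.
    by have /eqP := h wp; rewrite c0 mul0r add0r mulf_eq0 (negbTE c1) => /eqP.
  move=> i; have [->|] := eqVneq i ord0; first exact: c0.
  by case: i => -[|[|]] // k _; rewrite -c1; congr c; apply/val_inj.
move=> t [u [l [hul hind]]]; rewrite leNgt; apply/negP => tlt.
have hm i : ae_zero W (fun p => u i p - mean (u i)).
  have [hi li] := hul i; apply: (low_eigenfunction_const hi).
  exact: le_lt_trans li tlt.
(* Both eigenfunctions below [4 * ts] are constant almost everywhere, so this combination vanishes.
   Independence then makes the first constant zero, contradicting that an eigenfunction is
   nonzero. *)
pose c (i : 'I_2) := if i == ord0 then mean (u ord_max) else - mean (u ord0).
have hc : ae_zero W (fun p => \sum_(i < 2) c i * u i p).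
  have le0 (x : \bar R) : x = 0%E -> (x <= 0)%E by move=> ->.
  have := hm ord0; have := hm ord_max.
  move=> [N [mN N0 hN]] [N' [mN' N0' hN']]; exists (N `|` N'); split.
  - exact: measurableU.
  - apply/eqP; rewrite -measure_le0; apply: (le_trans (measureU2 _ mN mN')).
    by have := leeD (le0 _ N0) (le0 _ N0'); rewrite adde0.
  - move=> p np; apply: contrapT => /not_orP[n1 n2]; apply: np => wp.
    have h1 : u ord_max p - mean (u ord_max) = 0.
      by apply: contrapT => h; apply: n1; apply: hN => /(_ wp).
    have h2 : u ord0 p - mean (u ord0) = 0.
      by apply: contrapT => h; apply: n2; apply: hN' => /(_ wp).
    rewrite big_ord_recr big_ord1 /=.
    have -> : widen_ord (leqnSn 1) ord0 = ord0 by apply/val_inj.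
    rewrite /c eqxx /=; move/eqP: h1; move/eqP: h2; rewrite !subr_eq0 => /eqP-> /eqP->.
    by ring.
have := hind c hc ord_max; rewrite /c /= => /eqP; rewrite oppr_eq0 => /eqP m0.
have [[nz _] _] := hul ord0; apply: nz.
have E : (fun p => u ord0 p - mean (u ord0)) = u ord0 by apply/funext => p; rewrite m0 subr0.
by rewrite -E; exact: hm.
Qed.

End at_eigenvalue.

End spectrum.

(** * The trial function for kappa_1 *)

Section boundary_integrals.
Context {R : realType}.
Notation mu := (@lebesgue_measure R).
Implicit Types (f : R * R -> R) (a b : R).

Lemma integral_mrestr d (T : measurableType d) (m : {measure set T -> \bar R})
    (D : set T) (mD : measurable D) (f : T -> \bar R) :
  (mrestr m mD).-integrable setT f ->
  (\int[mrestr m mD]_x f x = \int[m]_(x in D) f x)%E.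
Proof.
move=> intf; have mDc := measurableC mD.
have m0 : mrestr m mD (~` D) = 0%E by rewrite /mrestr setICl measure0.
rewrite (negligible_integral mDc measurableT intf m0).
rewrite setTD setCK; apply: eq_measure_integral => A mA AD.
by rewrite -[in RHS](setIidl AD).
Qed.

Lemma arc_integral (gamma : {mfun measurableTypeR R >-> mplane R}) f a b (C : R) :
  a <= b -> measurable_fun setT (f : mplane R -> R) -> (forall p, `|f p| <= C) ->
  rint (arc_length gamma a b) setT f /\
  \int[arc_length gamma a b]_p f p = \int[mu]_(x in `[a, b]) f (gamma x).
Proof.
move=> ab mf hf.
have mI := measurable_itv `[a, b].
have fin : (mrestr mu mI setT < +oo)%E.
  rewrite /mrestr setTI lebesgue_measure_itv /=; case: ifP => _; last exact: ltry.
  by rewrite -EFinB ltry.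
have irestr : rint (mrestr mu mI) setT (fun x => f (gamma x)).
  by apply: (rint_bounded measurableT fin (C := C)) => //; exact: measurableT_comp.
have i1 : rint (arc_length gamma a b) setT f.
  by apply: (rint_bounded measurableT (C := C)).
split => //.
rewrite /Rintegral; congr fine.
have -> : (\int[arc_length gamma a b]_p (f p)%:E = \int[mrestr mu mI]_x (f (gamma x))%:E)%E.
  by apply: integral_pushforward => //; exact/measurable_EFinP.
exact: integral_mrestr.
Qed.

Lemma finite_arc_length (gamma : {mfun measurableTypeR R >-> mplane R}) a b :
  (arc_length gamma a b setT < +oo)%E.
Proof.
rewrite /arc_length /pushforward preimage_setT /mrestr setTI lebesgue_measure_itv /=.
by case: ifP => _; [rewrite -EFinB ltry|exact: ltry].
Qed.

Lemma sector_integral f (alpha C : R) : 0 <= alpha ->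
  measurable_fun setT (f : mplane R -> R) -> (forall p, `|f p| <= C) ->
  L2 (sector_arc_length alpha) setT f /\
  \int[sector_arc_length alpha]_p f p =
    \int[mu]_(r in `[0, 1]) f (ray (- (alpha / 2)) r) +
    \int[mu]_(r in `[0, 1]) f (ray (alpha / 2) r) +
    \int[mu]_(t in `[- (alpha / 2), alpha / 2]) f (circle t).
Proof.
move=> a0 mf hf.
pose m12 := measure_add (arc_length (@ray R (- (alpha / 2))) 0 1) (arc_length (ray (alpha / 2)) 0 1).
have fin12 : (m12 setT < +oo)%E.
  apply: (@le_lt_trans _ _ (arc_length (@ray R (- (alpha / 2))) 0 1 setT + arc_length (@ray R (alpha / 2)) 0 1 setT)%E).
    by rewrite le_eqVlt; apply/orP; left; apply/eqP; exact: measure_addE.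
  by apply: lte_add_pinfty; exact: finite_arc_length.
have fin : (sector_arc_length alpha setT < +oo)%E.
  apply: (@le_lt_trans _ _ (m12 setT + arc_length (@circle R) (- (alpha / 2)) (alpha / 2) setT)%E).
    by rewrite le_eqVlt; apply/orP; left; apply/eqP; exact: measure_addE.
  by apply: lte_add_pinfty => //; exact: finite_arc_length.
split; first by apply: (L2_bounded measurableT (C := C)).
have ab : - (alpha / 2) <= alpha / 2 by lra.
have [i1 <-] := @arc_integral (ray (- (alpha / 2))) f 0 1 C ler01 mf hf.
have [i2 <-] := @arc_integral (ray (alpha / 2)) f 0 1 C ler01 mf hf.
have [i3 <-] := @arc_integral circle f _ _ C ab mf hf.
have mE : measurable_fun setT (fun p : mplane R => (f p)%:E) by exact/measurable_EFinP.
have i12 : rint m12 setT f by apply: (rint_bounded measurableT (C := C)).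
have E : (\int[sector_arc_length alpha]_p (f p)%:E =
    \int[m12]_p (f p)%:E + \int[arc_length circle (- (alpha / 2)) (alpha / 2)]_p (f p)%:E)%E.
  exact: integral_measure_add.
have E12 : (\int[m12]_p (f p)%:E =
    \int[arc_length (ray (- (alpha / 2))) 0 1]_p (f p)%:E + \int[arc_length (ray (alpha / 2)) 0 1]_p (f p)%:E)%E.
  exact: integral_measure_add.
have n1 := integrable_fin_num measurableT i1; have n2 := integrable_fin_num measurableT i2.
have n3 := integrable_fin_num measurableT i3; have n12 := integrable_fin_num measurableT i12.
by rewrite /Rintegral E (fineD n12 n3) E12 (fineD n1 n2).
Qed.

End boundary_integrals.

(** * The radial trial function and its derivatives *)

Section trial_function.
Context {R : realType}.
Implicit Types (p : R * R) (t c x r : R).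

Definition sqnorm p : R := p.1 ^+ 2 + p.2 ^+ 2.

(** For [t > 0] this is [J_0(2 sqrt(t) r) - c]. Written through the squared norm it is smooth on the
    whole plane, so the constant sequence equal to it witnesses its boundary trace. *)
Definition trial t c p : R := bes 0 (t * sqnorm p) - c.

Definition trial_grad t p : R * R :=
  (- (2 * t) * (p.1 * bes 1 (t * sqnorm p)), - (2 * t) * (p.2 * bes 1 (t * sqnorm p))).

Lemma is_derive_sqnorm (e : R * R) p :
  is_derive p e sqnorm (2 * (p.1 * e.1 + p.2 * e.2)).
Proof.
have h1 := is_derive_mul (is_derive_fst p e) (is_derive_fst p e).
have h2 := is_derive_mul (is_derive_snd p e) (is_derive_snd p e).
apply: (is_derive_eq (is_derive_add h1 h2)); ring.
Qed.

Lemma Ck_fst k : Ck k (fun p : R * R => p.1).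
Proof.
case: k => [|k]; first by split => // p; exact: fst_continuous.
apply: (@Ck_succ _ _ _ (fun=> 1) (fun=> 0)).
- by move=> p; exact: fst_continuous.
- by move=> p; have := is_derive_fst p ((1, 0) : R * R).
- by move=> p; have := is_derive_fst p ((0, 1) : R * R).
- exact: Ck_cst.
- exact: Ck_cst.
Qed.

Lemma Ck_snd k : Ck k (fun p : R * R => p.2).
Proof.
case: k => [|k]; first by split => // p; exact: snd_continuous.
apply: (@Ck_succ _ _ _ (fun=> 0) (fun=> 1)).
- by move=> p; exact: snd_continuous.
- by move=> p; have := is_derive_snd p ((1, 0) : R * R).
- by move=> p; have := is_derive_snd p ((0, 1) : R * R).
- exact: Ck_cst.
- exact: Ck_cst.
Qed.

Lemma is_derive_bes_sqnorm s t (e : R * R) p : 0 <= s ->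
  is_derive p e (fun p => bes s (t * sqnorm p))
    (- (2 * t / (s + 1)) * ((p.1 * e.1 + p.2 * e.2) * bes (s + 1) (t * sqnorm p))).
Proof.
move=> s0.
apply: (is_derive_eq (@is_derive_comp _ _ (bes s) (fun p => t * sqnorm p) p e _ _ (is_derive_bes _ s0)
   (is_derive_scale t (is_derive_sqnorm e p)))).
by field; rewrite gt_eqF// ltr_wpDl.
Qed.

Lemma Ck_bes_sqnorm k s t : 0 <= s -> Ck k (fun p => bes s (t * sqnorm p)).
Proof.
elim: k s => [|k IH] s s0.
  split => // p; apply: (@continuous_comp _ _ _ (fun p => t * sqnorm p) (bes s)).
    by apply: cvgM; [exact: cvg_cst|exact: rho_continuous].
  exact: is_derive_continuous (is_derive_bes _ s0).
have s1 : 0 <= s + 1 by rewrite addr_ge0.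
apply: (@Ck_succ _ _ _ (fun p => - (2 * t / (s + 1)) * (p.1 * bes (s + 1) (t * sqnorm p)))
   (fun p => - (2 * t / (s + 1)) * (p.2 * bes (s + 1) (t * sqnorm p)))).
- exact: Ck_continuous (IH s s0).
- by move=> p; apply: (is_derive_eq (is_derive_bes_sqnorm t ((1, 0) : R * R) p s0)); rewrite /= mulr1 mulr0 addr0.
- by move=> p; apply: (is_derive_eq (is_derive_bes_sqnorm t ((0, 1) : R * R) p s0)); rewrite /= mulr1 mulr0 add0r.
- by apply: Ck_mul; [exact: Ck_cst|apply: Ck_mul; [exact: Ck_fst|exact: IH]].
- by apply: Ck_mul; [exact: Ck_cst|apply: Ck_mul; [exact: Ck_snd|exact: IH]].
Qed.

Lemma smooth_trial t c : smooth (trial t c).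
Proof.
move=> k; apply: (Ck_add (f := fun p => bes 0 (t * sqnorm p)) (g := fun=> - c)); last exact: Ck_cst.
exact: Ck_bes_sqnorm.
Qed.

Lemma is_derive_trial t c (e : R * R) p :
  is_derive p e (trial t c) (dot (trial_grad t p) e).
Proof.
apply: (is_derive_eq (is_derive_sub (is_derive_bes_sqnorm t e p (lexx 0)) (is_derive_const c p e))).
by rewrite /dot /trial_grad /= add0r; field.
Qed.

Lemma gradient_trial t c p : gradient (trial t c) p = trial_grad t p.
Proof.
have [_ h1] := is_derive_trial t c ((1, 0) : R * R) p.
have [_ h2] := is_derive_trial t c ((0, 1) : R * R) p.
rewrite /gradient /partial1 /partial2 h1 h2 /dot /= !mulr1 !mulr0 addr0 add0r.
by [].
Qed.

Lemma trial_bound t c p : 0 <= t -> `|trial t c p| <= 1 + `|c|.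
Proof.
move=> t0; apply: (le_trans (ler_normB _ _)); rewrite lerD2r; apply: bes_le1 => //.
by rewrite mulr_ge0// addr_ge0// sqr_ge0.
Qed.

Lemma trial_polar t c r (th : R) : trial t c (polar r th) = bes 0 (t * r ^+ 2) - c.
Proof.
rewrite /trial /sqnorm /polar /= !exprMn -mulrDr cos2Dsin2 mulr1; by [].
Qed.

End trial_function.

Section kappa.
Context {R : realType}.
Variables (alpha t c : R).
Hypothesis a0 : 0 < alpha.
Hypothesis a_pi : alpha / 2 <= pi / 2.
Hypothesis t0 : 0 < t.
Hypothesis bes1_t : bes 1 t = 0.
Notation b := (alpha / 2).
Notation W := (wedge b).

Let b0 : 0 < b. Proof. by rewrite divr_gt0. Qed.
Let mW := @measurable_wedge R b.
Let Woo := @area_wedge_lty R b.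
Let u := trial t c.
Let g := @trial_grad R t.
Let F (p : R * R) := bes 0 (t * sqnorm p).
Let N := \int[area R]_(p in W) (F p ^+ 2).
Let V := \int[area R]_(p in W) (1 : R).

Let trial_H1 c' : H1 W (trial t c') g.
Proof.
have t0' := ltW t0.
have tt : 0 <= 2 * t by rewrite mulr_ge0.
have gb (x s : R) (p : R * R) : 0 <= s -> `|x| <= 1 -> `|- (2 * t) * (x * bes s (t * sqnorm p))| <= 2 * t.
  move=> s0 x1; rewrite normrM normrN (ger0_norm tt) ler_piMr//.
  rewrite -[leRHS]mulr1; apply: ler_norm_mul => //; apply: bes_le1 => //.
  by rewrite mulr_ge0// addr_ge0// sqr_ge0.
have cg (f : R * R -> R) p : continuous f -> {for p, continuous (fun p => - (2 * t) * (f p * bes 1 (t * sqnorm p)))}.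
  move=> cf; have cb : continuous (fun p : R * R => bes 1 (t * sqnorm p)).
    by apply: (@Ck_continuous _ 0); exact: Ck_bes_sqnorm.
  by apply: cvgM; [exact: cvg_cst|apply: cvgM; [exact: cf|exact: cb]].
apply: (@classical_H1 R W (@open_wedge R b) _ _ (1 + `|c'| + 2 * t) Woo).
- move=> p _; apply: (is_derive_eq (is_derive_trial t c' ((1, 0) : R * R) p)).
  by rewrite /dot /= mulr1 mulr0 addr0.
- move=> p _; apply: (is_derive_eq (is_derive_trial t c' ((0, 1) : R * R) p)).
  by rewrite /dot /= mulr1 mulr0 add0r.
- move=> p _; split.
  + exact: (Ck_continuous (@smooth_trial R t c' 0%N)).
  + by apply: (cg (fun p => p.1)) => q; exact: fst_continuous.
  + by apply: (cg (fun p => p.2)) => q; exact: snd_continuous.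
- move=> p wp; have [/andP[p0 p1] /andP[p2 p3]] := wedge_box wp.
  have c0 := normr_ge0 c'; split.
  + by apply: (le_trans (trial_bound c' p t0')); rewrite lerDl mulr_ge0.
  + apply: (le_trans (gb _ 1 p ler01 _)); first by rewrite ler_norml; lra.
    by rewrite lerDr addr_ge0.
  + apply: (le_trans (gb _ 1 p ler01 _)); first by rewrite ler_norml; lra.
    by rewrite lerDr addr_ge0.
Qed.

Let f r : R := bes 0 (t * r ^+ 2).
Let f1 r : R := - (2 * t) * (r * bes 1 (t * r ^+ 2)).
Let f2 r : R := - (2 * t) * (bes 1 (t * r ^+ 2) - t * r ^+ 2 * bes 2 (t * r ^+ 2)).

Let dz r : is_derive r (1 : R) f (f1 r).
Proof.
apply: (is_derive_eq (is_derive_bes_sq t r (lexx 0))).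
by rewrite /f1 add0r; field.
Qed.

Let dz1 r : is_derive r (1 : R) f1 (f2 r).
Proof.
have d := is_derive_mul (is_derive_id r (1 : R)) (is_derive_bes_sq t r ler01).
apply: (is_derive_eq (is_derive_scale (- (2 * t)) d)).
by rewrite /f2 (_ : 1 + 1 = 2 :> R)//; field.
Qed.

Let trial_mode : exists T1 T2 C, neumann_mode b f f1 f2 (cmode b 0) T1 T2 C /\
  forall p, W p -> plap f f1 f2 (cmode b 0) T2 p = - (4 * t) * F p.
Proof.
have t0' := ltW t0; have tt : 0 <= 2 * t by rewrite mulr_ge0.
set C := 2 * t * (1 + t).
have C0 : 0 <= C by rewrite /C !mulr_ge0// addr_ge0.
have b2 r : 0 < r <= 1 -> `|f2 r| <= C.
  move=> /andP[r0 r1]; rewrite /f2 normrM normrN (ger0_norm tt).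
  rewrite ler_wpM2l//; apply: (le_trans (ler_normB _ _)); apply: lerD.
    exact: bes_sq_le1.
  rewrite -[leRHS]mulr1; apply: ler_norm_mul; last exact: bes_sq_le1.
  have k0 : 0 <= t * r ^+ 2 by rewrite mulr_ge0// sqr_ge0.
  by rewrite (ger0_norm k0) ler_piMr// expr_le1// ltW.
have f11 : f1 1 = 0 by rewrite /f1 expr1n mulr1 bes1_t !mulr0.
have fb := flux_bound (ltr1n R 2) (fun x _ => dz1 x) f11 b2.
have sf : smooth1 (itvoo 0 1) f.
  move=> k; apply: (@Sk_comp _ _ setT) => //; first exact: Sk_bes.
  by apply: Sk_scale; apply: Sk_expn; exact: Sk_id.
have w0 : mode_freq b 0 = 0 by rewrite /mode_freq mul0r.
have hb r : itvoo 0 1 r -> [/\ `|f1 r| <= C * r, `|f1 r| <= C * (1 - r) & `|f2 r| <= C].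
  move=> /andP[r0 r1]; have r01 : 0 < r <= 1 by rewrite r0 ltW.
  split; [|exact: fb|exact: b2].
  rewrite /f1 normrM normrN (ger0_norm tt) normrM (gtr0_norm r0).
  have h : `|bes 1 (t * r ^+ 2)| <= 1 by exact: bes_sq_le1.
  rewrite /C -!mulrA ler_pM2l// ler_pM2l// mulrC ler_pM2r//.
  by apply: (le_trans h); rewrite lerDl.
have h0 r : itvoo 0 1 r -> mode_freq b 0 != 0 -> `|f r| <= C * r ^+ 2 by rewrite w0 eqxx.
have [C' hm] := neumann_mode_cmode b0 C0 sf (fun r _ => dz r) (fun r _ => dz1 r) hb h0.
exists (cmode' b 0), (fun t => - mode_freq b 0 ^+ 2 * cmode b 0 t), C'; split => // p [p0 _ _].
have r0 := prad_gt0 p0.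
rewrite /plap w0 expr0n oppr0 !mul0r mulr0 addr0 cmodeE w0 mul0r cos0 mulr1.
rewrite /F /f1 /f2 /sqnorm -prad2 (bes_contiguous _ (lexx 0)) !add0r.
by field; rewrite gt_eqF.
Qed.

Let LF : L2 (area R) W F.
Proof.
have [h _ _ _] := trial_H1 0.
by move: h; congr L2; apply/funext => p; rewrite /trial subr0.
Qed.

Let FF : trial t 0 = F. Proof. by apply/funext => p; rewrite /trial subr0. Qed.

Let iF2 : rint (area R) W (fun p => F p ^+ 2). Proof. by case: LF. Qed.
Let iF := L2_rint mW Woo LF.

(** Green's formula for the radial mode against itself; the Neumann condition at the arc is the
    hypothesis [bes 1 t = 0]. *)
Let trial_energy : \int[area R]_(p in W) dot (g p) (g p) = 4 * t * N.
Proof.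
have [T1 [T2 [C [hm E]]]] := trial_mode.
have HF := trial_H1 0; rewrite FF in HF.
have [i1 i2 G] := green a_pi hm HF.
have T10 th : itvoo (- b) b th -> T1 th = 0.
  move=> It; have [_ _ [dT _] _ _] := hm; have [_ <-] := dT _ It.
  have -> : cmode b 0 = cst 1 by apply/funext => x; rewrite /cmode mul0r cos0.
  by rewrite derive_cst.
transitivity (\int[area R]_(p in W) dot (g p) (pgrad f f1 (cmode b 0) T1 p)).
  apply: eq_Rintegral => p /set_mem wp; have [p0 _ ht] := wedgeP wp.
  have r0 := prad_gt0 p0.
  congr dot; rewrite /pgrad T10// (_ : cmode b 0 _ = 1); last by rewrite /cmode mul0r cos0.
  rewrite /g /trial_grad /f1 !mulr0 subr0 addr0 !mulr1 cos_pang// sin_pang// prad2.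
  by congr pair; rewrite /sqnorm; field; rewrite gt_eqF.
rewrite G -(RintZ mW _ iF2) -(RintN mW i1).
by apply: eq_Rintegral => p /set_mem wp; rewrite (E p wp); ring.
Qed.

(** Green's formula against the constant 1: the Laplacian [- 4 t F] has integral zero. *)
Let trial_mean0 : \int[area R]_(p in W) F p = 0.
Proof.
have [T1 [T2 [C [hm E]]]] := trial_mode.
have [i1 i2 G] := green a_pi hm (@const_H1 R b 1).
have h0 : \int[area R]_(p in W) dot (0, 0) (pgrad f f1 (cmode b 0) T1 p) = 0.
  by apply: Rintegral_eq0 => p _; rewrite /dot /= !mul0r addr0.
have h : 4 * t * \int[area R]_(p in W) F p = 0.
  rewrite -(RintZ mW _ iF) -[RHS]h0 G -(RintN mW i1).
  by apply: eq_Rintegral => p /set_mem wp; rewrite (E p wp) mul1r mulNr opprK.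
by move/eqP: h; rewrite mulf_eq0 gt_eqF ?mulr_gt0//= => /eqP.
Qed.

Let trial_L2 : \int[area R]_(p in W) (u p ^+ 2) = N + c ^+ 2 * V.
Proof.
have i1 := rint_const b (c ^+ 2).
have i2 := rintZ mW (2 * c) iF.
have -> : \int[area R]_(p in W) (u p ^+ 2) = \int[area R]_(p in W) (F p ^+ 2 - 2 * c * F p + c ^+ 2).
  by apply: eq_Rintegral => p _; rewrite /u /trial -/(F p); ring.
rewrite (RintD mW (rintB mW iF2 i2) i1) (RintB mW iF2 i2) (RintZ mW _ iF) trial_mean0 mulr0 subr0.
congr (_ + _); rewrite -(RintZ mW _ (rint_const b 1)).
by apply: eq_Rintegral => p _; rewrite mulr1.
Qed.

Let V0 : 0 < V.
Proof.
rewrite lt_neqAle eq_sym area_wedge_neq0//=.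
by apply: Rintegral_ge0 => p _.
Qed.

Let NV : N <= V.
Proof.
apply: le_Rintegral => //; first exact: rint_const.
move=> p _; have h : `|F p| <= 1.
  by apply: bes_le1 => //; rewrite mulr_ge0 ?(ltW t0)// addr_ge0// sqr_ge0.
by rewrite -[leRHS](expr1n R 2) -(real_normK (num_real (F p))) lerXn2r// nnegrE.
Qed.

Lemma kappa1_le : 0 < c ->
  \int[sector_arc_length alpha]_p trial t c p = 0 ->
  (kappa1 W (sector_arc_length alpha) <= (4 * t / (1 + c ^+ 2))%:E)%E.
Proof.
move=> c0 bd0; have a0' := ltW a0; have t0' := ltW t0.
have N0 : 0 <= N by apply: Rintegral_ge0 => p _; exact: sqr_ge0.
have c2 : 0 < c ^+ 2 by rewrite exprn_gt0.
have D0 : 0 < N + c ^+ 2 * V by rewrite ltr_wpDl// mulr_gt0.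
have mu : measurable_fun setT (trial t c : mplane R -> R).
  apply: (open_continuous_mfun openT) => p _.
  exact: (Ck_continuous (@smooth_trial R t c 0%N)).
have [Ls _] := sector_integral a0' mu (fun p => trial_bound c p t0').
apply: (@le_trans _ _ ((4 * t * N) / (N + c ^+ 2 * V))%:E).
  apply: ereal_inf_lbound; exists u, g; split.
  - exact: trial_H1.
  - have mu2 : measurable_fun (W : set (mplane R)) (fun p : mplane R => u p ^+ 2).
      by apply: measurable_funX; exact: (measurable_funS measurableT (@subsetT _ _) mu).
    move=> u0; have := D0; rewrite -trial_L2 (Rintegral_ae_zero mW mu2) ?ltxx//.
    move: u0 => [M [mM M0 hM]]; exists M; split => // p np; apply: hM => h; apply: np => wp.
    by rewrite h// expr0n.
  - exists u => //; split; first exact: Ls.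
    exists g, (fun=> u); split.
    + exact: trial_H1.
    + by move=> _; exact: smooth_trial.
    + rewrite (_ : (fun n : nat => _) = fun=> 0%E); first exact: cvg_cst.
      by apply/funext => n; rewrite integral0_eq// => p _; rewrite subrr expr0n.
    + rewrite (_ : (fun n : nat => _) = fun=> 0%E); first exact: cvg_cst.
      apply/funext => n; rewrite integral0_eq// => p _; rewrite gradient_trial subrr.
      by rewrite /dot /= mulr0 addr0.
    + rewrite (_ : (fun n : nat => _) = fun=> 0%E); first exact: cvg_cst.
      by apply/funext => n; rewrite integral0_eq// => p _; rewrite subrr expr0n.
  - by rewrite trial_energy trial_L2.
have c1 : 0 < 1 + c ^+ 2 by rewrite ltr_wpDl.
have h : c ^+ 2 * N <= c ^+ 2 * V by rewrite ler_wpM2l// ltW.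
have h2 : N * (1 + c ^+ 2) <= N + c ^+ 2 * V by rewrite mulrDr mulr1 lerD2l mulrC.
rewrite lee_fin ler_pdivrMr// [leRHS]mulrAC (ler_pdivlMr _ _ c1).
by rewrite -[leLHS]mulrA ler_wpM2l// mulr_ge0.
Qed.

End kappa.

(** * Choice of the angle *)

Section sector_wedge.
Context {R : realType}.

(** The angular inequality is strict by definition; the other two come from openness. A small shift
    to the left keeps the first coordinate nonnegative and one to the right keeps the radius at most
    1, so at the point itself both inequalities are strict. *)
Lemma sector_eq_wedge (alpha : R) : alpha / 2 <= pi / 2 ->
  sector alpha = wedge (alpha / 2).
Proof.
move=> a_pi; apply/seteqP; split => p; last first.
  suff h : wedge (alpha / 2) `<=` sector alpha by exact: h.
  rewrite /sector -open_subsetE; last exact: open_wedge.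
  move=> q [q0 q1 q2]; have r0 := prad_gt0 q0.
  exists (prad q), (pang q); split => //; first by rewrite !ltW.
  by rewrite polar_prad_pang.
have cosS (t : R) : `|t| < alpha / 2 -> 0 < cos t.
  by move=> ht; apply: cos_gt0_pihalf; rewrite -ltr_norml (lt_le_trans ht).
have S_sub q : (exists r t : R, [/\ 0 <= r <= 1, `|t| < alpha / 2 & q = polar r t]) ->
    0 <= q.1 /\ prad q <= 1.
  move=> [r [t [/andP[r0 r1] ht ->]]]; rewrite prad_polar//; split => //=.
  by rewrite mulr_ge0// ltW// cosS.
move=> /[dup] /interior_subset [r [t [/andP[r0 r1] ht pE]]].
move=> [[A B] /= [/nbhs_ballP[e e0 hA] /nbhs_ballP[d d0 hB]] AB].
move: e0 d0 => /= e0 d0.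
have near x : `|p.1 - x| < e -> 0 <= x /\ prad (x, p.2) <= 1.
  move=> hx; apply: (S_sub (x, p.2)); apply: AB; split => /=; first exact: hA.
  by apply: hB; exact: ballxx.
have p0 : 0 < p.1.
  have [|h _] := near (p.1 - e / 2); first by rewrite ltr_norml; lra.
  by lra.
have cost := cosS t ht.
have rp : 0 < r.
  rewrite lt_neqAle r0 andbT eq_sym; apply: contraTneq p0 => r00.
  by rewrite pE /= r00 mul0r ltxx.
have hp : - (pi / 2) < t < pi / 2 by rewrite -ltr_norml; exact: lt_le_trans a_pi.
have tp : `|pang p| < alpha / 2 by rewrite pE (pang_polar rp hp).
split; [exact: p0| |exact: tp].
have [|_ h] := near (p.1 + e / 2); first by rewrite ltr_norml; lra.
have h1 := prad2 p; have h2 := prad2 (p.1 + e / 2, p.2); rewrite /= in h1 h2.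
have r1' := prad_gt0 p0.
have r2' : 0 < prad (p.1 + e / 2, p.2) by apply: prad_gt0 => /=; lra.
move: (prad p) (prad (p.1 + e / 2, p.2)) h h1 h2 r1' r2' => x y h h1 h2 x0 y0.
have k : 0 < p.1 * e by rewrite mulr_gt0.
have k2 := sqr_ge0 e.
have : x ^+ 2 < 1 by nra.
by rewrite expr_lt1// ltW.
Qed.

End sector_wedge.

(** * The boundary mean of the trial function and the choice of parameters *)

Section balance.
Context {R : realType}.
Notation mu := (@lebesgue_measure R).

Definition radius_mean (t : R) : R := \int[mu]_(r in `[0, 1]) bes 0 (t * r ^+ 2).

Lemma rint_segment (f : R -> R) (a b : R) : (forall x, a <= x <= b -> {for x, continuous f}) ->
  rint mu `[a, b] f.
Proof.
move=> cf; apply: continuous_compact_integrable; first exact: segment_compact.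
by apply: continuous_in_subspaceT => y; rewrite inE /= in_itv /=; exact: cf.
Qed.

Lemma radius_mean_lower (t : R) : 183 / 50 < t < 92 / 25 -> 11 / 40 <= radius_mean t.
Proof.
move=> /andP[t1 t2]; have t0 : 0 <= t by lra.
(* [P] is the six-term Taylor sum of [bes 0] at [t r^2], a lower bound, and [Q] is its primitive in
   [r]. *)
pose P (r : R) := 1 - t * (r ^+ 2 / 1) + t ^+ 2 * (r ^+ 4 / 4) - t ^+ 3 * (r ^+ 6 / 36) +
  t ^+ 4 * (r ^+ 8 / 576) - t ^+ 5 * (r ^+ 10 / (144 * 100)).
pose Q (r : R) := r - t * (r ^+ 3 / 3) + t ^+ 2 * (r ^+ 5 / 20) - t ^+ 3 * (r ^+ 7 / 252) +
  t ^+ 4 * (r ^+ 9 / (72 * 72)) - t ^+ 5 * (r ^+ 11 / (144 * 1100)).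
have dX n c (y : R) : is_derive y (1 : R) (fun z : R => z ^+ n.+1 / c) (n.+1%:R * y ^+ n / c).
  have h := is_derive_expn n.+1 (is_derive_id y (1 : R)).
  apply: (is_derive_eq (is_derive_mul h (is_derive_const c^-1 y (1 : R)))).
  by rewrite /= mulr0 addr0 mulr1.
have dQ r : is_derive r (1 : R) Q (P r).
  have h1 := is_derive_sub (is_derive_id r (1 : R)) (is_derive_scale t (dX 2%N 3 r)).
  have h2 := is_derive_add h1 (is_derive_scale (t ^+ 2) (dX 4%N 20 r)).
  have h3 := is_derive_sub h2 (is_derive_scale (t ^+ 3) (dX 6%N 252 r)).
  have h4 := is_derive_add h3 (is_derive_scale (t ^+ 4) (dX 8%N (72 * 72) r)).
  have h5 := is_derive_sub h4 (is_derive_scale (t ^+ 5) (dX 10%N (144 * 1100) r)).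
  by apply: (is_derive_eq h5); rewrite /P; field.
have term (k : R) m (c : R) : Sk setT 0 (fun r : R => k * (r ^+ m / c)).
  by apply: Sk_scale; apply: Sk_mul; [apply: Sk_expn; exact: Sk_id|exact: Sk_cst].
have cP r : {for r, continuous P}.
  have sP : Sk setT 0 P.
    by do 5! [apply: Sk_sub_fun; last exact: term | apply: Sk_add; last exact: term]; exact: Sk_cst.
  exact: sP.
have PF r : P r <= bes 0 (t * r ^+ 2).
  have h0 : 0 <= t * r ^+ 2 by rewrite mulr_ge0// sqr_ge0.
  apply: le_trans (bes_ge_btaylor (N := 5) (lexx 0) h0 _) => //.
  rewrite le_eqVlt; apply/orP; left; apply/eqP.
  by rewrite /P /btaylor !big_ord_recr big_ord0 /=; field.
have iP : rint mu `[0, 1] P by apply: rint_segment => r _; exact: cP.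
have iF : rint mu `[0, 1] (fun r => bes 0 (t * r ^+ 2)).
  by apply: rint_segment => r _; exact: is_derive_continuous (is_derive_bes_sq t r (lexx 0)).
have IP : \int[mu]_(r in `[0, 1]) P r = Q 1 - Q 0.
  by rewrite /Rintegral (ftc_segment ltr01 (fun x _ => dQ x) (fun x _ => cP x)).
apply: (@le_trans _ _ (\int[mu]_(r in `[0, 1]) P r)); last first.
  by apply: le_Rintegral => // r _; exact: PF.
have -> : \int[mu]_(r in `[0, 1]) P r =
    1 - t * (1 - t * (3 / 20 * (1 - t * (5 / 63 * (1 - t * (7 / 144 * (1 - t * (9 / 275)))))))) / 3.
  by rewrite IP /Q !expr1n !expr0n /=; field.
(* One step of interval arithmetic for the nested Horner form, applied from the innermost bracket
   outwards; plain expansion would lose too much through the alternating signs. *)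
have step (x lo hi c : R) : 0 <= c -> 0 <= lo -> lo <= x <= hi ->
    1 - 92 / 25 * (c * hi) <= 1 - t * (c * x) <= 1 - 183 / 50 * (c * lo).
  move=> c0 l0 /andP[lx xh].
  have a1 : c * x <= c * hi by rewrite ler_wpM2l.
  have a2 : c * lo <= c * x by rewrite ler_wpM2l.
  have a3 : 0 <= c * lo by rewrite mulr_ge0.
  have a4 : t * (c * x) <= 92 / 25 * (c * hi).
    by apply: ler_pM => //; [exact: le_trans a3 a2|exact: ltW].
  have a5 : 183 / 50 * (c * lo) <= t * (c * x).
    by apply: ler_pM a2; [apply: divr_ge0; exact: ler0n|exact: a3|exact: ltW].
  by rewrite !lerD2l !lerN2 a4 a5.
set a5 := 1 - t * (9 / 275); have h5 : 87 / 100 <= a5 <= 89 / 100 by rewrite /a5; lra.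
set a4 := 1 - t * (7 / 144 * a5); have h4 : 84 / 100 <= a4 <= 85 / 100.
  by have := step a5 (87 / 100) (89 / 100) (7 / 144); rewrite -/a4; lra.
set a3 := 1 - t * (5 / 63 * a4); have h3 : 75 / 100 <= a3 <= 76 / 100.
  by have := step a4 (84 / 100) (85 / 100) (5 / 63); rewrite -/a3; lra.
set a2 := 1 - t * (3 / 20 * a3); have h2 : 58 / 100 <= a2 <= 59 / 100.
  by have := step a3 (75 / 100) (76 / 100) (3 / 20); rewrite -/a2; lra.
have := step a2 (58 / 100) (59 / 100) (1 / 3).
by lra.
Qed.

(** The constant is the boundary average of [J_0]: two radii of length 1, and an arc of length
    [alpha] on which the function is constant, over the perimeter [2 + alpha]. *)
Lemma trial_boundary_mean (alpha t : R) : 0 < alpha -> 0 <= t ->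
  \int[sector_arc_length alpha]_p
    trial t ((2 * radius_mean t + alpha * bes 0 t) / (2 + alpha)) p = 0.
Proof.
move=> a0 t0; set c := _ / _.
have mt : measurable_fun setT (trial t c : mplane R -> R).
  apply: (open_continuous_mfun openT) => p _.
  exact: (Ck_continuous (@smooth_trial R t c 0%N)).
have [_ ->] := sector_integral (ltW a0) mt (fun p => trial_bound c p t0).
have iF : rint mu `[0, 1] (fun r => bes 0 (t * r ^+ 2)).
  by apply: rint_segment => r _; exact: is_derive_continuous (is_derive_bes_sq t r (lexx 0)).
have len (x y : R) : x <= y -> fine (mu (`[x, y]%classic : set R)) = y - x.
  move=> xy; rewrite lebesgue_measure_itv /= lte_fin; case: ltP => h; first by rewrite -EFinB.
  by have -> : x = y; [apply/eqP; rewrite eq_le xy h|rewrite subrr].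
have cst_int (x y k : R) : x <= y -> \int[mu]_(r in `[x, y]) k = k * (y - x).
  move=> xy; rewrite Rintegral_cst; last exact: measurable_itv.
  by congr (_ * _); exact: (len x y xy).
have ic (a b k : R) : rint mu `[a, b] (fun=> k).
  by apply: rint_segment => r _; exact: cst_continuous.
have ray_int th : \int[mu]_(r in `[0, 1]) trial t c (ray th r) = radius_mean t - c.
  transitivity (\int[mu]_(r in `[0, 1]) (bes 0 (t * r ^+ 2) - c)).
    by apply: eq_Rintegral => r _; rewrite /ray trial_polar.
  have mI : measurable (`[0, 1]%classic : set (measurableTypeR R)) by exact: measurable_itv.
  by rewrite (RintB mI iF (ic _ _ _)) cst_int// subr0 mulr1.
have circ_int : \int[mu]_(th in `[- (alpha / 2), alpha / 2]) trial t c (circle th) =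
    (bes 0 t - c) * alpha.
  transitivity (\int[mu]_(th in `[- (alpha / 2), alpha / 2]) (bes 0 t - c)).
    by apply: eq_Rintegral => th _; rewrite /circle trial_polar expr1n mulr1.
  rewrite cst_int; last by lra.
  by congr (_ * _); field.
rewrite !ray_int circ_int /c; field.
by rewrite gt_eqF// addr_gt0.
Qed.

(** The margin is narrow: the numerator is at least [2 * (11 / 40) - (32 / 25) * (41 / 100) =
    0.0252], against a required [(2 + alpha) / 200], which is at most 0.0164. *)
Lemma trial_constant_lower (alpha t : R) : 0 < alpha -> alpha <= 32 / 25 ->
  183 / 50 < t < 92 / 25 -> bes 1 t = 0 ->
  1 / 200 <= (2 * radius_mean t + alpha * bes 0 t) / (2 + alpha).
Proof.
move=> a0 a_up t12 b1; rewrite ler_pdivlMr; last by rewrite addr_gt0.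
have := radius_mean_lower t12.
have := ler_wpM2l (ltW a0) (bes0_root_lower t12 b1).
by clear t12 b1; lra.
Qed.

(** [32 / 25] is the quotient of the bound [16 / 5] for [pi] by the least order [5 / 2]. *)
Lemma angle_bounds (nu : R) : 5 / 2 <= nu <= 3 -> pi / nu <= 32 / 25 /\ pi / nu / 2 <= pi / 2.
Proof.
move=> /andP[nu1 _]; have nu0 : 0 < nu by lra.
have pi0 := pi_gt0 R; have pi_up := @pi_lt_16_5 R.
split; first by rewrite ler_pdivrMr//; lra.
by rewrite ler_pM2r// ler_pdivrMr// ler_peMr ?ltW//; lra.
Qed.

(** The lower end [183 / 50] keeps [ts] in the range of [bder_root], and [t / k < ts] is the margin
    that makes the Rayleigh quotient fall below [4 * ts]. *)
Lemma choose_spectral_parameter (t k : R) : 183 / 50 < t -> 1 < k ->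
  exists ts, [/\ 183 / 50 <= ts, ts < t & t / k < ts].
Proof.
move=> t1 k1; have t0 : 0 < t by lra.
have tk : t / k < t by rewrite ltr_pdivrMr ?ltr_pMr// (lt_trans ltr01).
have m1 : 183 / 50 <= Num.max (183 / 50) (t / k) by rewrite le_max lexx.
have m2 : t / k <= Num.max (183 / 50) (t / k) by rewrite le_max lexx orbT.
have m3 : Num.max (183 / 50) (t / k) < t by rewrite gt_max t1.
move: m1 m2 m3; set m := Num.max _ _ => m1 m2 m3.
by exists ((m + t) / 2); split; lra.
Qed.

End balance.

Local Close Scope classical_set_scope.

Theorem proposition9p2 (R : realType) :
  exists alpha mu2 : R,
    [/\ 0 < alpha < 2 * pi,
        is_neumann_eigenvalue (sector alpha) 2 mu2,
        (kappa1 (sector alpha) (sector_arc_length alpha) < mu2%:E)%E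
      & forall u : R * R -> R,
          neumann_eigenfunction (sector alpha) mu2 u ->
          odd_in_y (sector alpha) u].
Proof.
have [t0 [t12 b1 bpos]] := @bes1_root R.
have [t00 t0T] : 0 < t0 /\ t0 < 369 / 100 by move: t12 => /andP[? ?]; lra.
(* The gain [k] must be fixed before the angle is known, since the angle depends on it through [ts]
   and [nu]; this is why the lower bound on the trial constant has to be uniform. *)
have [k k1 kc] : exists2 k : R, 1 < k & forall c, 1 / 200 <= c -> k <= 1 + c ^+ 2.
  have h : 0 < 1 / 200 :> R by apply: divr_gt0; rewrite ?ltr01 ?ltr0n.
  exists (1 + (1 / 200) ^+ 2); first by rewrite ltrDl; exact: exprn_gt0.
  move=> c c1; rewrite lerD2l; apply: (lerXn2r 2 _ _ c1); rewrite nnegrE; first exact: ltW.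
  exact: le_trans (ltW h) c1.
have [ts [ts1 tst0 tsk]] := choose_spectral_parameter (proj1 (andP t12)) k1.
have [nu nu_itv nu_ts] := bder_root (andb_true_intro (conj ts1 (ltW (lt_trans tst0 t0T)))).
have nu0 : 0 < nu by move: nu_itv => /andP[? _]; lra.
(* The angle for which the first cosine mode has frequency [nu]. *)
pose alpha := pi / nu.
have a0 : 0 < alpha by rewrite divr_gt0 ?pi_gt0.
have aE : alpha * nu = pi by rewrite /alpha divfK// gt_eqF.
have [a_up a_pi] := angle_bounds nu_itv.
have b0 : 0 < alpha / 2 by rewrite divr_gt0.
have nuE : nu = mode_freq (alpha / 2) 1.
  rewrite /mode_freq mul1r (_ : 2 * (alpha / 2) = alpha); last by field.
  by rewrite -aE mulrAC divff ?mul1r// gt_eqF.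
have ts0 : 0 < ts < t0 by rewrite tst0 andbT; apply: lt_le_trans ts1; apply: divr_gt0; rewrite ltr0n.
have sE := sector_eq_wedge a_pi.
exists alpha, (4 * ts); rewrite sE; split.
- rewrite a0 /=; apply: (@le_lt_trans _ _ pi); last by rewrite ltr_pMl ?pi_gt0// ltr1n.
  by move: a_pi; rewrite ler_pM2r// invr_gt0.
- exact: (second_eigenvalue b0 a_pi nuE nu_itv ts0 t0T nu_ts bpos).
- have c_low := trial_constant_lower a0 a_up t12 b1.
  have c0 := lt_le_trans (divr_gt0 ltr01 (ltr0Sn R 199)) c_low.
  apply: (le_lt_trans (kappa1_le a0 a_pi t00 b1 c0 (trial_boundary_mean a0 (ltW t00)))).
  rewrite lte_fin -mulrA ltr_pM2l//; apply: le_lt_trans tsk.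
  have k0 := lt_trans ltr01 k1; have kc' := kc _ c_low.
  by rewrite ler_pM2l// lef_pV2 ?posrE// (lt_le_trans k0 kc').
- by move=> u hu; exact: (eigenfunction_odd b0 a_pi nuE nu_itv ts0 t0T nu_ts bpos hu).
Qed.
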